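(* Let $G$ be sampled from either the sparse Erdős–Rényi distribution $\mathrm{ER}(n,K/n)$ ($K>0$ fixed) or the Barabási–Albert distribution $\mathrm{BA}(n,m)$ ($m\ge1$ fixed). Let $(T,\bar w)$ be a $k$-rooted graph and $\ell\in\mathbb{N}$. Then for every $(k+1)$-rooted graph $(T',\bar w,y)$ extending $(T,\bar w)$ there is $q_{T'\mid T}\in[0,1]$ such that for all $\epsilon,\theta>0$ there is $N$ such that for all $n\ge N$, with probability at least $1-\theta$, for all $k$-tuples of nodes $\bar u$ with $N^G_\ell(\bar u)\cong(T,\bar w)$, $$\left|\frac{|\{v: N^G_\ell(\bar u,v)\cong(T',\bar w,y)\}|}{n}-q_{T'\mid T}\right|<\epsilon.$$ Moreover $\sum_{T'\in\mathrm{Ext}(T)}q_{T'\mid T}=1$.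
   Context: A $k$-rooted graph $(T,\bar w)$ is a finite graph with a distinguished tuple $\bar w$ of $k$ nodes; isomorphisms of rooted graphs must map roots to roots in order. For a graph $G$ and tuple $\bar u$, $N^G_\ell(\bar u)$ is the $k$-rooted graph, rooted at $\bar u$, given by the induced subgraph on the nodes at distance at most $\ell$ from some $u_i$. A $(k+1)$-rooted graph $(T',\bar w,y)$ extends $(T,\bar w)$ if $T$ is a subgraph of $T'$ (with the same first $k$ roots); $\mathrm{Ext}(T)$ is the set of isomorphism classes of such extensions. $\mathrm{BA}(n,m)$ is the Barabási–Albert preferential attachment model in which each new node attaches $m$ edges. *)

(* Defs.v *)
From HB Require Import structures.
From mathcomp Require Import all_boot all_order all_algebra.
From mathcomp Require Import all_classical all_reals.
From mathcomp Require Import ereal esum.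

Set Implicit Arguments.
Unset Strict Implicit.
Unset Printing Implicit Defensive.

Import Order.TTheory GRing.Theory Num.Theory.
Local Open Scope ring_scope.

(* Graphs on the node set 'I_n: a graph is its set of ordered edge      *)
(* pairs; the random-graph models below only produce symmetric,         *)
(* irreflexive edge sets (simple undirected graphs).                    *)
Definition graph (n : nat) := {set 'I_n * 'I_n}.

Fixpoint within (n : nat) (G : graph n) (l : nat) (u v : 'I_n) : bool :=
  if l is l'.+1 then within G l' u v || [exists w, within G l' u w && ((w, v) \in G)]
  else u == v.

Definition ball (n k : nat) (G : graph n) (l : nat) (u : 'I_k -> 'I_n) : {set 'I_n} :=
  [set v | [exists i, within G l (u i) v]].

Lemma root_in_ball (n k : nat) (G : graph n) (l : nat) (u : 'I_k -> 'I_n) (i : 'I_k) :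
  u i \in ball G l u.
Proof.
rewrite inE; apply/existsP; exists i.
elim: l => [|l IH] /=; first by rewrite eqxx.
by rewrite IH.
Qed.

Definition nbhd_vert (n k : nat) (G : graph n) (l : nat) (u : 'I_k -> 'I_n) :=
  {v : 'I_n | v \in ball G l u}.

Definition nbhd_edge (n k : nat) (G : graph n) (l : nat) (u : 'I_k -> 'I_n) :
  rel (nbhd_vert G l u) := fun x y => (val x, val y) \in G.

Arguments nbhd_edge {n k} G l u.

Definition nbhd_root (n k : nat) (G : graph n) (l : nat) (u : 'I_k -> 'I_n)
  (i : 'I_k) : nbhd_vert G l u := exist _ (u i) (root_in_ball G l u i).

Arguments nbhd_root {n k} G l u i.

Record crg (k : nat) := CRG {
  cn : nat;
  ce : rel 'I_cn;
  ce_sym : symmetric ce;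
  ce_irr : irreflexive ce;
  cr : 'I_k -> 'I_cn }.

Definition rg_iso (k : nat) (V1 V2 : finType) (E1 : rel V1) (r1 : 'I_k -> V1)
  (E2 : rel V2) (r2 : 'I_k -> V2) : Prop :=
  exists f : V1 -> V2, [/\ bijective f, (forall x y, E2 (f x) (f y) = E1 x y)
                         & (forall i, f (r1 i) = r2 i)].

Definition nbhd_iso (n k : nat) (G : graph n) (l : nat) (u : 'I_k -> 'I_n)
  (T : crg k) : Prop :=
  rg_iso (nbhd_edge G l u) (nbhd_root G l u) (@ce k T) (@cr k T).

Definition ext_roots (n k : nat) (u : 'I_k -> 'I_n) (v : 'I_n) : 'I_k.+1 -> 'I_n :=
  fun i => oapp u v (unlift ord_max i).

Definition extends (k : nat) (T : crg k) (T' : crg k.+1) : Prop :=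
  exists f : 'I_(cn T) -> 'I_(cn T'),
    [/\ injective f,
        (forall x y, ce x y -> ce (f x) (f y))
      & (forall i : 'I_k, f (cr T i) = cr T' (widen_ord (leqnSn k) i))].

Local Open Scope classical_set_scope.

Definition iso_class (k : nat) (T : crg k) : set (crg k) :=
  [set S | rg_iso (@ce k S) (@cr k S) (@ce k T) (@cr k T)].

Definition Ext (k : nat) (T : crg k) : set (set (crg k.+1)) :=
  [set C | exists T', extends T T' /\ C = iso_class T'].

Local Close Scope classical_set_scope.

Section Models.
Variable R : realType.

Definition ER_weight (n : nat) (p : R) (G : graph n) : R :=
  if [forall x, forall y, ((x, y) \in G) == ((y, x) \in G)] && [forall x, (x, x) \notin G]
  then \prod_(x : 'I_n) \prod_(y : 'I_n | (x < y)%N) (if (x, y) \in G then p else 1 - p)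
  else 0.

(* Barabasi-Albert BA(n, m), in the Bollobas-Riordan (LCD) formalization:
   run the m = 1 process for m*n steps; at step t the new vertex t sends an
   edge to an earlier vertex i < t w.p. deg_t(i)/(2t+1), or a loop w.p. 1/(2t+1);
   then vertices are merged in consecutive blocks of m (vertex t -> t %/ m).
   The sampled graph is the underlying simple graph (loops and multiple edges
   removed).  A choice sequence c records the target c t of step t. *)
Definition BA_deg (N : nat) (c : {ffun 'I_N -> 'I_N}) (t i : nat) : nat :=
  ((i < t) + #|[set s : 'I_N | (s < t)%N && (nat_of_ord (c s) == i)]|)%N.

Definition BA_weight (N : nat) (c : {ffun 'I_N -> 'I_N}) : R :=
  \prod_(t : 'I_N)
    ((if (c t < t)%N then (BA_deg c t (c t))%:R
      else if nat_of_ord (c t) == nat_of_ord t then 1 else 0) / (2 * t + 1)%:R).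

Definition BA_graph (m n : nat) (c : {ffun 'I_(m * n) -> 'I_(m * n)}) : graph n :=
  [set e : 'I_n * 'I_n | (e.1 != e.2) &&
     [exists t : 'I_(m * n),
        ((t %/ m == e.1) && (c t %/ m == e.2)) || ((t %/ m == e.2) && (c t %/ m == e.1))]%N].

Inductive model := ER_model of R | BA_model of nat.

Definition model_ok (M : model) : Prop :=
  match M with ER_model K => 0 < K | BA_model m => (0 < m)%N end.

Definition Pr (M : model) (n : nat) (A : graph n -> Prop) : R :=
  match M with
  | ER_model K =>
      \sum_(G : graph n | `[< A G >]) ER_weight (Num.min 1 (K / n%:R)) G
  | BA_model m =>
      \sum_(c : {ffun 'I_(m * n) -> 'I_(m * n)} | `[< A (BA_graph c) >]) BA_weight c
  end.

End Models.
Arguments Pr {R} M n A.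
Arguments ER_model {R}.
Arguments BA_model {R}.

(* Main.v *)
Require Import Defs.
From HB Require Import structures.
From mathcomp Require Import all_boot all_order all_algebra.
From mathcomp Require Import all_classical all_reals.
From mathcomp Require Import ereal esum topology normedtype sequences exp.
From mathcomp Require Import lra zify.
(* Imported again so that [ball] is not the topological one. *)
Require Import Defs.
Set Implicit Arguments.
Unset Strict Implicit.
Unset Printing Implicit Defensive.
Import Order.TTheory GRing.Theory Num.Theory.
Import numFieldNormedType.Exports.
Local Open Scope ring_scope.

(* In both models [E (sum_v d(v) g(d(v))) = O(n)] for some nondecreasing unbounded [g].  Hence,
   with high probability, few nodes come within bounded distance of a node of large degree,
   and all balls of a fixed radius have [o(n)] nodes.  So for every [u] the ball around
   [(u, v)] is, for all but [o(n)] nodes [v], the disjoint union of the balls around [u] and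
   around [v], and it suffices to show that the frequency of each type of node converges in
   probability, a type being a code that determines the ball up to isomorphism; finitely many
   types cover almost all nodes, so no mass is lost in the limit.

   In the Erdos-Renyi graph the type is the sorted adjacency matrix of the ball together with
   the set of its inner positions; the first moment is explicit and the second moment splits
   into disjoint pairs of balls, which are almost independent, and intersecting pairs, of
   which there are [o(n^2)].

   In the Barabasi-Albert graph the type also records the order of all attachments to the
   nodes of the ball, hence their degrees.  For such decorated patterns the conditional
   expectation of the number of occurrences after one more node is a linear function of
   numbers of occurrences of smaller patterns, and stochastic approximation in L2 shows by
   induction that the count divided by [n ^ (number of components)] converges in L1. *)

(** * Balls and degrees *)

(** A class that is not a disjoint union of [T] with a rooted ball gets limit 0. Gluing is done
    abstractly, so the limits sum to 1 even if [T] never occurs as a ball.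

    The decorations of the types make counting exact: they certify that no neighbour of an inner
    node is missing, so the nodes of a type correspond one to one to the node sets or lists that
    carry its code. No exploration of balls has to be analysed.

    Nor can the recursion stay among connected patterns, since undoing an edge may split a
    component. Hence all patterns are counted, with one factor [n] per component, and the
    probability of order [1/n] of hitting a given vertex pays for the additional factor. Because a
    pattern contains its degrees, the a priori bounds on counts and increments are deterministic,
    although the degrees of the graph are unbounded. *)

Definition simple_graph n (G : graph n) :=
  (forall x y, (x, y) \in G -> (y, x) \in G) /\ forall x, (x, x) \notin G.

Section Distance.
Variables (n : nat) (G : graph n).
Hypothesis symG : forall x y, (x, y) \in G -> (y, x) \in G.

Lemma within_refl l u : within G l u u.
Proof. by elim: l => [|l IH] /=; rewrite ?eqxx ?IH. Qed.

Lemma withinS l u v : within G l u v -> within G l.+1 u v.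
Proof. by move=> /= ->. Qed.

Lemma within_leq l l' u v : (l <= l')%N -> within G l u v -> within G l' u v.
Proof.
move=> /subnK <-; elim: (l' - l)%N => // d IH h.
by rewrite addSn withinS // IH.
Qed.

Lemma within_edge l u w v :
  within G l u w -> (w, v) \in G -> within G l.+1 u v.
Proof.
by move=> h1 h2 /=; apply/orP; right; apply/existsP; exists w; rewrite h1.
Qed.

Lemma within_trans a b u v w :
  within G a u v -> within G b v w -> within G (a + b) u w.
Proof.
elim: b w => [|b IH] w h; first by rewrite addn0 => /eqP <-.
rewrite addnS => /= /orP[/(IH _ h) -> //|/existsP[x /andP[hx xw]]].
by apply: (within_edge (w := x)) => //; apply: IH.
Qed.

Lemma within1 u v : (u, v) \in G -> within G 1 u v.
Proof. by apply: within_edge; rewrite /= eqxx. Qed.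

Lemma within_sym l u v : within G l u v -> within G l v u.
Proof.
elim: l v => [|l IH] v /=; first by move/eqP->; rewrite eqxx.
case/orP=> [/IH -> //|/existsP[w /andP[/IH h wv]]].
by apply: (within_trans (a := 1) (b := l) _ h); apply: within1; apply: symG.
Qed.

Lemma within_left l u v : within G l.+1 u v ->
  within G l u v \/ exists2 w, (u, w) \in G & within G l w v.
Proof.
move/within_sym => /= /orP[/within_sym|/existsP[w /andP[h e]]]; first by left.
by right; exists w; [apply: symG | apply: within_sym].
Qed.

Variable dg : 'I_n -> nat.
Hypothesis dgP : forall x, (#|[set y | (x, y) \in G]| <= dg x)%N.

(** Since [dg] only bounds the degrees from above, it may later be the multigraph degree of the
    attachment process. *)
Definition tame (D r : nat) (v : 'I_n) :=
  [forall y, within G r v y ==> (dg y <= D)%N].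

Lemma tameP D r v : reflect (forall y, within G r v y -> (dg y <= D)%N) (tame D r v).
Proof.
apply: (iffP forallP) => h y; first by move/implyP: (h y).
by apply/implyP; apply: h.
Qed.

Lemma card_bigcup_leq (I : finType) (A : {set I}) (F : I -> {set 'I_n}) D :
  (forall i, i \in A -> #|F i| <= D)%N -> (#|\bigcup_(i in A) F i| <= #|A| * D)%N.
Proof.
move=> h; rewrite -sum_nat_const.
apply: (@leq_trans (\sum_(i in A) #|F i|)%N); last exact: leq_sum.
elim/big_rec2: _ => [|i k B _ IH]; first by rewrite cards0.
by apply: leq_trans (leq_card_setU _ _) _; rewrite leq_add2l.
Qed.

Lemma card_tame_ball D r v : tame D r v ->
  (#|[set x | within G r.+1 v x]| <= D.+1 ^ r.+1)%N.
Proof.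
have gen q : tame D q v -> (#|[set x | within G q v x]| <= D.+1 ^ q)%N ->
    (#|[set x | within G q.+1 v x]| <= D.+1 ^ q.+1)%N.
  move=> /tameP t h.
  have sub : [set x | within G q.+1 v x] \subset [set x | within G q v x] :|:
       \bigcup_(w in [set x | within G q v x]) [set y | (w, y) \in G].
    apply/fintype.subsetP => x; rewrite !inE /= => /orP[->//|/existsP[w /andP[h1 h2]]].
    by apply/orP; right; apply/bigcupP; exists w; rewrite !inE.
  apply: leq_trans (subset_leq_card sub) _.
  apply: leq_trans (leq_card_setU _ _) _.
  apply: (@leq_trans (#|[set x | within G q v x]| * D.+1)); last first.
    by rewrite expnSr leq_mul2r h orbT.
  rewrite mulnS leq_add2l; apply: card_bigcup_leq => i; rewrite inE => hi.
  exact: leq_trans (dgP i) (t i hi).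
elim: r => [|r IH] t.
  apply: gen => //; rewrite expn0 -(cards1 v); apply: subset_leq_card.
  by apply/fintype.subsetP => x; rewrite !inE /= eq_sym.
apply: gen => //; apply: IH.
by apply/tameP => y hy; move/tameP: t; apply; apply: withinS.
Qed.

(** Tameness of [v] may stop one step short of [x]: leaving [x] costs [dg x], and only the remaining
    [r] steps cost [D]. *)
Lemma card_tame_reach D r x :
  (#|[set v | within G r.+1 v x && tame D r v]| <= (dg x).+1 * D.+1 ^ r)%N.
Proof.
elim: r => [|r IH].
  rewrite expn0 muln1.
  apply: (@leq_trans (#|x |: [set y | (x, y) \in G]|)).
    apply: subset_leq_card; apply/fintype.subsetP => v; rewrite !inE => /andP[+ _].
    case/within_left => [/eqP->|[w vw /eqP <-]]; first by rewrite eqxx.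
    by rewrite (symG vw) orbT.
  rewrite cardsU1; apply: leq_add (leq_b1 _) (dgP x).
set S := [set v | within G r.+1 v x && tame D r v].
have sub : [set v | within G r.+2 v x && tame D r.+1 v] \subset
    S :|: \bigcup_(w in [set w in S | (dg w <= D)%N]) [set y | (w, y) \in G].
  apply/fintype.subsetP => v; rewrite !inE => /andP[+ /tameP t].
  have t' : tame D r v by apply/tameP => y hy; apply/t/withinS.
  case/within_left => [-> |[w vw wx]]; first by rewrite t'.
  apply/orP; right; apply/bigcupP; exists w; rewrite !inE ?(symG vw) //.
  have vw1 := within1 vw.
  rewrite wx /= (t w (within_leq _ vw1)) // andbT; apply/tameP => y wy.
  by apply: t; apply: (within_trans (a := 1) vw1 wy).
apply: leq_trans (subset_leq_card sub) _.
apply: leq_trans (leq_card_setU _ _) _.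
apply: (@leq_trans (#|S| * D.+1)); last by rewrite expnSr mulnA leq_mul2r IH orbT.
rewrite mulnS leq_add2l.
apply: (@leq_trans (#|[set w in S | (dg w <= D)%N]| * D)).
  apply: card_bigcup_leq => i; rewrite !inE => /andP[_ hi].
  exact: leq_trans (dgP i) hi.
by rewrite leq_mul2r; apply/orP; right; apply: subset_leq_card; apply/fintype.subsetP => y;
  rewrite inE => /andP[].
Qed.

Definition nwild D r := #|[set v | ~~ tame D r v]|.
Definition heavy D := (\sum_(x | (D < dg x)%N) dg x)%N.

Lemma nwild0 D : (nwild D 0 <= heavy D)%N.
Proof.
rewrite /nwild /heavy -sum1_card.
rewrite (eq_bigl (fun x => (D < dg x)%N)); last first.
  move=> x; rewrite inE; apply/idP/idP.
    apply: contraNT; rewrite -leqNgt => h; apply/tameP => y /eqP <- //.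
  by apply: contraL => /tameP/(_ x (within_refl 0 x)); rewrite leqNgt.
by apply: leq_sum => x; apply: leq_trans.
Qed.

(** A node that is tame for [D] and [r] but not for [D'] and [r.+1] is charged to some [x] with
    [D' < dg x] within distance [r.+1]. By [card_tame_reach] such an [x] receives at most
    [(dg x).+1 * D.+1 ^ r] charges. *)
Lemma nwildS D D' r : (D <= D')%N ->
  (nwild D' r.+1 <= nwild D r + 2 * D.+1 ^ r * heavy D')%N.
Proof.
move=> DD'.
pose S x := [set v | within G r.+1 v x && tame D r v].
have sub : [set v | ~~ tame D' r.+1 v] \subset
   [set v | ~~ tame D r v] :|: \bigcup_(x in [set x | (D' < dg x)%N]) S x.
  apply/fintype.subsetP => v; rewrite !inE negb_forall => /existsP[x].
  rewrite negb_imply -ltnNge => /andP[h1 h2].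
  case: (boolP (tame D r v)) => //= t; apply/bigcupP; exists x; rewrite inE //.
  by rewrite t andbT.
apply: leq_trans (subset_leq_card sub) _.
apply: leq_trans (leq_card_setU _ _) _; rewrite leq_add2l.
apply: (@leq_trans (\sum_(x in [set x | (D' < dg x)%N]) #|S x|)%N).
  elim/big_rec2: _ => [|i k B _ IH]; first by rewrite cards0.
  by apply: leq_trans (leq_card_setU _ _) _; rewrite leq_add2l.
rewrite /heavy big_distrr /=.
under eq_bigl do rewrite inE.
apply: leq_sum => x hx; apply: leq_trans (card_tame_reach D r x) _.
by rewrite [leqRHS]mulnAC leq_mul2r; apply/orP; right; lia.
Qed.

(** Either [dg x] is at most [D1] or it is a single summand of [heavy D1]. With [D1] so large that
    [heavy D1] is a small fraction of [n], this treats all [x] at once. *)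
Lemma card_reach_leq D D1 r x :
  (#|[set v | within G r v x]| <= nwild D r + (D1 + heavy D1).+1 * D.+1 ^ r)%N.
Proof.
apply: (@leq_trans (#|[set v | ~~ tame D r v] :|: [set v | within G r.+1 v x && tame D r v]|)).
  apply: subset_leq_card; apply/fintype.subsetP => v; rewrite !inE => h.
  by rewrite withinS // orNb.
apply: leq_trans (leq_card_setU _ _) _; rewrite leq_add2l.
apply: leq_trans (card_tame_reach D r x) _.
rewrite leq_mul2r ltnS; apply/orP; right.
case: (leqP (dg x) D1) => h; first by apply: leq_trans h _; rewrite leq_addr.
apply: leq_trans _ (leq_addl _ _).
by rewrite /heavy (bigD1 x) //= leq_addr.
Qed.

End Distance.

(** * Frequencies of node properties *)

Section Frequency.
Variable R : realType.

Definition freq n (A : 'I_n -> Prop) : R :=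
  #|[set v : 'I_n | `[< A v >]]|%:R / n%:R.

Lemma freqE n (A : 'I_n -> Prop) : freq A = (\sum_v (`[< A v >])%:R) / n%:R.
Proof.
rewrite /freq -sum1_card natr_sum; congr (_ / _).
rewrite big_mkcond /=; apply: eq_bigr => v _; rewrite inE.
by case: `[< _ >].
Qed.

Lemma freq_ge0 n (A : 'I_n -> Prop) : 0 <= freq A.
Proof. by rewrite /freq divr_ge0. Qed.

Lemma freq_le1 n (A : 'I_n -> Prop) : freq A <= 1.
Proof.
rewrite /freq; case: n A => [|n] A; first by rewrite invr0 mulr0 ler01.
by rewrite ler_pdivrMr // mul1r ler_nat -[leqRHS]card_ord max_card.
Qed.

Lemma freq_leD n (A B C : 'I_n -> Prop) :
  (forall v, A v -> B v \/ C v) -> freq A <= freq B + freq C.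
Proof.
move=> h; rewrite /freq -mulrDl ler_wpM2r // -natrD ler_nat.
apply: leq_trans (leq_card_setU _ _); apply: subset_leq_card.
apply/fintype.subsetP => v; rewrite !inE => Av; case: (h v Av) => h1.
  by rewrite asboolT.
by rewrite [X in _ || X]asboolT ?orbT.
Qed.

Lemma freq_le n (A B : 'I_n -> Prop) : (forall v, A v -> B v) -> freq A <= freq B.
Proof.
move=> h; rewrite /freq ler_wpM2r // ler_nat; apply: subset_leq_card.
by apply/fintype.subsetP => v; rewrite !inE; apply: h.
Qed.

Lemma freq_eq n (A B : 'I_n -> Prop) : (forall v, A v <-> B v) -> freq A = freq B.
Proof. by move=> h; apply/eqP; rewrite eq_le !freq_le // => v /h. Qed.

Lemma freq_leC n (A B : 'I_n -> Prop) : (0 < n)%N ->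
  (forall v, A v \/ B v) -> 1 - freq A <= freq B.
Proof.
move=> n0 h; rewrite lerBlDl; have <- : freq (fun _ : 'I_n => True) = 1.
  rewrite freqE (eq_bigr (fun=> 1)); last by move=> v _; rewrite asboolT.
  by rewrite sumr_const card_ord divff // pnatr_eq0 -lt0n.
by apply: freq_leD => v _.
Qed.

Lemma freq_sum_le (I : eqType) n (s : seq I) (A : I -> 'I_n -> Prop) (B : 'I_n -> Prop) :
  uniq s -> (forall i j v, i \in s -> j \in s -> A i v -> A j v -> i = j) ->
  (forall i v, i \in s -> A i v -> B v) ->
  \sum_(i <- s) freq (A i) <= freq B.
Proof.
move=> us h hB.
suff -> : \sum_(i <- s) freq (A i) = freq (fun v => exists2 i, i \in s & A i v).
  by apply: freq_le => v [i si]; apply: hB.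
under eq_bigr do rewrite freqE.
rewrite -mulr_suml exchange_big freqE /=; congr (_ / _); apply: eq_bigr => v _.
case: (boolP (has (fun i => `[< A i v >]) s)) => [/hasP[i si /asboolP Ai]|/hasPn nA].
  rewrite (bigD1_seq i) //= !asboolT //; last by exists i.
  rewrite big_seq_cond big1 ?addr0 // => j /andP[sj ji].
  rewrite asboolF // => Aj; case/eqP: ji; exact: h Aj Ai.
rewrite [in RHS]asboolF; last by move=> [i /nA /negP + Ai]; apply; apply/asboolP.
by rewrite big_seq big1 // => i /nA /negbTE ->.
Qed.

Lemma freq_le_sum (I : eqType) n (s : seq I) (B : 'I_n -> Prop) (A : I -> 'I_n -> Prop) :
  (forall v, B v -> exists2 i, i \in s & A i v) ->
  freq B <= \sum_(i <- s) freq (A i).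
Proof.
elim: s B => [|i s IH] B h.
  rewrite big_nil; have -> : freq B = freq (fun _ : 'I_n => False).
    by apply: freq_eq => v; split => // /h[].
  by rewrite freqE big1 ?mul0r // => v _; rewrite asboolF.
rewrite big_cons.
apply: (@le_trans _ _ (freq (A i) + freq (fun v => B v /\ ~ A i v))).
  by apply: freq_leD => v Bv; case: (pselect (A i v)); [left|right].
rewrite lerD2l; apply: IH => v [/h[j]]; rewrite inE => /orP[/eqP->|sj] Aj nA //.
by exists j.
Qed.

End Frequency.

(** * Convergence in probability *)

Section Likely.
Variables (R : realType) (Om : nat -> finType) (mu : forall n, Om n -> R).
Arguments mu {n}.
Hypothesis mu_ge0 : forall n (w : Om n), 0 <= mu w.
Hypothesis mu_sum : forall n, \sum_(w : Om n) mu w = 1.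

Definition prob n (A : Om n -> Prop) : R := \sum_(w | `[< A w >]) mu w.
Definition Ex n (f : Om n -> R) : R := \sum_w mu w * f w.

Definition likely (th : R) (A : forall n, Om n -> Prop) :=
  exists N, forall n, (N <= n)%N -> 1 - th <= prob (@A n).

Lemma prob_le n (A B : Om n -> Prop) : (forall w, A w -> B w) -> prob A <= prob B.
Proof.
move=> h; rewrite /prob big_mkcond [leRHS]big_mkcond /=; apply: ler_sum => w _.
case: asboolP => [Aw|_]; first by rewrite asboolT //; apply: h.
by case: ifP.
Qed.

Lemma probC n (A : Om n -> Prop) : prob (fun w => ~ A w) = 1 - prob A.
Proof.
apply/eqP; rewrite eq_sym subr_eq addrC -(mu_sum n) (bigID (fun w => `[< A w >])) /=.
apply/eqP; congr (_ + _); apply: eq_bigl => w; exact/asboolPn/asboolP.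
Qed.

Lemma probU n (A B : Om n -> Prop) : prob (fun w => A w \/ B w) <= prob A + prob B.
Proof.
rewrite /prob big_mkcond [X in _ <= X + _]big_mkcond [X in _ <= _ + X]big_mkcond /=.
rewrite -big_split /=; apply: ler_sum => w _.
case: asboolP => [[]/asboolP ->|_]; rewrite ?lerDl ?lerDr; last (apply: addr_ge0).
all: by case: ifP.
Qed.

Lemma likelyP th (A : forall n, Om n -> Prop) : likely th A <->
  exists N, forall n, (N <= n)%N -> prob (fun w => ~ A n w) <= th.
Proof.
split=> -[N h]; exists N => n /h; rewrite probC; first by rewrite lerBlDl lerBlDr addrC.
by rewrite lerBlDl lerBlDr addrC.
Qed.

Lemma likely_le th th' (A : forall n, Om n -> Prop) :
  th <= th' -> likely th A -> likely th' A.
Proof. by move=> h [N hN]; exists N => n /hN; apply: le_trans; rewrite lerB. Qed.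

Lemma likely_mono th N (A B : forall n, Om n -> Prop) :
  (forall n w, (N <= n)%N -> A n w -> B n w) -> likely th A -> likely th B.
Proof.
move=> h [N' hN']; exists (maxn N N') => n; rewrite geq_max => /andP[h1 /hN'].
by move/le_trans; apply; apply: prob_le => w; apply: h.
Qed.

Lemma likely_and th th' (A B : forall n, Om n -> Prop) :
  likely th A -> likely th' B -> likely (th + th') (fun n w => A n w /\ B n w).
Proof.
move=> /likelyP[N hN] /likelyP[N' hN']; apply/likelyP.
exists (maxn N N') => n; rewrite geq_max => /andP[/hN h /hN' h'].
apply: le_trans (lerD h h'); apply: le_trans (probU _ _).
by apply: prob_le => w /not_andP.
Qed.

Lemma likely_all (I : eqType) (s : seq I) (A : I -> forall n, Om n -> Prop) th :
  0 < th -> (forall i, i \in s -> forall th', 0 < th' -> likely th' (A i)) ->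
  likely th (fun n w => forall i, i \in s -> A i n w).
Proof.
elim: s th => [|i s IH] th th0 h.
  exists 0%N => n _; rewrite (_ : prob _ = 1); first by rewrite gerBl ltW.
  by rewrite -(mu_sum n); apply: eq_bigl => w; apply/asboolP.
have t2 : 0 < th / 2 by rewrite divr_gt0.
have h1 := h i (mem_head _ _) _ t2.
have h2 : likely (th / 2) (fun n w => forall i, i \in s -> A i n w).
  by apply: IH => // j sj; apply: h; rewrite inE sj orbT.
apply: likely_le (likely_mono (N := 0) _ (likely_and h1 h2)); first lra.
by move=> n w _ [h3 h4] j; rewrite inE => /orP[/eqP->//|/h4].
Qed.

Lemma likely_ex th (A : forall n, Om n -> Prop) : th < 1 -> likely th A ->
  exists N, forall n, (N <= n)%N -> exists w, A n w.
Proof.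
move=> th1 [N hN]; exists N => n /hN h; apply: contrapT => nA.
have : prob (@A n) = 0.
  by apply: big1 => w /asboolP Aw; case: nA; exists w.
by move=> e; move: h; rewrite e subr_le0 leNgt th1.
Qed.

Lemma Ex_le n (f g : Om n -> R) : (forall w, f w <= g w) -> Ex f <= Ex g.
Proof. by move=> h; apply: ler_sum => w _; rewrite ler_wpM2l. Qed.

Lemma markov n (f : Om n -> R) e : (forall w, 0 <= f w) -> 0 < e ->
  prob (fun w => ~ (f w <= e)) <= Ex f / e.
Proof.
move=> f0 e0; rewrite ler_pdivlMr // /prob /Ex big_mkcond mulr_suml.
apply: ler_sum => w _; case: asboolP => [/negP|_]; last by rewrite mul0r mulr_ge0.
by rewrite -ltNge => h; rewrite ler_wpM2l // ltW.
Qed.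

Lemma likely_markov (f : forall n, Om n -> R) (e th : R) N :
  (forall n w, 0 <= f n w) -> 0 < e ->
  (forall n, (N <= n)%N -> Ex (f n) <= e * th) -> likely th (fun n w => f n w <= e).
Proof.
move=> f0 e0 h; apply/likelyP; exists N => n /h h1.
by apply: le_trans (markov (f0 n) e0) _; rewrite ler_pdivrMr // mulrC.
Qed.

Definition conv_prob (Z : forall n, Om n -> R) (q : R) :=
  forall eps th, 0 < eps -> 0 < th -> likely th (fun n w => `|Z n w - q| <= eps).

Lemma conv_prob_cst (Z : forall n, Om n -> R) (q : R) :
  (forall n w, Z n w = q) -> conv_prob Z q.
Proof.
move=> h eps th e0 t0; exists 0%N => n _.
rewrite (_ : prob _ = 1); first by rewrite gerBl ltW.
by rewrite -[RHS](mu_sum n); apply: eq_bigl => w; apply/asboolP; rewrite h subrr normr0 ltW.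
Qed.

(** A Cauchy criterion: the centre [a] may depend on the precision. *)
Lemma conv_prob_cauchy (Z : forall n, Om n -> R) :
  (forall eps th, 0 < eps -> 0 < th ->
     exists a, likely th (fun n w => `|Z n w - a| <= eps)) ->
  exists q, conv_prob Z q.
Proof.
move=> h.
(* Two events of failure probability 1/4 meet for large [n]. Hence the intervals [[a - e, a + e]]
   with [near a e] intersect pairwise, and the supremum of their left ends lies in all of them. *)
pose near a e := likely (4^-1) (fun n w => `|Z n w - a| <= e).
have nearP a a' e e' th : th < 1 / 2 -> near a e ->
    likely th (fun n w => `|Z n w - a'| <= e') -> `|a - a'| <= e + e'.
  move=> th2 h1 h2; have [|N /(_ N (leqnn _))[w]] := likely_ex _ (likely_and h1 h2); first lra.
  move=> [h3 h4]; rewrite (_ : a - a' = (Z N w - a') - (Z N w - a)); last by lra.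
  by apply: le_trans (ler_normB _ _) _; lra.
have f4 : 0 < 4^-1 :> R by rewrite invr_gt0.
pose E := [set x | exists a e, near a e /\ x = a - e]%classic.
have Eub a e : near a e -> ubound E (a + e).
  move=> h1 x [a' [e' [h2 ->]]]; have t12 : 4^-1 < 1 / 2 :> R by lra.
  have /ler_normlP := nearP _ _ _ _ _ t12 h1 h2; case.
  by lra.
have En : (E !=set0)%classic by have [a ha] := h 1 _ ltr01 f4; exists (a - 1), a, 1.
have supE a e : near a e -> `|a - sup E| <= e.
  move=> h1; have h2 : has_sup E by split => //; exists (a + e); exact: Eub.
  have l1 : sup E <= a + e by apply: ge_sup => //; exact: Eub.
  have l2 : a - e <= sup E by apply: ub_le_sup; [case: h2|exists a, e].
  by apply/ler_normlP; split; lra.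
exists (sup E) => eps th e0 th0.
have e2 : 0 < eps / 2 by rewrite divr_gt0.
have t0 : 0 < Num.min th (4^-1) by rewrite lt_min th0.
have [a ha] := h _ _ e2 t0.
have h1 : near a (eps / 2) by apply: likely_le ha; rewrite ge_min lexx orbT.
have h2 := supE _ _ h1.
apply: likely_le (likely_mono (N := 0) _ ha); first by rewrite ge_min lexx.
move=> n w _ h3; rewrite (_ : _ - _ = (Z n w - a) + (a - sup E)); last by lra.
by apply: le_trans (ler_normD _ _) _; lra.
Qed.

(** Infinitely many types may satisfy [a]. Tightness reduces them to a finite list, and its sum of
    limits is the centre required by [conv_prob_cauchy]. *)
Lemma conv_prob_types (tau : eqType) (typ : forall n, Om n -> 'I_n -> tau) :
  (forall t, exists q, conv_prob (fun n w => freq R (fun v => typ n w v = t)) q) ->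
  (forall eps th, 0 < eps -> 0 < th -> exists L : seq tau,
     likely th (fun n w => freq R (fun v => typ n w v \notin L) <= eps)) ->
  forall a : tau -> Prop,
    exists q, conv_prob (fun n w => freq R (fun v => a (typ n w v))) q.
Proof.
move=> h1 h2 a; apply: conv_prob_cauchy => eps th e0 th0.
have [q hq] := choice h1.
have e2 : 0 < eps / 2 by rewrite divr_gt0.
have t2 : 0 < th / 2 by rewrite divr_gt0.
have [L0 hL0] := h2 _ _ e2 t2.
pose L := [seq t <- undup L0 | `[< a t >]].
exists (\sum_(t <- L) q t).
(* The successor keeps the denominator nonzero for an empty list. *)
pose d := eps / 2 / (size L).+1%:R.
have d0 : 0 < d by rewrite divr_gt0.
have h3 : likely (th / 2) (fun n w => forall t, t \in L ->
    `|freq R (fun v => typ n w v = t) - q t| <= d).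
  by apply: likely_all => // t _ th' th'0; apply: hq.
apply: likely_le (likely_mono (N := 0) _ (likely_and hL0 h3)); first lra.
move=> n w _ [h4 h5].
set F := freq _ _ in h4.
have h6 : \sum_(t <- L) freq R (fun v => typ n w v = t) <= freq R (fun v => a (typ n w v)).
  apply: freq_sum_le.
  - exact/filter_uniq/undup_uniq.
  - by move=> i j v _ _ -> ->.
  - by move=> i v; rewrite mem_filter => /andP[/asboolP ai _] ->.
have h7 : freq R (fun v => a (typ n w v)) <= \sum_(t <- L) freq R (fun v => typ n w v = t) + F.
  apply: (@le_trans _ _ (freq R (fun v => a (typ n w v) /\ typ n w v \in L0) + F)).
    by apply: freq_leD => v av; case: (boolP (typ n w v \in L0)); [left|right].
  rewrite lerD2r; apply: freq_le_sum => v [av lv]; exists (typ n w v) => //.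
  by rewrite mem_filter asboolT //= mem_undup.
have h8 : `|\sum_(t <- L) freq R (fun v => typ n w v = t) - \sum_(t <- L) q t| <= eps / 2.
  rewrite -sumrB; apply: le_trans (ler_norm_sum _ _ _) _.
  apply: (@le_trans _ _ (\sum_(t <- L) d)).
    by rewrite big_seq [leRHS]big_seq; apply: ler_sum => t /h5.
  rewrite big_const_seq count_predT iter_addr_0 /d -[X in X <= _]mulr_natr -mulrA.
  rewrite ler_piMr ?(ltW e2) // mulrC ler_pdivrMr // mul1r ler_nat //.
move/ler_normlP: h8 => [h8 h9]; apply/ler_normlP; split; lra.
Qed.

End Likely.

(** * Unordered sums equal to 1 *)

Section EsumOne.
Variable R : realType.

Lemma esum_eq1 (T : choiceType) (S : set T) (q : T -> R) :
  (forall s : seq T, uniq s -> (forall x, x \in s -> S x) -> \sum_(x <- s) q x <= 1) ->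
  (forall e, 0 < e -> exists s : seq T,
     [/\ uniq s, (forall x, x \in s -> S x) & 1 - e <= \sum_(x <- s) q x]) ->
  (\esum_(x in S) (q x)%:E = 1)%E.
Proof.
move=> h1 h2; apply/eqP; rewrite eq_le; apply/andP; split.
  apply: ge_ereal_sup => _ [A [finA AS] <-].
  rewrite fsbig_finite // sumEFin lee_fin; apply: h1; first exact: finmap.fset_uniq.
  by move=> x; rewrite in_fset_set // => /set_mem /AS.
apply/lee_addgt0Pr => e e0; have [s [us sS hs]] := h2 e e0.
rewrite -leeBlDr // -EFinB; apply: esum_ge; exists [set` s]%classic.
  by split => [|x /= /sS].
by rewrite -fsbig_seq // sumEFin lee_fin.
Qed.

End EsumOne.

(** * Isomorphisms and disjoint unions of rooted graphs *)

Section RootedGraphs.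

Lemma rg_iso_refl k (V : finType) (E : rel V) (r : 'I_k -> V) : rg_iso E r E r.
Proof. by exists id; split => //; exists id. Qed.

Lemma rg_iso_sym k (V1 V2 : finType) (E1 : rel V1) (E2 : rel V2)
  (r1 : 'I_k -> V1) (r2 : 'I_k -> V2) : rg_iso E1 r1 E2 r2 -> rg_iso E2 r2 E1 r1.
Proof.
move=> [f [[g fK gK] fE fr]]; exists g; split; first by exists f.
  by move=> x y; rewrite -fE !gK.
by move=> i; rewrite -fr fK.
Qed.

Lemma rg_iso_trans k (V1 V2 V3 : finType) (E1 : rel V1) (E2 : rel V2) (E3 : rel V3)
  (r1 : 'I_k -> V1) (r2 : 'I_k -> V2) (r3 : 'I_k -> V3) :
  rg_iso E1 r1 E2 r2 -> rg_iso E2 r2 E3 r3 -> rg_iso E1 r1 E3 r3.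
Proof.
move=> [f [fb fE fr]] [g [gb gE gr]]; exists (g \o f); split.
- exact: bij_comp.
- by move=> x y /=; rewrite gE fE.
- by move=> i /=; rewrite fr gr.
Qed.

Lemma iso_classP k (S S' : crg k) :
  rg_iso (@ce k S) (@cr k S) (@ce k S') (@cr k S') -> iso_class S = iso_class S'.
Proof.
move=> h; apply/seteqP; split => X /= hX; first exact: rg_iso_trans hX h.
exact: rg_iso_trans hX (rg_iso_sym h).
Qed.

Section CrgOf.
Variables (k : nat) (V : finType) (E : rel V) (r : 'I_k -> V).
Hypotheses (Es : symmetric E) (Ei : irreflexive E).

Let e (i j : 'I_#|V|) := E (enum_val i) (enum_val j).
Let e_sym : symmetric e. Proof. by move=> i j; apply: Es. Qed.
Let e_irr : irreflexive e. Proof. by move=> i; apply: Ei. Qed.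

Definition crg_of : crg k := CRG e_sym e_irr (fun i => enum_rank (r i)).

Lemma crg_of_iso : rg_iso E r (@ce k crg_of) (@cr k crg_of).
Proof.
exists enum_rank; split => [|x y|//].
  by exists enum_val; [apply: enum_rankK|apply: enum_valK].
by rewrite /= /e !enum_rankK.
Qed.

End CrgOf.

Section Sum.
Variables (k : nat) (V1 V2 : finType) (E1 : rel V1) (E2 : rel V2).
Variables (r1 : 'I_k -> V1) (y : V2).

Definition sum_edge : rel (V1 + V2)%type := fun a b =>
  match a, b with inl x, inl x' => E1 x x' | inr x, inr x' => E2 x x' | _, _ => false end.

Definition sum_root (i : 'I_k.+1) : (V1 + V2)%type :=
  oapp (fun j => inl (r1 j)) (inr y) (unlift ord_max i).

Lemma sum_edge_sym : symmetric E1 -> symmetric E2 -> symmetric sum_edge.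
Proof. by move=> h1 h2 [a|a] [b|b] /=. Qed.

Lemma sum_edge_irr : irreflexive E1 -> irreflexive E2 -> irreflexive sum_edge.
Proof. by move=> h1 h2 [a|a] /=. Qed.

End Sum.

Lemma sum_iso k (V1 V2 W1 W2 : finType) (E1 : rel V1) (E2 : rel V2) (F1 : rel W1) (F2 : rel W2)
  (r1 : 'I_k -> V1) (s1 : 'I_k -> W1) (y : 'I_1 -> V2) (z : 'I_1 -> W2) :
  rg_iso E1 r1 F1 s1 -> rg_iso E2 y F2 z ->
  rg_iso (sum_edge E1 E2) (sum_root r1 (y ord0)) (sum_edge F1 F2) (sum_root s1 (z ord0)).
Proof.
move=> [f [[f' fK f'K] fE fr]] [g [[g' gK g'K] gE gr]].
exists (fun a => match a with inl x => inl (f x) | inr x => inr (g x) end); split.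
- exists (fun a => match a with inl x => inl (f' x) | inr x => inr (g' x) end).
    by move=> [a|a]; rewrite ?fK ?gK.
  by move=> [a|a]; rewrite ?f'K ?g'K.
- by move=> [a|a] [b|b] /=.
- by move=> i; rewrite /sum_root; case: unlift => [j|] /=; rewrite ?fr ?gr.
Qed.

Lemma inj_surj_bij (A B : Type) (f : A -> B) :
  injective f -> (forall b, exists a, f a = b) -> bijective f.
Proof.
by move=> fi /choice[g gK]; exists g => // a; apply: fi.
Qed.

(** A distance above [l + l] makes the two balls disjoint; the additional 1 excludes an edge between
    them. *)
Lemma far_nbhd_iso n (G : graph n) l k (u : 'I_k -> 'I_n) (v : 'I_n) :
  simple_graph G -> (forall i, ~~ within G (l + l).+1 (u i) v) ->
  rg_iso (sum_edge (nbhd_edge G l u) (nbhd_edge G l (fun _ : 'I_1 => v)))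
         (sum_root (nbhd_root G l u) (nbhd_root G l (fun _ : 'I_1 => v) ord0))
         (nbhd_edge G l (ext_roots u v)) (nbhd_root G l (ext_roots u v)).
Proof.
move=> [sG _] far.
have in1 (x : nbhd_vert G l u) : val x \in ball G l (ext_roots u v).
  have := valP x; rewrite !inE => /existsP[i hi]; apply/existsP.
  exists (lift ord_max i); by rewrite /ext_roots liftK.
have in2 (x : nbhd_vert G l (fun _ : 'I_1 => v)) : val x \in ball G l (ext_roots u v).
  have := valP x; rewrite !inE => /existsP[i hi]; apply/existsP.
  by exists ord_max; rewrite /ext_roots unlift_none.
pose f (a : nbhd_vert G l u + nbhd_vert G l (fun _ : 'I_1 => v)) :
    nbhd_vert G l (ext_roots u v) :=
  match a with inl x => exist _ (val x) (in1 x) | inr x => exist _ (val x) (in2 x) end.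
have noedge (a : nbhd_vert G l u) (b : nbhd_vert G l (fun _ : 'I_1 => v)) :
    (val a, val b) \notin G /\ val a <> val b.
  have := valP a; have := valP b; rewrite !inE => /existsP[_ hb] /existsP[i hi].
  split.
    apply/negP => ab; case/negP: (far i); rewrite -addSn.
    exact: within_trans (within_edge hi ab) (within_sym sG hb).
  move=> ab; case/negP: (far i); apply/withinS/(within_trans hi).
  by rewrite ab; apply: within_sym.
exists f; split.
- apply: inj_surj_bij.
    move=> [a|a] [b|b] /(congr1 val) /= e.
    + by congr (inl _); apply: val_inj.
    + by case: (noedge a b) => _ [].
    + by case: (noedge b a) => _ h; case: h; apply: esym e.
    + by congr (inr _); apply: val_inj.
  move=> b; have := valP b; rewrite inE => /existsP[i].
  rewrite /ext_roots; case: unliftP => [j _|_] /= h.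
    have hb : val b \in ball G l u by rewrite inE; apply/existsP; exists j.
    by exists (inl (exist _ (val b) hb)); apply: val_inj.
  have hb : val b \in ball G l (fun _ : 'I_1 => v).
    by rewrite inE; apply/existsP; exists ord0.
  by exists (inr (exist _ (val b) hb)); apply: val_inj.
- move=> [a|a] [b|b] //=; rewrite /nbhd_edge /=; first by apply/negbTE; case: (noedge a b).
  apply/negbTE; apply/negP => /sG h; case: (noedge b a) => /negP; exact.
- move=> i; apply: val_inj; rewrite /= /ext_roots /sum_root.
  by case: unlift.
Qed.

End RootedGraphs.

(** * Reduction to the convergence of local types *)

Section Reduction.
Variables (R : realType) (Om : nat -> finType) (mu : forall n, Om n -> R).
Arguments mu {n}.
Hypothesis mu_ge0 : forall n (w : Om n), 0 <= mu w.
Hypothesis mu_sum : forall n, \sum_(w : Om n) mu w = 1.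
Variables (gr : forall n, Om n -> graph n) (dg : forall n, Om n -> 'I_n -> nat).
Hypothesis gr_simple : forall n (w : Om n), simple_graph (gr w).
Hypothesis dgP : forall n (w : Om n) x, (#|[set y | (x, y) \in gr w]| <= dg w x)%N.
Variables (g : nat -> R) (C : R).
Hypothesis g_ge0 : forall d, 0 <= g d.
Hypothesis g_mono : forall d d', (d <= d')%N -> g d <= g d'.
Hypothesis g_unb : forall A, exists D, A <= g D.
Hypothesis UI : forall n,
  Ex (@mu) (fun w : Om n => \sum_v (dg w v)%:R * g (dg w v)) <= C * n%:R.

Local Notation likely := (likely (@mu)).

Lemma heavy_likely (eps th : R) : 0 < eps -> 0 < th -> exists D0, forall D, (D0 <= D)%N ->
  likely th (fun n w => (heavy (dg w) D)%:R <= eps * n%:R).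
Proof.
move=> e0 t0; have et0 : 0 < eps * th by rewrite mulr_gt0.
(* The summand 1 makes [g D] positive, so that Markov's inequality can be applied after multiplying
   by it. *)
have [D0 hD0] := g_unb (`|C| / (eps * th) + 1); exists D0 => D DD.
have gD : `|C| / (eps * th) + 1 <= g D by apply: le_trans hD0 (g_mono DD).
have gp : 0 < g D.
  by apply: lt_le_trans gD; rewrite ltr_wpDl // divr_ge0 // ltW.
suff : likely th (fun n w => (heavy (dg w) D)%:R / n%:R <= eps).
  move=> hh; apply: (likely_mono mu_ge0 (N := 1) _ hh) => n w n0.
  by rewrite ler_pdivrMr // ltr0n.
apply: (likely_markov mu_ge0 mu_sum (N := 1)) => // n n0.
have n0' : 0 < n%:R :> R by rewrite ltr0n.
have -> : Ex (@mu) (fun w : Om n => (heavy (dg w) D)%:R / n%:R) =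
    Ex (@mu) (fun w : Om n => (heavy (dg w) D)%:R * g D) / (n%:R * g D).
  rewrite /Ex mulr_suml; apply: eq_bigr => w _.
  by rewrite invfM -!mulrA [g D * _]mulrCA mulfV ?mulr1 // gt_eqF.
rewrite ler_pdivrMr ?mulr_gt0 //.
have h : Ex (@mu) (fun w : Om n => (heavy (dg w) D)%:R * g D) <= C * n%:R.
  apply: le_trans (UI n); apply: (Ex_le mu_ge0) => w.
  rewrite /heavy natr_sum mulr_suml big_mkcond /=; apply: ler_sum => v _.
  case: ifP => h; last by rewrite mulr_ge0.
  by rewrite ler_wpM2l // g_mono // ltnW.
apply: le_trans h _; rewrite mulrCA mulrC ler_wpM2l // ?(ltW n0') //.
apply: le_trans (ler_norm C) _.
by rewrite mulrC -ler_pdivrMr //; apply: le_trans gD; rewrite lerDl.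
Qed.

Lemma nwild_likely r (eps th : R) : 0 < eps -> 0 < th -> exists D,
  likely th (fun n w => (nwild (gr w) (dg w) D r)%:R <= eps * n%:R).
Proof.
elim: r eps th => [|r IH] eps th e0 t0.
  have [D hD] := heavy_likely e0 t0; exists D.
  apply: (likely_mono mu_ge0 (N := 0) _ (hD D (leqnn _))) => n w _; apply: le_trans.
  by rewrite ler_nat nwild0.
have e2 : 0 < eps / 2 by rewrite divr_gt0.
have t2 : 0 < th / 2 by rewrite divr_gt0.
have [D hD] := IH _ _ e2 t2.
(* [D'] is chosen after [D], since the heavy mass must be small compared with this factor. *)
pose c := (2 * D.+1 ^ r)%N.
have c0 : 0 < c%:R :> R by rewrite ltr0n muln_gt0 expn_gt0.
have e2c : 0 < eps / 2 / c%:R by rewrite divr_gt0.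
have [D' hD'] := heavy_likely e2c t2; exists (maxn D D').
apply: likely_le (likely_mono mu_ge0 (N := 0) _
  (likely_and mu_ge0 mu_sum hD (hD' (maxn D D') (leq_maxr _ _)))); first lra.
move=> n w _ [h1 h2]; have [sG _] := gr_simple w.
have := nwildS sG (dgP w) r (leq_maxl D D').
rewrite -(ler_nat R) natrD natrM => h3; apply: le_trans h3 _.
have : c%:R * (heavy (dg w) (maxn D D'))%:R <= c%:R * (eps / 2 / c%:R * n%:R).
  by rewrite ler_pM2l.
rewrite [leRHS]mulrA [c%:R * (_ / _)]mulrC divfK ?gt_eqF // /c.
by lra.
Qed.

Lemma reach_likely r (eps th : R) : 0 < eps -> 0 < th ->
  likely th (fun n w => forall x, #|[set v | within (gr w) r v x]|%:R <= eps * n%:R).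
Proof.
move=> e0 t0.
have e2 : 0 < eps / 2 by rewrite divr_gt0.
have e4 : 0 < eps / 4 by rewrite divr_gt0.
have t2 : 0 < th / 2 by rewrite divr_gt0.
have [D hD] := nwild_likely r e2 t2.
pose c := (D.+1 ^ r)%N.
have c0 : 0 < c%:R :> R by rewrite ltr0n expn_gt0.
have e4c : 0 < eps / 4 / c%:R by rewrite divr_gt0.
have [D' hD'] := heavy_likely e4c t2.
pose N := Num.bound (D'.+1%:R * c%:R / (eps / 4)).
apply: likely_le (likely_mono mu_ge0 (N := N) _
  (likely_and mu_ge0 mu_sum hD (hD' D' (leqnn _)))); first lra.
move=> n w nN [h1 h2] x; have [sG _] := gr_simple w.
have := card_reach_leq sG (dgP w) D D' r x.
rewrite -(ler_nat R) natrD natrM -/c -addSn natrD mulrDl => h3.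
have h4 : c%:R * (heavy (dg w) D')%:R <= c%:R * (eps / 4 / c%:R * n%:R).
  by rewrite ler_pM2l.
have h5 : D'.+1%:R * c%:R <= n%:R * (eps / 4).
  rewrite -ler_pdivrMr //; apply: le_trans (ltW (archi_boundP _)) _.
    by rewrite divr_ge0 ?mulr_ge0 // ltW.
  by rewrite ler_nat.
move: h4; rewrite [leRHS]mulrA [c%:R * (_ / _)]mulrC divfK ?gt_eqF //.
by lra.
Qed.

Variables (l : nat) (tau : eqType) (typ : forall n, Om n -> 'I_n -> tau).
Hypothesis typ_iso : forall n n' (w : Om n) (w' : Om n') v v', typ w v = typ w' v' ->
  rg_iso (nbhd_edge (gr w) l (fun _ : 'I_1 => v)) (nbhd_root (gr w) l (fun _ : 'I_1 => v))
         (nbhd_edge (gr w') l (fun _ : 'I_1 => v')) (nbhd_root (gr w') l (fun _ : 'I_1 => v')).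
Hypothesis typ_conv : forall t, exists q,
  conv_prob (@mu) (fun n w => freq R (fun v => typ w v = t)) q.
Hypothesis typ_fin : forall D, exists L : seq tau, forall n (w : Om n) v,
  tame (gr w) (dg w) D l v -> typ w v \in L.

Lemma typ_tight (eps th : R) : 0 < eps -> 0 < th -> exists L : seq tau,
  likely th (fun n w => freq R (fun v => typ w v \notin L) <= eps).
Proof.
move=> e0 t0; have [D hD] := nwild_likely l e0 t0; have [L hL] := typ_fin D.
exists L; apply: (likely_mono mu_ge0 (N := 1) _ hD) => n w n0 h.
rewrite ler_pdivrMr ?ltr0n //; apply: le_trans h; rewrite ler_nat.
apply: subset_leq_card; apply/fintype.subsetP => v; rewrite !inE.
by apply: contra; apply: hL.
Qed.

Lemma typ_pred_conv (a : tau -> Prop) : exists q,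
  conv_prob (@mu) (fun n w => freq R (fun v => a (typ w v))) q.
Proof. exact: (conv_prob_types mu_ge0 mu_sum (typ := @typ) typ_conv typ_tight). Qed.

Variables (k : nat) (T : crg k).

Let nbe n (w : Om n) v := nbhd_edge (gr w) l (fun _ : 'I_1 => v).
Let nbr n (w : Om n) v := nbhd_root (gr w) l (fun _ : 'I_1 => v).

Arguments nbe {n} w v.
Arguments nbr {n} w v.

Lemma nbe_sym n (w : Om n) v : symmetric (nbe w v).
Proof. by move=> x y; apply/idP/idP; apply: (gr_simple w).1. Qed.

Lemma nbe_irr n (w : Om n) v : irreflexive (nbe w v).
Proof. by move=> x; apply/negbTE; apply: (gr_simple w).2. Qed.

Arguments nbe_sym {n} w v.
Arguments nbe_irr {n} w v.

(** [T] enters as an abstract graph, not as a ball of [gr w]: the limits are thus defined, and sum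
    to 1, whether or not [T] is ever the neighbourhood of a tuple. *)
Let glue n (w : Om n) v : crg k.+1 :=
  crg_of (sum_root (@cr k T) (nbr w v ord0))
    (sum_edge_sym (@ce_sym k T) (nbe_sym w v)) (sum_edge_irr (@ce_irr k T) (nbe_irr w v)).

Let glue_iso n (w : Om n) v := crg_of_iso (sum_root (@cr k T) (nbr w v ord0))
    (sum_edge_sym (@ce_sym k T) (nbe_sym w v)) (sum_edge_irr (@ce_irr k T) (nbe_irr w v)).

Arguments glue {n} w v.
Arguments glue_iso {n} w v.

Lemma glue_typ n n' (w : Om n) (w' : Om n') v v' : typ w v = typ w' v' ->
  iso_class (glue w v) = iso_class (glue w' v').
Proof.
move=> /typ_iso h; apply: iso_classP.
apply: rg_iso_trans (rg_iso_sym (glue_iso w v)) _.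
apply: rg_iso_trans (glue_iso w' v').
exact: (sum_iso (rg_iso_refl _ _) h).
Qed.

Lemma glue_extends n (w : Om n) v : extends T (glue w v).
Proof.
exists (fun x => enum_rank (inl x)); split.
- by move=> x y /enum_rank_inj[].
- by move=> x y; rewrite /= !enum_rankK.
- move=> i /=; congr (enum_rank _); rewrite /sum_root.
  have -> : widen_ord (leqnSn k) i = lift ord_max i.
    by apply: val_inj; rewrite /= /bump leqNgt ltn_ord.
  by rewrite liftK.
Qed.

(** For any precision some actual sample is that close to the limit, so pointwise bounds pass to
    it. *)
Lemma conv_prob_bound (Z : forall n, Om n -> R) q a b :
  (forall n w, (0 < n)%N -> a <= Z n w <= b) -> conv_prob (@mu) Z q -> a <= q <= b.
Proof.
move=> h hZ; have lt1 : 2^-1 < 1 :> R by lra.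
have gt0 : 0 < 2^-1 :> R by lra.
suff K e : 0 < e -> a - e <= q <= b + e.
  apply/andP; split; apply/ler_addgt0Pr => e /K; lra.
move=> e0; have [N hN] := likely_ex lt1 (hZ _ _ e0 gt0).
have [w /ler_normlP[h1 h2]] := hN _ (leqnSn N).
have := h N.+1 w isT; lra.
Qed.

(* Away from [u], the ball of radius [l] around [(u, v)] is the disjoint union of [T] and the
   ball around [v], so [q C] is the limiting frequency of the types that glue with [T] to a
   graph of the class [C]. *)
Theorem local_limit_extension :
  exists q : set (crg k.+1) -> R,
    (forall T' : crg k.+1, extends T T' ->
       0 <= q (iso_class T') <= 1 /\
       forall eps theta : R, 0 < eps -> 0 < theta ->
         likely theta (fun n w => forall u : 'I_k -> 'I_n, nbhd_iso (gr w) l u T ->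
               `| (#|[set v : 'I_n | `[< nbhd_iso (gr w) l (ext_roots u v) T' >]]|%:R / n%:R)
                  - q (iso_class T') | < eps))
    /\ (\esum_(C in Ext T) (q C)%:E = 1)%E.
Proof.
(* A type gets its class from any sample that realises it. By [glue_typ] the choice of the sample
   does not matter, and unrealised types get no class. *)
pose a (K : set (crg k.+1)) (t : tau) :=
  exists n (w : Om n) v, typ w v = t /\ K = iso_class (glue w v).
have [q hq] := choice (fun K => typ_pred_conv (a K)).
exists q; split; last first.
  have disj K K' t : a K t -> a K' t -> K = K'.
    by move=> [n [w [v [<- ->]]]] [n' [w' [v' [h ->]]]]; apply: glue_typ.
  (* Inequalities for sums of the limits are read off at one actual sample where finitely many
     frequencies are close to them. *)
  have gap (s : seq (set (crg k.+1))) d th (A : forall n, Om n -> Prop) : 0 < d ->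
      th < 1 -> likely th A -> exists n, exists w : Om n, [/\ (0 < n)%N, A n w &
       `|\sum_(K <- s) freq R (fun v => a K (typ w v)) - \sum_(K <- s) q K| <= d].
    move=> d0 th1 lA.
    pose d' := d / (size s).+1%:R.
    have d'0 : 0 < d' by rewrite divr_gt0.
    have t0 : 0 < (1 - th) / 2 by lra.
    have l1 : likely ((1 - th) / 2) (fun n w => forall K, K \in s ->
        `|freq R (fun v => a K (typ w v)) - q K| <= d').
      by apply: (likely_all mu_ge0 mu_sum) => // K _ th' h; apply: hq.
    have [|N hN] := likely_ex _ (likely_and mu_ge0 mu_sum lA l1); first lra.
    have [w [Aw hw]] := hN _ (leqnSn N); exists N.+1, w; split => //.
    rewrite -sumrB; apply: le_trans (ler_norm_sum _ _ _) _.
    apply: (@le_trans _ _ (\sum_(K <- s) d')).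
      by rewrite big_seq [leRHS]big_seq; apply: ler_sum => K /hw.
    rewrite big_const_seq count_predT iter_addr_0 /d' -[X in X <= _]mulr_natr -mulrA.
    by rewrite ler_piMr ?(ltW d0) // mulrC ler_pdivrMr // mul1r ler_nat.
  apply: esum_eq1 => [s us _|e e0].
    apply/ler_addgt0Pr => e e0.
    have lT : likely 0 (fun n w => True).
      exists 0%N => n _; rewrite subr0 -(mu_sum n) (eq_bigl (fun w : Om n => `[< True >])) // => w.
      by rewrite asboolT.
    have [n [w [n0 _ /ler_normlP[h1 h2]]]] := gap s e 0 _ e0 ltr01 lT.
    have : \sum_(K <- s) freq R (fun v => a K (typ w v)) <= freq R (fun _ : 'I_n => True).
      by apply: freq_sum_le => // K K' v _ _; apply: disj.
    have := freq_le1 R (fun _ : 'I_n => True); lra.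
  have e2 : 0 < e / 2 by lra.
  have h2 : 0 < 2^-1 :> R by lra.
  have [L hL] := typ_tight e2 h2.
  pose real t := exists n (w : Om n) v, typ w v = t.
  have rep t : exists K, real t -> a K t /\ Ext T K.
    case: (pselect (real t)) => [[n [w [v tE]]]|]; last by exists set0.
    exists (iso_class (glue w v)); split; first by exists n, w, v.
    by exists (glue w v); split => //; apply: glue_extends.
  have [c hc] := choice rep.
  pose s := undup [seq c t | t <- L & `[< real t >]].
  exists s; split; first exact: undup_uniq.
    move=> K; rewrite mem_undup => /mapP[t]; rewrite mem_filter => /andP[/asboolP rt _] ->.
    by case: (hc t rt).
  have [|n [w [n0 h3 /ler_normlP[h4 h5]]]] := gap s _ _ _ e2 _ hL; first lra.
  have h6 : 1 - freq R (fun v => typ w v \notin L) <= freq R (fun v => typ w v \in L).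
    by apply: freq_leC => // v; case: (boolP (typ w v \in L)); [right|left].
  have : freq R (fun v => typ w v \in L) <= \sum_(K <- s) freq R (fun v => a K (typ w v)).
    apply: freq_le_sum => v vL; have rv : real (typ w v) by exists n, w, v.
    exists (c (typ w v)); last by case: (hc _ rv).
    by rewrite mem_undup; apply/mapP; exists (typ w v) => //; rewrite mem_filter asboolT.
  by lra.
move=> T' TT'; split.
  by apply: conv_prob_bound (hq _) => n w _; rewrite freq_ge0 freq_le1.
move=> eps th e0 t0.
have e2 : 0 < eps / 2 by lra.
have t2 : 0 < th / 2 by lra.
(* The error is split into [eps / 2] for the types and [eps / 4] for the nodes near one of the [k]
   roots; [k.+1] allows [k = 0]. *)
have ek : 0 < eps / 4 / k.+1%:R by rewrite divr_gt0 // divr_gt0.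
have l1 := hq (iso_class T') _ _ e2 t2.
have l2 := reach_likely (l + l).+1 ek t2.
apply: likely_le (likely_mono mu_ge0 (N := 1) _ (likely_and mu_ge0 mu_sum l1 l2)); first lra.
move=> n w n0 [h1 h2] u uT.
have nn : 0 < n%:R :> R by rewrite ltr0n.
rewrite -/(freq R (fun v => nbhd_iso (gr w) l (ext_roots u v) T')).
pose near v := exists i, within (gr w) (l + l).+1 (u i) v.
have hnear : freq R near <= eps / 4.
  have : freq R near <= \sum_(i <- enum 'I_k) freq R (fun v => within (gr w) (l + l).+1 (u i) v).
    by apply: freq_le_sum => v [i hi]; exists i => //; rewrite mem_enum.
  move/le_trans; apply.
  apply: (@le_trans _ _ (\sum_(i <- enum 'I_k) (eps / 4 / k.+1%:R))).
    apply: ler_sum => i _; rewrite ler_pdivrMr //; apply: le_trans (h2 (u i)).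
    rewrite ler_nat; apply: subset_leq_card; apply/fintype.subsetP => v.
    by rewrite !inE; apply: within_sym; case: (gr_simple w).
  rewrite big_const_seq count_predT iter_addr_0 size_enum_ord -[X in X <= _]mulr_natr -mulrA.
  by rewrite ler_piMr ?(ltW e4) // 1?mulrC ?ler_pdivrMr ?mul1r ?ler_nat //; lra.
have agree v : ~ near v ->
    (nbhd_iso (gr w) l (ext_roots u v) T' <-> a (iso_class T') (typ w v)).
  move=> nv; have far i : ~~ within (gr w) (l + l).+1 (u i) v.
    by apply/negP => h; apply: nv; exists i.
  have iso1 := far_nbhd_iso (gr_simple w) far.
  have iso2 := sum_iso uT (rg_iso_refl (nbe w v) (nbr w v)).
  have iso3 := rg_iso_trans (rg_iso_sym iso1) (rg_iso_trans iso2 (glue_iso w v)).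
  split => [h|[n' [w' [v' [h e]]]]].
    exists n, w, v; split => //; apply/esym/iso_classP.
    exact: rg_iso_trans (rg_iso_sym iso3) h.
  apply: rg_iso_trans iso3 _.
  have : iso_class (glue w v) (glue w v) by apply: rg_iso_refl.
  by rewrite (glue_typ (esym h)) -e.
have h3 : freq R (fun v => nbhd_iso (gr w) l (ext_roots u v) T') <=
    freq R (fun v => a (iso_class T') (typ w v)) + freq R near.
  by apply: freq_leD => v hv; case: (pselect (near v)) => [|/agree[h _]]; [right|left; apply: h].
have h4 : freq R (fun v => a (iso_class T') (typ w v)) <=
    freq R (fun v => nbhd_iso (gr w) l (ext_roots u v) T') + freq R near.
  by apply: freq_leD => v hv; case: (pselect (near v)) => [|/agree[_ h]]; [right|left; apply: h].
move/ler_normlP: h1 => [h5 h6]; apply/ltr_normlP; split; lra.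
Qed.

End Reduction.

(** * Node sets as increasing lists *)

Section SortedBalls.

(** Listing a set increasingly gives each node a canonical position, so that balls in different
    graphs can be compared position by position. *)
Definition vals n (A : {set 'I_n}) : seq nat := [seq val x | x <- enum A].

Lemma size_vals n (A : {set 'I_n}) : size (vals A) = #|A|.
Proof. by rewrite size_map -cardE. Qed.

Lemma mem_vals n (A : {set 'I_n}) (x : 'I_n) : (val x \in vals A) = (x \in A).
Proof. by rewrite mem_map ?mem_enum //; apply: val_inj. Qed.

Lemma valsP n (A : {set 'I_n}) x : x \in vals A -> exists2 v : 'I_n, v \in A & val v = x.
Proof. by case/mapP => v; rewrite mem_enum => vA ->; exists v. Qed.

Lemma vals_sorted n (A : {set 'I_n}) : sorted ltn (vals A) && all (fun x => x < n)%N (vals A).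
Proof.
apply/andP; split; last by apply/allP => x /valsP[v _ <-]; apply: ltn_ord.
have : subseq (vals A) (iota 0 n).
  rewrite -val_enum_ord; apply: map_subseq.
  by rewrite [enum 'I_n]enumT; apply: filter_subseq.
by move/subseq_sorted; apply; [exact: ltn_trans|exact: iota_ltn_sorted].
Qed.

Lemma vals_uniq n (A : {set 'I_n}) : uniq (vals A).
Proof. by rewrite map_inj_uniq ?enum_uniq //; apply: val_inj. Qed.

Lemma index_iso n n' (G : graph n) (G' : graph n') l l' (v : 'I_n) (v' : 'I_n')
  (A := ball G l (fun _ : 'I_1 => v)) (A' := ball G' l' (fun _ : 'I_1 => v')) :
  #|A| = #|A'| -> index (val v) (vals A) = index (val v') (vals A') ->
  (forall x y x' y', x \in A -> y \in A -> x' \in A' -> y' \in A' ->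
     index (val x) (vals A) = index (val x') (vals A') ->
     index (val y) (vals A) = index (val y') (vals A') ->
     ((x, y) \in G) = ((x', y') \in G')) ->
  rg_iso (nbhd_edge G l (fun _ : 'I_1 => v)) (nbhd_root G l (fun _ : 'I_1 => v))
         (nbhd_edge G' l' (fun _ : 'I_1 => v')) (nbhd_root G' l' (fun _ : 'I_1 => v')).
Proof.
move=> cAA iv eG.
have ex (x : nbhd_vert G l (fun _ : 'I_1 => v)) :
    exists y : nbhd_vert G' l' (fun _ : 'I_1 => v'),
    index (val (val y)) (vals A') = index (val (val x)) (vals A).
  have ix : (index (val (val x)) (vals A) < size (vals A'))%N.
    by rewrite size_vals -cAA -size_vals index_mem mem_vals; apply: valP x.
  have [y yA yE] := valsP (mem_nth 0%N ix).
  by exists (exist _ y yA); rewrite /= yE index_uniq // vals_uniq.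
have inj k (H : graph k) r (u : 'I_k) (x y : nbhd_vert H r (fun _ : 'I_1 => u)) :
    index (val (val x)) (vals (ball H r (fun _ : 'I_1 => u))) =
    index (val (val y)) (vals (ball H r (fun _ : 'I_1 => u))) -> x = y.
  move=> e; apply: val_inj; apply: val_inj.
  have mx : val (val x) \in vals (ball H r (fun _ : 'I_1 => u)) by rewrite mem_vals; apply: valP x.
  have my : val (val y) \in vals (ball H r (fun _ : 'I_1 => u)) by rewrite mem_vals; apply: valP y.
  by rewrite -(nth_index 0%N mx) -(nth_index 0%N my) e.
have [f fE] := choice ex; exists f; split.
- apply: inj_surj_bij => [x y e|y]; first by apply: inj; rewrite -!fE e.
  have iy : (index (val (val y)) (vals A') < size (vals A))%N.
    by rewrite size_vals cAA -size_vals index_mem mem_vals; apply: valP y.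
  have [x xA xE] := valsP (mem_nth 0%N iy).
  exists (exist _ x xA); apply: inj.
  by rewrite fE /= xE index_uniq // vals_uniq.
- move=> x y; rewrite /nbhd_edge; apply: esym.
  by apply: (eG _ _ _ _ (valP x) (valP y) (valP (f x)) (valP (f y))); rewrite fE.
- by move=> i; apply: inj; rewrite fE.
Qed.

End SortedBalls.

(** * The Barabasi-Albert process as a Markov chain on target lists *)

Section Growth.
Variable R : realType.
Implicit Types (s t : seq nat) (f g : seq nat -> R) (N j i : nat).

(** The degree of the vertex [i]: its own edge and the incoming ones, so that a loop counts
    twice. *)
Definition hdeg s i : nat := ((i < size s) + count_mem i s)%N.
Definition wt s i : R :=
  (if (i < size s)%N then hdeg s i else nat_of_bool (i == size s))%:R / (2 * size s + 1)%:R.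
(* The state of the one-edge process is the list [s] of the targets chosen so far;
   [Step f s] is the expectation of [f] after one more step. *)
Definition Step f s : R := \sum_(i < (size s).+1) wt s i * f (rcons s i).
(** No vertex chooses a target younger than itself; equality is a loop. *)
Definition valid s := all (fun j => nth 0 s j <= j)%N (iota 0 (size s)).

Lemma valid_rconsE s i : valid (rcons s i) = valid s && (i <= size s)%N.
Proof.
rewrite /valid size_rcons -addn1 iotaD all_cat /= add0n nth_rcons ltnn eqxx andbT.
by congr (_ && _); apply: eq_in_all => j; rewrite mem_iota add0n nth_rcons => /= ->.
Qed.

Lemma valid_rcons s i : valid s -> (i <= size s)%N -> valid (rcons s i).
Proof. by rewrite valid_rconsE => -> ->. Qed.

Lemma valid_lt s x : valid s -> x \in s -> (x < size s)%N.
Proof.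
move=> /allP h /(nthP 0%N)[j js <-]; apply: (leq_ltn_trans _ js).
by apply: h; rewrite mem_iota add0n js.
Qed.

Lemma wt_ge0 s i : 0 <= wt s i.
Proof. by rewrite /wt divr_ge0. Qed.

Lemma sum_count_mem N s : (\sum_(i < N) count_mem (i : nat) s = count (fun x => x < N) s)%N.
Proof.
elim: s => [|x s IH] /=; first by rewrite big1.
rewrite big_split /= IH; congr (_ + _)%N.
case: (ltnP x N) => h.
  rewrite (bigD1 (Ordinal h)) //= eqxx big1 // => i /eqP hi.
  by apply/eqP; rewrite eqb0; apply/eqP => e; apply: hi; apply: val_inj.
rewrite big1 // => i _; apply/eqP; rewrite eqb0; apply/eqP => e.
by move: (ltn_ord i); rewrite -e ltnNge h.
Qed.

Lemma sum_hdeg s : valid s -> (\sum_(i < size s) hdeg s i = 2 * size s)%N.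
Proof.
move=> v; rewrite /hdeg big_split /= sum_count_mem.
rewrite (eq_bigr (fun=> 1%N)); last by move=> i _; rewrite ltn_ord.
by rewrite sum_nat_const card_ord muln1 mul2n -addnn; congr (_ + _)%N; apply/eqP; rewrite -all_count;
  apply/allP => x; apply: valid_lt.
Qed.

Lemma wt_sum s : valid s -> \sum_(i < (size s).+1) wt s i = 1.
Proof.
move=> v; rewrite /wt -mulr_suml -natr_sum big_ord_recr /= ltnn eqxx.
rewrite (eq_bigr (fun i : 'I_(size s) => hdeg s i)); last by move=> i _; rewrite ltn_ord.
by rewrite sum_hdeg // divff // pnatr_eq0 addn1.
Qed.

Lemma iterStep_le j s f g : valid s ->
  (forall t, size t = j -> valid (s ++ t) -> f (s ++ t) <= g (s ++ t)) ->
  iter j Step f s <= iter j Step g s.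
Proof.
elim: j s => [|j IH] s v h /=.
  by have := h [::]; rewrite cats0; apply.
apply: ler_sum => i _; rewrite ler_wpM2l ?wt_ge0 // IH //.
  by apply: valid_rcons => //; rewrite -ltnS.
by move=> t st; rewrite cat_rcons; apply: h; rewrite /= st.
Qed.

Lemma iterStep_eq j s f g : valid s ->
  (forall t, size t = j -> valid (s ++ t) -> f (s ++ t) = g (s ++ t)) ->
  iter j Step f s = iter j Step g s.
Proof.
by move=> v h; apply/eqP; rewrite eq_le !iterStep_le // => t h1 h2; rewrite h.
Qed.

Lemma iterStepD j s f g :
  iter j Step (fun s => f s + g s) s = iter j Step f s + iter j Step g s.
Proof.
elim: j s => [|j IH] s //=; rewrite /Step -big_split /=; apply: eq_bigr => i _.
by rewrite IH mulrDr.
Qed.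

Lemma iterStepZ j s a f : iter j Step (fun s => a * f s) s = a * iter j Step f s.
Proof.
elim: j s => [|j IH] s //=; rewrite /Step mulr_sumr /=; apply: eq_bigr => i _.
by rewrite IH mulrCA.
Qed.

Lemma iterStep_sum (I : Type) (r : seq I) (P : pred I) j s (F : I -> seq nat -> R) :
  iter j Step (fun s => \sum_(x <- r | P x) F x s) s = \sum_(x <- r | P x) iter j Step (F x) s.
Proof.
elim: j s => [|j IH] s //=; rewrite /Step exchange_big /=; apply: eq_bigr => i _.
by rewrite IH mulr_sumr.
Qed.

Lemma iterStep_const j s c : valid s -> iter j Step (fun=> c) s = c.
Proof.
elim: j s => [|j IH] s v //=; rewrite /Step.
rewrite (eq_bigr (fun i : 'I_(size s).+1 => wt s i * c)); last first.
  by move=> i _; rewrite IH // valid_rcons // -ltnS.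
by rewrite -mulr_suml wt_sum // mul1r.
Qed.

Definition EN N f : R := iter N Step f [::].

Lemma EN_le N f g : (forall s, size s = N -> valid s -> f s <= g s) -> EN N f <= EN N g.
Proof. by move=> h; apply: iterStep_le => // t st; apply: h. Qed.

Lemma EN_eq N f g : (forall s, size s = N -> valid s -> f s = g s) -> EN N f = EN N g.
Proof. by move=> h; apply: iterStep_eq => // t st; apply: h. Qed.

Lemma END N f g : EN N (fun s => f s + g s) = EN N f + EN N g.
Proof. exact: iterStepD. Qed.

Lemma ENZ N a f : EN N (fun s => a * f s) = a * EN N f.
Proof. exact: iterStepZ. Qed.

Lemma EN_const N c : EN N (fun=> c) = c.
Proof. exact: iterStep_const. Qed.

Lemma EN_add N j f : EN (N + j) f = EN N (iter j Step f).
Proof. by rewrite /EN iterD. Qed.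

Lemma EN_ge0 N f : (forall s, size s = N -> valid s -> 0 <= f s) -> 0 <= EN N f.
Proof. by move=> h; rewrite -(EN_const N 0); apply: EN_le. Qed.

Fixpoint path_weight s t : R :=
  if t is i :: t' then wt s i * path_weight (rcons s i) t' else 1.

Lemma path_weightE s t :
  path_weight s t = \prod_(j < size t) wt (s ++ take j t) (nth 0%N t j).
Proof.
elim: t s => [|i t IH] s /=; first by rewrite big_ord0.
rewrite big_ord_recl /= cats0 IH; congr (_ * _).
by apply: eq_bigr => j _; rewrite cat_rcons.
Qed.

Lemma wt_large s i : (size s < i)%N -> wt s i = 0.
Proof. by move=> h; rewrite /wt ltnNge ltnW //= gtn_eqF // mul0r. Qed.

(** Targets beyond the new vertex have weight 0, so all steps may range over the same ['I_K]. *)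
Lemma iterStep_tuple N K s f : (size s + N <= K)%N ->
  iter N Step f s = \sum_(t : N.-tuple 'I_K)
    path_weight s [seq val x | x <- t] * f (s ++ [seq val x | x <- t]).
Proof.
elim: N s => [|N IH] s hK /=.
  rewrite (big_pred1 [tuple]) /=; first by rewrite mul1r cats0.
  by move=> t; rewrite tuple0; apply/esym/eqP; exact: tuple0.
rewrite (reindex (fun p : 'I_K * N.-tuple 'I_K => [tuple of p.1 :: p.2])) /=; last first.
  exists (fun t : N.+1.-tuple 'I_K => (thead t, [tuple of behead t])).
    by move=> [i t] _ /=; congr pair; apply: val_inj.
  by move=> t _; rewrite -tuple_eta.
rewrite -(pair_bigA _ (fun (i : 'I_K) (t : N.-tuple 'I_K) =>
  wt s i * path_weight (rcons s i) [seq val x | x <- t] * f (s ++ val i :: [seq val x | x <- t]))) /=.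
have sK : ((size s).+1 <= K)%N by apply: leq_trans hK; rewrite addnS ltnS leq_addr.
rewrite /Step (big_ord_widen K (fun i => wt s i * iter N Step f (rcons s i)) sK).
rewrite big_mkcond /=; apply: eq_bigr => i _; rewrite ltnS leqNgt.
case: (ltnP (size s) i) => h /=.
  by rewrite big1 // => t _; rewrite wt_large // !mul0r.
rewrite IH ?size_rcons ?addSnnS // mulr_sumr; apply: eq_bigr => t _.
by rewrite mulrA cat_rcons.
Qed.

Definition codes N (c : {ffun 'I_N -> 'I_N}) : seq nat := [seq val (c x) | x <- enum 'I_N].

Lemma size_codes N (c : {ffun 'I_N -> 'I_N}) : size (codes c) = N.
Proof. by rewrite size_map size_enum_ord. Qed.

Lemma nth_codes N (c : {ffun 'I_N -> 'I_N}) (t : 'I_N) : nth 0%N (codes c) t = c t.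
Proof. by rewrite (nth_map t) ?size_enum_ord // nth_ord_enum. Qed.

Lemma BA_weightE N (c : {ffun 'I_N -> 'I_N}) : BA_weight R c = path_weight [::] (codes c).
Proof.
rewrite path_weightE size_codes; apply: eq_bigr => t _ /=.
have st : size (take t (codes c)) = t by rewrite size_takel ?size_codes // ltnW.
rewrite nth_codes /wt st; congr (_ / _).
case: ifP => h; last by case: ifP => //.
congr (_%:R); rewrite /BA_deg /hdeg st h; congr (_ + _)%N.
rewrite /codes -map_take count_map -sum1_card -sum1_count.
transitivity (\sum_(j <- enum 'I_N | (j < t)%N && (nat_of_ord (c j) == c t)) 1)%N.
  by rewrite big_enum_cond /=; apply: eq_bigl => x; rewrite inE.
rewrite -[X in \sum_(j <- X | _) _](cat_take_drop t) (@big_cat _ 0%N addn) /= [X in (_ + X)%N]big1_seq ?addn0.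
  rewrite big_seq_cond [RHS]big_seq_cond; apply: eq_bigl => x.
  case: (boolP (x \in _)) => //= xt; case: ltnP => //= tx.
  have := map_f val xt; rewrite map_take val_enum_ord take_iota mem_iota /= add0n.
  by rewrite leq_min ltnNge tx.
move=> x /andP[/andP[xt _] xd].
have := map_f val xd; rewrite map_drop val_enum_ord drop_iota mem_iota add0n.
by rewrite leqNgt xt.
Qed.

(** The bridge from the static product weight to the chain: expectations can be computed one step at
    a time. *)
Lemma BA_expectation N f :
  \sum_(c : {ffun 'I_N -> 'I_N}) BA_weight R c * f (codes c) = EN N f.
Proof.
rewrite /EN (iterStep_tuple (K := N)) //=.
rewrite (reindex (fun t : N.-tuple 'I_N => [ffun i => tnth t i])) /=; last first.
  exists (fun c : {ffun 'I_N -> 'I_N} => [tuple c i | i < N]).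
    by move=> t _; apply: eq_from_tnth => i; rewrite tnth_mktuple ffunE.
  by move=> c _; apply/ffunP => i; rewrite ffunE tnth_mktuple.
apply: eq_bigr => t _; rewrite BA_weightE.
suff -> : codes [ffun i => tnth t i] = [seq val x | x <- t] by [].
rewrite /codes -[in RHS](map_tnth_enum t) -[RHS]map_comp; apply: eq_map => i /=.
by rewrite ffunE.
Qed.

End Growth.

(** * Limits of real sequences *)

Section Sequences.
Variable R : realType.
Implicit Types u v : nat -> R.
Local Open Scope classical_set_scope.

Lemma cvg0_le u v : (forall n, 0 <= u n) ->
  (exists N, forall n, (N <= n)%N -> u n <= v n) -> v @ \oo --> 0 -> u @ \oo --> 0.
Proof.
move=> u0 [N h] hv; apply: (squeeze_cvgr (f := fun=> 0) (h := v)) => //; last exact: cvg_cst.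
by exists N => // n /= /h ->; rewrite u0.
Qed.

Lemma cvg_ex u (a e : R) : u @ \oo --> a -> 0 < e ->
  exists N, forall n, (N <= n)%N -> `|u n - a| <= e.
Proof.
move=> /cvgrPdist_le h e0; have [N _ hN] := h e e0; exists N => n Nn.
by rewrite distrC; apply: hN.
Qed.

Lemma ex_cvg u (a : R) : (forall e, 0 < e ->
  exists N, forall n, (N <= n)%N -> `|u n - a| <= e) -> u @ \oo --> a.
Proof.
move=> h; apply/cvgrPdist_le => e /h [N hN]; exists N => // n /= Nn.
by rewrite distrC; apply: hN.
Qed.

Lemma cvg_eventually u v (a : R) N : (forall n, (N <= n)%N -> u n = v n) ->
  u @ \oo --> a -> v @ \oo --> a.
Proof.
move=> h hu; apply: ex_cvg => e e0; have [N' hN'] := cvg_ex hu e0.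
by exists (maxn N N') => n; rewrite geq_max => /andP[/h <- /hN'].
Qed.

Lemma cvg_invS : (fun n => n.+1%:R^-1 : R) @ \oo --> 0.
Proof. exact: cvg_harmonic. Qed.

Lemma cvgX u (a : R) k : u @ \oo --> a -> (fun n => u n ^+ k) @ \oo --> a ^+ k.
Proof.
move=> h; elim: k => [|k IH].
  by rewrite expr0; apply: cvg_cst.
rewrite exprS (_ : (fun n => _) = u \* (fun n => u n ^+ k)); first exact: cvgM.
by apply/funext => n; rewrite exprS.
Qed.

Lemma cvg_fsum (I : Type) (r : seq I) (F : I -> nat -> R) (a : I -> R) :
  (forall i, F i @ \oo --> a i) ->
  (fun n => \sum_(i <- r) F i n) @ \oo --> \sum_(i <- r) a i.
Proof.
move=> h; elim: r => [|i r IH].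
  rewrite big_nil (_ : (fun n => _) = fun=> 0); first exact: cvg_cst.
  by apply/funext => n; rewrite big_nil.
rewrite big_cons (_ : (fun n => _) = F i \+ (fun n => \sum_(i <- r) F i n)); first exact: cvgD.
by apply/funext => n; rewrite big_cons.
Qed.

Lemma cvg_ratioS : (fun n => n.+2%:R / n.+1%:R : R) @ \oo --> (1 : R).
Proof.
rewrite (_ : (fun n => _) = (fun=> 1) \+ (fun n => n.+1%:R^-1)); last first.
  by apply/funext => n /=; rewrite -[n.+2]addn1 natrD mulrDl mul1r divff.
by rewrite -[X in _ --> X]addr0; apply: cvgD cvg_invS; apply: cvg_cst.
Qed.

Lemma cvg_powS k :
  (fun n => (n.+2%:R ^+ k.+1 - n.+1%:R ^+ k.+1) / n.+1%:R ^+ k : R) @ \oo --> (k.+1%:R : R).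
Proof.
rewrite (_ : (fun n => _) =
  fun n => \sum_(i <- enum 'I_k.+1) (n.+2%:R / n.+1%:R : R) ^+ (k - i)); last first.
  apply/funext => n; rewrite subrXX -natrB // subSnn mul1r big_enum /= mulr_suml.
  apply: eq_bigr => i _; rewrite /= expr_div_n -mulrA; congr (_ * _).
  have ik : (i <= k)%N by rewrite -ltnS.
  have -> : n.+1%:R ^+ k = n.+1%:R ^+ (k - i) * n.+1%:R ^+ i :> R by rewrite -exprD subnK.
  by rewrite invfM mulrCA divff ?mulr1 // expf_neq0 // pnatr_eq0.
rewrite (_ : k.+1%:R = \sum_(i <- enum 'I_k.+1) (1 : R)); last first.
  by rewrite big_enum /= sumr_const card_ord.
by apply: cvg_fsum => i; have := cvgX (k := (k - i)%N) cvg_ratioS; rewrite expr1n.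
Qed.

(** Summing the increments bounds the quotient by a term of order [1/n] and a Cesaro mean of a
    sequence tending to 0. *)
Lemma growth_cvg0 (V eta : nat -> R) p n0 : (forall n, 0 <= V n) ->
  (forall n, 0 <= eta n) -> eta @ \oo --> 0 ->
  (forall n, (n0 <= n)%N -> V n.+1 <= V n + n.+1%:R ^+ p.+1 * eta n) ->
  (fun n => V n / n.+1%:R ^+ p.+2) @ \oo --> 0.
Proof.
move=> V0 eta0 h hV.
(* Changing finitely many terms makes the recursive inequality hold from 0 on and does not affect
   the limit. *)
pose et n := if (n < n0)%N then `|V n.+1 - V n| else eta n.
have et0 n : 0 <= et n by rewrite /et; case: ifP.
have het : et @ \oo --> 0.
  apply: (cvg_eventually (N := n0)) h => n hn; by rewrite /et ltnNge hn.
have step n : V n.+1 <= V n + n.+1%:R ^+ p.+1 * et n.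
  rewrite /et; case: ltnP => [_|/hV //].
  rewrite -lerBlDl; apply: le_trans (ler_norm _) _; rewrite ler_peMl //.
  by rewrite exprn_ege1 // ler1n.
have bnd n : V n <= V 0 + n.+1%:R ^+ p.+1 * series et n.
  elim: n => [|n IH]; first by rewrite /series /= big_geq // mulr0 addr0.
  apply: le_trans (step n) _; rewrite /series /= big_nat_recr //= mulrDr addrA.
  apply: lerD.
    apply: le_trans IH _; rewrite lerD2l ler_wpM2r //; first exact: sumr_ge0.
    by rewrite ler_pXn2r ?nnegrE // ler_nat.
  by rewrite ler_wpM2r // ler_pXn2r ?nnegrE // ler_nat.
apply: (cvg0_le (v := fun n => V 0 * n.+1%:R^-1 + arithmetic_mean et n)).
- by move=> n; rewrite divr_ge0 // exprn_ge0.
- exists 0%N => n _; rewrite ler_pdivrMr ?exprn_gt0 //.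
  apply: le_trans (bnd n) _; rewrite mulrDl; apply: lerD.
    by rewrite exprS mulrA mulfVK // ler_peMr // exprn_ege1 // ler1n.
  have -> : arithmetic_mean et n = series et n.+1 / n.+1%:R by rewrite /arithmetic_mean mulrC.
  rewrite [_ ^+ p.+2]exprS mulrA mulfVK // mulrC ler_wpM2r ?exprn_ge0 //.
  by rewrite /series /= [leRHS]big_nat_recr //= lerDl.
- rewrite -[X in _ --> X]addr0; apply: cvgD; last exact: cesaro het.
  by rewrite -[X in _ --> X](mulr0 (V 0)); apply: cvgM cvg_invS; apply: cvg_cst.
Qed.

End Sequences.

(** * Convergence in L1 of normalised functionals of the chain *)

Section L1.
Variables (R : realType) (m : nat).
Local Open Scope classical_set_scope.
Local Notation EN := (@EN R).
Implicit Types (f g : nat -> seq nat -> R) (s t : seq nat).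

(* Dividing by a power of [n.+1] instead of [n] avoids the junk value at [n = 0]. *)
Definition L1to k f (q : R) :=
  (fun n => EN (m * n) (fun s => `|f n s / n.+1%:R ^+ k - q|)) @ \oo --> (0 : R).
Definition L1_conv k f := exists q, L1to k f q.

Lemma L1to_gen k k' f g c (c0 q : R) :
  (forall n s, size s = (m * n)%N -> valid s ->
     g n s / n.+1%:R ^+ k' = c n * (f n s / n.+1%:R ^+ k)) ->
  c @ \oo --> c0 -> L1to k f q -> L1to k' g (c0 * q).
Proof.
move=> h hc hf.
apply: (cvg0_le (v := fun n => `|c n| *
   EN (m * n) (fun s => `|f n s / n.+1%:R ^+ k - q|) + `|c n - c0| * `|q|)).
- by move=> n; apply: EN_ge0.
- exists 0%N => n _; rewrite -ENZ -(EN_const (m * n) (`|c n - c0| * `|q|)) -END.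
  apply: EN_le => s ss vs; rewrite h //.
  rewrite (_ : _ - _ = c n * (f n s / n.+1%:R ^+ k - q) + (c n - c0) * q).
    by apply: le_trans (ler_normD _ _) _; rewrite !normrM.
  by set x := _ / _; lra.
- have -> : (0 : R) = `|c0| * 0 + 0 * `|q| by lra.
  apply: cvgD; apply: cvgM => //; first exact: cvg_norm.
    rewrite -(normr0 R); apply: cvg_norm; rewrite -(subrr c0).
    by apply: cvgB => //; exact: cvg_cst.
  exact: cvg_cst.
Qed.

Lemma L1conv_eq k f g :
  (forall n s, size s = (m * n)%N -> valid s -> f n s = g n s) ->
  L1_conv k f -> L1_conv k g.
Proof.
move=> h [q hq]; exists (1 * q); apply: (L1to_gen (c := fun=> 1) _ _ hq); last exact: cvg_cst.
by move=> n s ss vs; rewrite mul1r h.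
Qed.

Lemma L1convZ k f c (c0 : R) :
  c @ \oo --> c0 -> L1_conv k f -> L1_conv k (fun n s => c n * f n s).
Proof.
move=> hc [q hq]; exists (c0 * q); apply: (L1to_gen (c := c) _ hc hq) => n s _ _.
by rewrite mulrA.
Qed.

(** Applied to the probability of attaching to a given vertex, which is of order [1/n] and so
    absorbs one power of [n]. *)
Lemma L1conv_shift k f c (c0 : R) :
  (fun n => n.+1%:R * c n) @ \oo --> c0 -> L1_conv k.+1 f ->
  L1_conv k (fun n s => c n * f n s).
Proof.
move=> hc [q hq]; exists (c0 * q); apply: (L1to_gen _ hc hq) => n s _ _.
rewrite exprS invfM.
have -> : n.+1%:R * c n * (f n s * (n.+1%:R^-1 / n.+1%:R ^+ k)) =
    n.+1%:R / n.+1%:R * (c n * f n s / n.+1%:R ^+ k).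
  by move: (n.+1%:R^-1) (n.+1%:R ^- k) => x y; lra.
by rewrite divff // mul1r.
Qed.

Lemma L1conv_weaken k f : L1_conv k f -> L1_conv k.+1 f.
Proof.
move=> [q hq]; exists (0 * q); apply: (L1to_gen _ (@cvg_invS R) hq) => n s _ _.
by rewrite exprS invfM mulrCA.
Qed.

Lemma L1convD k f g : L1_conv k f -> L1_conv k g -> L1_conv k (fun n s => f n s + g n s).
Proof.
move=> [q hq] [q' hq']; exists (q + q').
apply: (cvg0_le (v := fun n => EN (m * n) (fun s => `|f n s / n.+1%:R ^+ k - q|)
   + EN (m * n) (fun s => `|g n s / n.+1%:R ^+ k - q'|))).
- by move=> n; apply: EN_ge0.
- exists 0%N => n _; rewrite -END; apply: EN_le => s _ _.
  by rewrite mulrDl opprD addrACA; exact: ler_normD.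
- by rewrite -(addr0 0); apply: cvgD.
Qed.

Lemma L1conv0 k : L1_conv k (fun _ _ => 0).
Proof.
exists 0; rewrite /L1to (_ : (fun n => _) = fun=> 0); first exact: cvg_cst.
by apply/funext => n; rewrite -[RHS](EN_const (m * n) 0); apply: EN_eq => s _ _; rewrite mul0r subrr normr0.
Qed.

Lemma L1conv_const k (c : R) : L1_conv k (fun _ _ => c).
Proof.
have h : L1_conv 0 (fun _ _ => c).
  exists c; rewrite /L1to (_ : (fun n => _) = fun=> 0); first exact: cvg_cst.
  apply/funext => n; rewrite -[RHS](EN_const (m * n) 0).
  by apply: EN_eq => s _ _; rewrite expr0 divr1 subrr normr0.
elim: k => // k; exact: L1conv_weaken.
Qed.

Lemma L1conv_sum (I : eqType) (r : seq I) k (F : I -> nat -> seq nat -> R) :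
  (forall i, i \in r -> L1_conv k (F i)) -> L1_conv k (fun n s => \sum_(i <- r) F i n s).
Proof.
elim: r => [|i r IH] h.
  by apply: L1conv_eq (L1conv0 k) => n s _ _; rewrite big_nil.
have h1 : L1_conv k (F i) by apply: h; rewrite mem_head.
have h2 : L1_conv k (fun n s => \sum_(i <- r) F i n s).
  by apply: IH => j jr; apply: h; rewrite inE jr orbT.
by apply: L1conv_eq (L1convD h1 h2) => n s _ _; rewrite big_cons.
Qed.

(* Stochastic approximation: the drift makes [X n - q n^k.+1] a process whose
   second moment is [o(n^(2 k.+1))], where [q] solves [q (c + k.+1) = w]. *)
Lemma L1conv_drift k (X W : nat -> seq nat -> R) (sg : nat -> R) (c C : R) n0 :
  (fun n => n.+1%:R * (1 - sg n)) @ \oo --> c -> 0 <= c ->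
  (forall n, (n0 <= n)%N -> sg n <= 1) ->
  (forall n s, size s = (m * n)%N -> valid s ->
     iter m (@Step R) (X n.+1) s = sg n * X n s + W n s) ->
  L1_conv k W ->
  (forall n s, size s = (m * n)%N -> valid s -> `|X n s| <= C * n.+1%:R ^+ k.+1) ->
  (forall n s t, size s = (m * n)%N -> size t = m -> valid s -> valid (s ++ t) ->
     `|X n.+1 (s ++ t) - X n s| <= C * n.+1%:R ^+ k) ->
  L1_conv k.+1 X.
Proof.
move=> hc c0 sg1 drift [w hW] bX bD.
pose q := w / (c + k.+1%:R).
have ck : c + k.+1%:R != 0 by rewrite gt_eqF // ltr_wpDl.
have qE : q * c + q * k.+1%:R = w by rewrite -mulrDr /q divfK.
pose a n : R := n.+1%:R.
have a0 n : 0 < a n by rewrite ltr0n.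
pose Y n s := X n s - q * a n ^+ k.+1.
pose r n := (a n.+1 ^+ k.+1 - a n ^+ k.+1) / a n ^+ k.
have hr : r @ \oo --> (k.+1%:R : R) by exact: cvg_powS.
(* The deterministic error of the approximation [q * a n ^+ k.+1]; it tends to 0 by the equation for
   [q]. *)
pose d n := w - q * (a n * (1 - sg n)) - q * r n.
have hd : d @ \oo --> 0.
  rewrite (_ : 0 = w - q * c - q * k.+1%:R); last by lra.
  apply: cvgB; first (apply: cvgB; first exact: cvg_cst).
    by apply: cvgM hc; apply: cvg_cst.
  by apply: cvgM hr; apply: cvg_cst.
pose e n s := W n s / a n ^+ k - w + d n.
have an0 n j : a n ^+ j != 0 by rewrite expf_neq0 // gt_eqF.
have eE n s : size s = (m * n)%N -> valid s ->
    iter m (@Step R) (Y n.+1) s = Y n s - (1 - sg n) * Y n s + a n ^+ k * e n s.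
  move=> ss vs; rewrite iterStepD iterStep_const // drift //.
  have -> : a n ^+ k * e n s =
      W n s - q * (1 - sg n) * a n ^+ k.+1 - q * (a n.+1 ^+ k.+1 - a n ^+ k.+1).
    have h1 : a n ^+ k * (W n s / a n ^+ k) = W n s by rewrite mulrC divfK.
    have h2 : a n ^+ k * r n = a n.+1 ^+ k.+1 - a n ^+ k.+1 by rewrite mulrC divfK.
    rewrite /e /d -h2 -[in RHS]h1 exprS; set x := _ / _; lra.
  rewrite /Y; lra.
pose C1 := C + `|q|.
have bY n s : size s = (m * n)%N -> valid s -> `|Y n s| <= C1 * a n ^+ k.+1.
  move=> ss vs; apply: le_trans (ler_normB _ _) _.
  rewrite /C1 mulrDl; apply: lerD; first exact: (bX n s ss vs).
  by rewrite normrM [`|a n ^+ _|]ger0_norm ?exprn_ge0 ?(ltW (a0 n)).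
pose D := C + `|q| * (k.+1%:R + 1).
have [n1 hn1] := cvg_ex hr ltr01.
have bDY n s t : (n1 <= n)%N -> size s = (m * n)%N -> size t = m -> valid s -> valid (s ++ t) ->
    `|Y n.+1 (s ++ t) - Y n s| <= D * a n ^+ k.
  move=> nn ss st vs vst.
  have rn : `|r n| <= k.+1%:R + 1.
    have := hn1 n nn => h; rewrite -(subrK k.+1%:R (r n)) addrC.
    by apply: le_trans (ler_normD _ _) _; rewrite ger0_norm // lerD2l.
  have -> : Y n.+1 (s ++ t) - Y n s = (X n.+1 (s ++ t) - X n s) - q * (r n * a n ^+ k).
    by rewrite /r divfK // /Y; lra.
  apply: le_trans (ler_normB _ _) _; rewrite /D mulrDl; apply: lerD; first exact: (bD n s t ss st vs vst).
  rewrite (normrM q) (normrM (r n)) [`|a n ^+ _|]ger0_norm ?exprn_ge0 ?(ltW (a0 n)) // mulrA.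
  apply: ler_wpM2r; first by rewrite exprn_ge0 ?(ltW (a0 n)).
  by apply: ler_wpM2l.
pose V n := EN (m * n) (fun s => Y n s ^+ 2).
pose eta n := 2 * C1 * (EN (m * n) (fun s => `|W n s / a n ^+ k - w|) + `|d n|) + D ^+ 2 * (a n)^-1.
have C10 : 0 <= C1.
  have := bY 0%N [::]; rewrite muln0 => /(_ erefl erefl); rewrite expr1n mulr1.
  by apply: le_trans; exact: normr_ge0.
have eta0 n : 0 <= eta n.
  apply: addr_ge0; apply: mulr_ge0; rewrite ?sqr_ge0 ?invr_ge0 ?(ltW (a0 n)) //.
    exact: mulr_ge0.
  by apply: addr_ge0 => //; apply: EN_ge0.
have heta : eta @ \oo --> 0.
  have -> : (0 : R) = 2 * C1 * (0 + 0) + D ^+ 2 * 0 by lra.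
  apply: cvgD; apply: cvgM; try exact: cvg_cst; last exact: cvg_invS.
  apply: cvgD => //; rewrite -(normr0 R); exact: cvg_norm.
have stepV n : (maxn n0 n1 <= n)%N -> V n.+1 <= V n + a n ^+ (2 * k).+1 * eta n.
  rewrite geq_max => /andP[h0 h1]; rewrite /V mulnS addnC EN_add.
  have -> : EN (m * n) (fun s => Y n s ^+ 2) + a n ^+ (2 * k).+1 * eta n =
      EN (m * n) (fun s => Y n s ^+ 2 + a n ^+ (2 * k).+1 *
        (2 * C1 * (`|W n s / a n ^+ k - w| + `|d n|) + D ^+ 2 * (a n)^-1)).
    by rewrite END ENZ END ENZ END !EN_const.
  apply: EN_le => s ss vs.
  pose x := Y n s.
  (* As [z - x] is at most [D * a n ^+ k] in absolute value, [z ^+ 2] is bounded by an expression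
     affine in [z], and only the conditional mean of [Y n.+1] is needed. *)
  apply: (@le_trans _ _ (iter m (@Step R)
      (fun s' => 2 * x * Y n.+1 s' + (D ^+ 2 * a n ^+ (2 * k) - x ^+ 2)) s)).
    apply: iterStep_le => // t st vst.
    have := bDY n s t h1 ss st vs vst; rewrite -/x.
    set z := Y n.+1 (s ++ t) => hz.
    have : (z - x) ^+ 2 <= (D * a n ^+ k) ^+ 2.
      by rewrite -real_normK ?num_real // ler_pXn2r ?nnegrE // (le_trans _ hz).
    rewrite exprMn -exprM [(k * 2)%N]mulnC; move: (D ^+ 2 * _) => y; nra.
  rewrite iterStepD iterStepZ iterStep_const // eE //.
  rewrite -/(Y n s) -/x.
  have hx : `|x| <= C1 * a n ^+ k.+1 by apply: bY.
  have h2 : a n ^+ (2 * k).+1 * (2 * C1 * `|e n s| + D ^+ 2 * (a n)^-1)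
      = 2 * (C1 * a n ^+ k.+1) * (a n ^+ k * `|e n s|) + D ^+ 2 * a n ^+ (2 * k).
    rewrite mulrDr; congr (_ + _).
      have -> : a n ^+ (2 * k).+1 = a n ^+ k.+1 * a n ^+ k by rewrite -exprD; congr (_ ^+ _); lia.
      lra.
    transitivity (a n / a n * (D ^+ 2 * a n ^+ (2 * k))).
      by rewrite exprS; move: (a n)^-1 (a n ^+ (2 * k)) (D ^+ 2) => y z z'; lra.
    by rewrite divff ?mul1r // gt_eqF.
  have h3 : x * (a n ^+ k * e n s) <= C1 * a n ^+ k.+1 * (a n ^+ k * `|e n s|).
    apply: le_trans (ler_norm _) _; rewrite normrM; apply: ler_pM => //.
    by rewrite normrM ger0_norm // exprn_ge0 // ltW.
  (* The mean-reverting term has the favourable sign and is dropped. *)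
  have h4 : 0 <= (1 - sg n) * x ^+ 2 by rewrite mulr_ge0 ?sqr_ge0 // subr_ge0 sg1.
  have h5 : `|e n s| <= `|W n s / a n ^+ k - w| + `|d n| by apply: ler_normD.
  have h6 : a n ^+ (2 * k).+1 * (2 * C1 * `|e n s| + D ^+ 2 * (a n)^-1) <=
     a n ^+ (2 * k).+1 * (2 * C1 * (`|W n s / a n ^+ k - w| + `|d n|) + D ^+ 2 * (a n)^-1).
    by rewrite ler_wpM2l ?exprn_ge0 ?(ltW (a0 n)) // lerD2r ler_wpM2l // mulr_ge0.
  apply: le_trans (lerD (lexx _) h6); rewrite h2.
  move: h3 h4; set y := _ * e n s; set z := _ * `|e n s|; set b := C1 * _; lra.
have V0 n : 0 <= V n by apply: EN_ge0 => s _ _; apply: sqr_ge0.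
have hV := growth_cvg0 V0 eta0 heta stepV.
exists q; apply: ex_cvg => ep ep0.
have ep2 : 0 < ep / 2 by lra.
have ep4 : 0 < (ep / 2) ^+ 2 by rewrite exprn_gt0.
have [N hN] := cvg_ex hV ep4; exists N => n /hN.
rewrite !subr0 ger0_norm; last by rewrite divr_ge0 ?exprn_ge0.
rewrite ger0_norm; last by apply: EN_ge0.
move=> hVn.
(* From L2 to L1 by [x <= ep / 2 + x ^+ 2 / (ep / 2)] for nonnegative [x]. *)
apply: (@le_trans _ _ (EN (m * n) (fun s => ep / 2 + (ep / 2)^-1 * (a n ^- (2 * k).+2 * Y n s ^+ 2)))).
  apply: EN_le => s ss vs.
  have -> : X n s / n.+1%:R ^+ k.+1 - q = Y n s / a n ^+ k.+1.
    by rewrite /Y mulrBl mulfK.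
  have -> : a n ^- (2 * k).+2 * Y n s ^+ 2 = (Y n s / a n ^+ k.+1) ^+ 2.
    by rewrite expr_div_n -exprM mulrC; congr (_ / _ ^+ _); lia.
  rewrite -real_normK ?num_real //; set x := `|_|.
  case: (leP x (ep / 2)) => h; first by rewrite ler_wpDr // mulr_ge0 ?invr_ge0 ?sqr_ge0 // ltW.
  apply: ler_wpDl; first exact: ltW.
  rewrite [leRHS]mulrC ler_pdivlMr // expr2; apply: ler_wpM2l; first exact: normr_ge0.
  exact: ltW.
rewrite END EN_const ENZ ENZ -/(V n).
have : (ep / 2)^-1 * (a n ^- (2 * k).+2 * V n) <= ep / 2.
  by rewrite mulrC ler_pdivrMr // -expr2 mulrC.
lra.
Qed.

End L1.

(** * Degree-decorated patterns *)

Section Patterns.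
Variables (R : realType) (m : nat).
Hypothesis m0 : (0 < m)%N.
Implicit Types (s phi : seq nat) (N n sz h a b i : nat).

(* [Some (a, b)] names the [b]-th vertex of the block merged into the [a]-th node of a list
   [phi], and [None] any vertex outside [phi].  The entry of a pattern at [(a, b)] lists the
   places of the vertices attached to that vertex, in order of arrival, and the place of its
   own target; it is [None] as long as the vertex is not born.  In particular a pattern
   determines the degrees of the nodes of [phi]. *)
Definition place := option (nat * nat).
Definition pattern := nat -> nat -> option (seq place * place).

Definition slot_of phi h : place :=
  if (h %/ m)%N \in phi then Some (index (h %/ m)%N phi, (h %% m)%N) else None.

Definition pattern_of s phi : pattern := fun a b =>
  let h := (m * nth 0 phi a + b)%N in
  if [&& a < size phi, b < m & h < size s]%N
  then Some ([seq slot_of phi t | t <- iota 0 (size s) & nth 0%N s t == h], slot_of phi (nth 0%N s h))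
  else None.

(* The effect on a pattern of a new vertex at place [nu] choosing a target at place [la];
   [ustep] undoes it. *)
Definition hstep (P : pattern) (la nu : place) : pattern := fun a b =>
  let e := if nu == Some (a, b) then Some ([::], la) else P a b in
  if la == Some (a, b) then omap (fun e => (rcons e.1 nu, e.2)) e else e.

Definition ustep (Q : pattern) (la nu : place) : pattern := fun a b =>
  if nu == Some (a, b) then None else
  if la == Some (a, b) then omap (fun e => (take (size e.1).-1 e.1, e.2)) (Q a b) else Q a b.

(** Arrivals are recorded in order, so the newest one is the last entry and can be removed without
    ambiguity. *)
Lemma hstepK (P : pattern) la nu :
  (forall a b, nu = Some (a, b) -> P a b = None) -> ustep (hstep P la nu) la nu = P.
Proof.
move=> h; apply/funext => a; apply/funext => b; rewrite /ustep /hstep.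
case: eqP => [/h -> //|_]; case: (la == Some (a, b)) => //.
case: (P a b) => [[x y]|] //=; by rewrite size_rcons /= -cats1 take_size_cat.
Qed.

Lemma divn_eqP h x b : (b < m)%N -> (h == m * x + b)%N = ((h %/ m == x) && (h %% m == b))%N.
Proof.
move=> bm; apply/eqP/andP => [->|[/eqP <- /eqP <-]].
  by rewrite mulnC divnMDl // divn_small // modnMDl modn_small // addn0 !eqxx.
by rewrite mulnC -divn_eq.
Qed.

Lemma locP phi h a b : uniq phi ->
  (slot_of phi h == Some (a, b)) = [&& a < size phi, b < m & h == m * nth 0 phi a + b]%N.
Proof.
move=> u; rewrite /slot_of; case: (ltnP b m) => bm; last first.
  rewrite andbF; case: ifP => // _; apply/eqP => -[_ e].
  by move: bm; rewrite -e leqNgt ltn_pmod.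
rewrite divn_eqP //; case: (ltnP a (size phi)) => ha /=; last first.
  case: ifP => // hp; apply/eqP => -[e _].
  by move: ha; rewrite -e leqNgt index_mem hp.
case: ifP => hp; last first.
  apply/esym/negbTE; apply/negP => /andP[/eqP e _].
  by move: hp; rewrite e mem_nth.
apply/eqP/andP => [[<- <-]|[/eqP -> /eqP ->]]; first by rewrite nth_index ?eqxx.
by rewrite index_uniq.
Qed.

Lemma pat_None s phi : uniq phi ->
  forall a b, slot_of phi (size s) = Some (a, b) -> pattern_of s phi a b = None.
Proof.
move=> u a b /eqP; rewrite locP // => /and3P[_ _ /eqP e].
by rewrite /pattern_of -e ltnn !andbF.
Qed.

Lemma pat_rcons s phi i : uniq phi -> valid s -> (i <= size s)%N ->
  pattern_of (rcons s i) phi = hstep (pattern_of s phi) (slot_of phi i) (slot_of phi (size s)).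
Proof.
move=> u v hi; apply/funext => a; apply/funext => b.
rewrite /hstep !locP //; set h := (m * _ + b)%N; rewrite /pattern_of -/h.
case: (ltnP a (size phi)) => //= ha; case: (ltnP b m) => //= hb.
rewrite size_rcons ltnS -addn1 iotaD add0n filter_cat map_cat /=.
have old : [seq t <- iota 0 (size s) | nth 0%N (rcons s i) t == h] =
    [seq t <- iota 0 (size s) | nth 0%N s t == h].
  by apply: eq_in_filter => t; rewrite mem_iota add0n nth_rcons => /= ->.
rewrite old nth_rcons ltnn eqxx nth_rcons eq_sym.
case: (ltngtP h (size s)) => hs /=.
- by rewrite [h == i]eq_sym; case: (i == h); rewrite ?cats0 // cats1.
- by case: ifP.
- have -> : [seq t <- iota 0 (size s) | nth 0%N s t == h] = [::].
    apply/eqP; rewrite -size_eq0 size_filter -leqn0 leqNgt -has_count; apply/hasPn => t.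
    rewrite mem_iota add0n => /= ht; apply/eqP => e.
    by have := valid_lt v (mem_nth 0%N ht); rewrite e hs ltnn.
  by case: ifP.
Qed.

Definition all_slots sz : seq place := [seq Some (a, b) | a <- iota 0 sz, b <- iota 0 m].

Lemma mem_slots sz a b : (Some (a, b) \in all_slots sz) = ((a < sz) && (b < m))%N.
Proof.
apply/allpairsP/andP => [[[x y] /= [hx hy [-> ->]]]|[ha hb]].
  by move: hx hy; rewrite !mem_iota !add0n.
by exists (a, b); rewrite !mem_iota.
Qed.

Lemma slots_None sz : None \notin all_slots sz.
Proof. by apply/negP => /allpairsP[[x y] [_ _]]. Qed.

Lemma slots_uniq sz : uniq (all_slots sz).
Proof.
apply: allpairs_uniq; rewrite ?iota_uniq // => -[a b] [c d] _ _ /= [-> ->] //.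
Qed.

Lemma mem_loc phi h : slot_of phi h \in None :: all_slots (size phi).
Proof.
rewrite inE /slot_of; case: ifP => //= hp.
by rewrite mem_slots index_mem hp ltn_pmod.
Qed.

(* The unnormalised probability that the next target, chosen by the vertex at place [nu],
   is the vertex at place [la]. *)
Definition mass (P : pattern) (nu la : place) : nat :=
  if la == nu then 1%N else
  if la is Some (a, b) then (if P a b is Some e then (size e.1).+1 else 0%N) else 0%N.
Definition total sz P nu := (\sum_(la <- all_slots sz) mass P nu la)%N.
Definition slot_prob N sz P nu (la : place) : R :=
  if la is Some _ then (mass P nu la)%:R / (2 * N + 1)%:R
  else 1 - (total sz P nu)%:R / (2 * N + 1)%:R.

Lemma sum_pick (A : eqType) (r : seq A) (x : A) (F : A -> R) :
  uniq r -> x \in r -> \sum_(y <- r) (x == y)%:R * F y = F x.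
Proof.
move=> u xr; rewrite (bigD1_seq x) //= eqxx mul1r big1 ?addr0 // => y /negbTE yx.
by rewrite eq_sym yx mul0r.
Qed.

Lemma sum_wt_loc_Some s phi a b : uniq phi -> valid s -> (a < size phi)%N -> (b < m)%N ->
  \sum_(i < (size s).+1) wt R s i * (slot_of phi i == Some (a, b))%:R =
  (mass (pattern_of s phi) (slot_of phi (size s)) (Some (a, b)))%:R / (2 * size s + 1)%:R.
Proof.
move=> u v ha hb; pose h := (m * nth 0 phi a + b)%N.
under eq_bigr do rewrite locP // ha hb /= -/h.
transitivity (wt R s h).
  case: (ltnP h (size s).+1) => hs.
    rewrite (bigD1 (Ordinal hs)) //= eqxx mulr1 big1 ?addr0 // => i ih.
    rewrite (_ : _ == _ = false) ?mulr0 //; apply/negbTE.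
    by apply: contra ih => /eqP e; apply/eqP/val_inj.
  rewrite wt_large // big1 // => i _; rewrite (_ : _ == _ = false) ?mulr0 //.
  by apply/negbTE; rewrite neq_ltn (leq_trans (ltn_ord i) hs).
rewrite /wt; congr (_%:R / _); rewrite /mass [Some (a, b) == _]eq_sym locP // ha hb /= -/h.
rewrite [size s == h]eq_sym /pattern_of ha hb /= -/h; case: (ltngtP h (size s)) => hs //=.
rewrite /hdeg hs size_map size_filter; congr S.
rewrite -[in LHS](mkseq_nth 0%N s) /mkseq count_map.
by apply: eq_count => t.
Qed.

(** The law of the place of the next target depends on the history only through the pattern and the
    place of the new vertex, which closes the recursion. Targets outside [phi] are pooled in
    [None]. *)
Lemma sum_wt_loc s phi la : uniq phi -> valid s -> la \in None :: all_slots (size phi) ->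
  \sum_(i < (size s).+1) wt R s i * (slot_of phi i == la)%:R =
  slot_prob (size s) (size phi) (pattern_of s phi) (slot_of phi (size s)) la.
Proof.
move=> u v; rewrite inE; case: la => [[a b]|_] /=.
  by rewrite mem_slots => /andP[ha hb]; apply: sum_wt_loc_Some.
apply/eqP; rewrite eq_sym subr_eq -[X in X == _](wt_sum R v); apply/eqP.
rewrite /total natr_sum mulr_suml.
rewrite [X in _ = _ + X](_ : _ = \sum_(la <- all_slots (size phi))
   \sum_(i < (size s).+1) wt R s i * (slot_of phi i == la)%:R); last first.
  rewrite big_seq [RHS]big_seq; apply: eq_bigr => -[[a b]|]; last by rewrite (negbTE (slots_None _)).
  by rewrite mem_slots => /andP[ha hb]; rewrite sum_wt_loc_Some.
rewrite exchange_big -big_split /=; apply: eq_bigr => i _.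
rewrite -mulr_sumr -mulrDr -[LHS]mulr1; congr (_ * _).
have us : uniq (None :: all_slots (size phi)) by rewrite /= slots_None slots_uniq.
rewrite -[LHS](sum_pick (fun=> 1) us (mem_loc phi i)) big_cons mulr1.
by congr (_ + _); apply: eq_bigr => x _; rewrite mulr1.
Qed.

(** If [Q] does not arise from such a step, [ustep] returns junk; the Boolean factor removes this
    case. *)
Definition step_coef N sz nu Q la : R :=
  (hstep (ustep Q la nu) la nu == Q)%:R * slot_prob N sz (ustep Q la nu) nu la.

(** Once the places of the new vertex and of its target are fixed, [Q] has at most one predecessor,
    so the sum runs over targets only. *)
Lemma Step_pat s phi Q : uniq phi -> valid s ->
  Step (fun s' => (pattern_of s' phi == Q)%:R) s =
  \sum_(la <- None :: all_slots (size phi)) step_coef (size s) (size phi) (slot_of phi (size s)) Q la *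
    (pattern_of s phi == ustep Q la (slot_of phi (size s)))%:R.
Proof.
move=> u v; set nu := slot_of phi (size s); rewrite /Step.
transitivity (\sum_(i < (size s).+1) \sum_(la <- None :: all_slots (size phi))
   wt R s i * (slot_of phi i == la)%:R * (hstep (pattern_of s phi) la nu == Q)%:R).
  apply: eq_bigr => i _; rewrite pat_rcons //; last by rewrite -ltnS.
  under eq_bigr do rewrite -mulrA.
  rewrite -mulr_sumr; congr (_ * _).
  rewrite (sum_pick (fun la => (hstep (pattern_of s phi) la nu == Q)%:R)) ?mem_loc //=.
  by rewrite slots_None slots_uniq.
rewrite exchange_big /= big_seq [RHS]big_seq; apply: eq_bigr => la hla.
rewrite -mulr_suml sum_wt_loc // -/nu /step_coef.
case: (pattern_of s phi =P ustep Q la nu) => [->|ne]; first by rewrite mulr1 mulrC.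
rewrite mulr0; case: (_ =P Q) => [e|_]; last by rewrite mulr0.
by case: ne; rewrite -e hstepK //; apply: pat_None.
Qed.

(** All increasing lists of nodes below [n]; the recursion separates the lists ending with the
    newest node. *)
Fixpoint node_lists n : seq (seq nat) :=
  if n is n'.+1 then node_lists n' ++ [seq rcons phi n' | phi <- node_lists n'] else [:: [::]].

Lemma mem_node_lists n phi : (phi \in node_lists n) = sorted ltn phi && all (fun x => x < n)%N phi.
Proof.
elim: n phi => [|n IH] phi /=; first by case: phi => //= x phi; rewrite andbF.
rewrite mem_cat IH; case: (lastP phi) => [|psi x]; first by [].
have -> : (rcons psi x \in [seq rcons phi n | phi <- node_lists n]) = (psi \in node_lists n) && (x == n).
  apply/mapP/andP => [[y hy /rcons_inj[-> ->]]|[h /eqP ->]]; first by [].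
  by exists psi.
rewrite IH !all_rcons.
have srt : sorted ltn (rcons psi x) = sorted ltn psi && all (fun y => y < x)%N psi.
  case: psi => //= y psi; rewrite rcons_path.
  elim: psi y => [|z psi IH2] y /=; first by rewrite andbT.
  rewrite -!andbA IH2; case: (ltnP y z) => //= yz.
  case: (path ltn z psi) => //=; case: (ltnP z x) => //= zx; rewrite ?andbF //.
  by rewrite (ltn_trans yz zx).
rewrite srt; apply/idP/idP.
  case/orP=> [/and3P[/andP[h1 h2] h3 h4]|/andP[/andP[h1 h2] /eqP ->]].
    by rewrite h1 h2 ltnS (ltnW h3) /=; apply: sub_all h4 => y /ltnW.
  by rewrite h1 h2 ltnS leqnn /=; apply: sub_all h2 => y /ltnW.
move=> /and3P[/andP[h1 h2] h3 h4]; rewrite h1 h2 /=.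
move: h3; rewrite ltnS leq_eqVlt => /orP[/eqP xn|xn].
  by rewrite xn eqxx -xn h2 orbT.
rewrite xn /=; apply/orP; left; apply: sub_all h2 => y yx; exact: ltn_trans yx xn.
Qed.

Lemma node_listsP n phi : phi \in node_lists n -> uniq phi /\ forall x, x \in phi -> (x < n)%N.
Proof.
rewrite mem_node_lists => /andP[h1 /allP h2]; split => //.
by apply: sorted_uniq h1; [exact: ltn_trans | move=> x; exact: ltnn].
Qed.

Lemma node_lists_uniq n : uniq (node_lists n).
Proof.
elim: n => //= n IH; rewrite cat_uniq IH map_inj_uniq ?IH; last by move=> x y /rcons_inj[].
rewrite andbT; apply/hasPn => _ /mapP[phi _ ->]; apply/negP => /node_listsP[_ /(_ n)].
by rewrite mem_rcons mem_head ltnn => /(_ isT).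
Qed.

(* While the node [n] is being built, [pat_count n] counts lists of older nodes, and
   [new_count n] lists ending with [n]. *)
Definition pat_count n sz Q s : R :=
  \sum_(phi <- node_lists n | size phi == sz) (pattern_of s phi == Q)%:R.
Definition new_count n sz Q s : R :=
  \sum_(phi <- node_lists n | size phi == sz) (pattern_of s (rcons phi n) == Q)%:R.

Lemma cntS n sz Q s : pat_count n.+1 sz.+1 Q s = pat_count n sz.+1 Q s + new_count n sz Q s.
Proof.
rewrite /pat_count /new_count /= big_cat /= big_map; congr (_ + _).
by apply: eq_bigl => phi; rewrite size_rcons eqSS.
Qed.

Lemma cnt_ge0 n sz Q s : 0 <= pat_count n sz Q s.
Proof. by apply: sumr_ge0. Qed.

Lemma cnt0 n Q s : pat_count n 0 Q s = ((fun _ _ => None) == Q)%:R.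
Proof.
rewrite /pat_count; elim: n => [|n IH] /=.
  rewrite big_cons big_nil addr0 /=; have -> // : pattern_of s [::] = fun _ _ => None.
  by apply/funext => a; apply/funext => b; rewrite /pattern_of.
rewrite big_cat big_map /= IH big1 ?addr0 // => phi.
by rewrite size_rcons.
Qed.

Lemma Step_cnt n sz Q s : (m * n <= size s < m * n.+1)%N -> valid s ->
  Step (pat_count n sz Q) s = \sum_(la <- None :: all_slots sz)
    step_coef (size s) sz None Q la * pat_count n sz (ustep Q la None) s.
Proof.
move=> /andP[h1 h2] v.
transitivity (\sum_(phi <- node_lists n | size phi == sz)
    Step (fun s' => (pattern_of s' phi == Q)%:R : R) s).
  exact: (iterStep_sum (node_lists n) (fun phi => size phi == sz) 1 s
    (fun phi s' => (pattern_of s' phi == Q)%:R : R)).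
under [RHS]eq_bigr do rewrite mulr_sumr.
rewrite [RHS]exchange_big /= big_seq_cond [RHS]big_seq_cond.
apply: eq_bigr => phi /andP[/node_listsP[u pn] /eqP sp].
have nuE : slot_of phi (size s) = None.
  rewrite /slot_of; case: ifP => // /pn; rewrite ltnNge leq_divRL //.
  by rewrite mulnC h1.
by rewrite Step_pat // sp nuE.
Qed.

Lemma Step_cntn n sz Q s : (m * n <= size s < m * n.+1)%N -> valid s ->
  Step (new_count n sz Q) s = \sum_(la <- None :: all_slots sz.+1)
    step_coef (size s) sz.+1 (Some (sz, size s - m * n)%N) Q la *
    new_count n sz (ustep Q la (Some (sz, size s - m * n)%N)) s.
Proof.
move=> /andP[h1 h2] v.
transitivity (\sum_(phi <- node_lists n | size phi == sz)
    Step (fun s' => (pattern_of s' (rcons phi n) == Q)%:R : R) s).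
  exact: (iterStep_sum (node_lists n) (fun phi => size phi == sz) 1 s
    (fun phi s' => (pattern_of s' (rcons phi n) == Q)%:R : R)).
under [RHS]eq_bigr do rewrite mulr_sumr.
rewrite [RHS]exchange_big /= big_seq_cond [RHS]big_seq_cond.
apply: eq_bigr => phi /andP[/node_listsP[u pn] /eqP sp].
have ur : uniq (rcons phi n).
  by rewrite rcons_uniq u andbT; apply/negP => /pn; rewrite ltnn.
have nuE : slot_of (rcons phi n) (size s) = Some (sz, size s - m * n)%N.
  apply/eqP; rewrite locP // size_rcons sp ltnS leqnn nth_rcons sp ltnn eqxx /=.
  rewrite subnKC // eqxx andbT ltn_subLR //; by rewrite addnC -mulnS.
by rewrite Step_pat // size_rcons sp nuE.
Qed.

End Patterns.

(** * Connected components of patterns *)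

Section Connectivity.
Implicit Types (P Q : pattern) (a b x y z : nat) (U V : seq nat).

Definition adj Q x y :=
  (exists b b' ins, Q x b = Some (ins, Some (y, b'))) \/
  (exists b b' ins, Q y b = Some (ins, Some (x, b'))).

(** The reflexive transitive closure of [adj], in impredicative form. *)
Definition conn Q y z := forall A : nat -> Prop,
  (forall x x', adj Q x x' -> A x -> A x') -> A y -> A z.

Lemma adj_sym Q x y : adj Q x y -> adj Q y x.
Proof. by case; [right|left]. Qed.

Lemma conn_refl Q x : conn Q x x.
Proof. by []. Qed.

Lemma conn_trans Q x y z : conn Q x y -> conn Q y z -> conn Q x z.
Proof. by move=> h1 h2 A hA /(h1 A hA)/(h2 A hA). Qed.

Lemma conn_adj Q x y : adj Q x y -> conn Q x y.
Proof. by move=> h A hA; apply: hA. Qed.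

Lemma conn_sym Q x y : conn Q x y -> conn Q y x.
Proof.
move=> h A hA Ay; apply: contrapT => nAx.
by apply: (h (fun z => ~ A z)) => // z z' zz' nz /(hA _ _ (adj_sym zz')).
Qed.

(* [U] meets every connected component of the pattern; it may contain junk indices. *)
Definition hits sz Q U := forall y, (y < sz)%N -> exists2 x, x \in U & conn Q x y.

Lemma hits_swap sz Q U x : hits sz Q U -> (x < sz)%N ->
  exists2 V, (size V).+1 = size U & hits sz Q (x :: V).
Proof.
move=> h /h[r rU rx]; exists (rem r U).
  by rewrite size_rem // prednK //; case: (U) rU.
move=> y /h[r' r'U r'y]; case: (r' =P r) => [e|/eqP ne].
  exists x; first exact: mem_head.
  by apply: conn_trans (conn_sym rx) _; rewrite -e.
by exists r' => //; rewrite inE; apply/orP; right; apply: rem_mem.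
Qed.

Lemma conn_sub P Q : (forall x y, adj Q x y -> adj P x y) -> forall x y, conn Q x y -> conn P x y.
Proof. by move=> h x y c A hA; apply: c => z z' /h; apply: hA. Qed.

Lemma hits_sub sz P Q U : (forall x y, adj Q x y -> adj P x y) -> hits sz Q U -> hits sz P U.
Proof. by move=> h hQ y /hQ[x xU c]; exists x => //; apply: conn_sub h _ _ c. Qed.

(** Deleting an edge splits at most one component, and its two ends represent the parts. *)
Lemma hits_cut sz P Q u v U :
  (forall x y, adj Q x y -> [\/ adj P x y, x = u /\ y = v | x = v /\ y = u]) ->
  hits sz Q (u :: U) -> hits sz P [:: u, v & U].
Proof.
move=> h hQ y /hQ[x xU c].
apply: (c (fun z => exists2 x, x \in [:: u, v & U] & conn P x z)).
  move=> z z' /h[a|[_ ->]|[_ ->]] [r rU rz].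
  - by exists r => //; apply: conn_trans rz (conn_adj a).
  - by exists v; rewrite ?inE ?eqxx ?orbT.
  - by exists u; rewrite ?inE ?eqxx.
exists x => //; move: xU; rewrite !inE => /orP[->//|->]; by rewrite !orbT.
Qed.

Definition wfp sz Q := forall a b e, Q a b = Some e ->
  (a < sz)%N /\ forall a' b', e.2 = Some (a', b') -> (a' < sz)%N.

Lemma adj_wfp sz Q x y : wfp sz Q -> adj Q x y -> (x < sz)%N /\ (y < sz)%N.
Proof.
move=> w [[b [b' [ins /w[h /(_ y b' erefl)]]]]|[b [b' [ins /w[h /(_ x b' erefl)]]]]] //.
Qed.

(** Position [sz] is isolated in [Q], so one representative is spent on it alone. *)
Lemma hits_last sz Q U : wfp sz Q -> hits sz.+1 Q U ->
  exists2 V, (size V).+1 = size U & hits sz Q V.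
Proof.
move=> w h; have [V sV hV] := hits_swap h (leqnn sz.+1); exists V => // y ysz.
have [|x + c] := hV y; first exact: ltnW.
rewrite inE => /orP[/eqP e|xV]; last by exists x.
have : y = sz.
  apply: (c (fun z => z = sz)) => // z z' /(adj_wfp w)[h1 _] zE.
  by move: h1; rewrite zE ltnn.
by move=> yE; move: ysz; rewrite yE ltnn.
Qed.

(** An arrival from outside only lengthens a list of incoming edges, whereas [adj] reads the
    targets. *)
Lemma hstep_adj_old P la x y : adj (hstep P la None) x y -> adj P x y.
Proof.
suff K a b ins o : hstep P la None a b = Some (ins, o) -> exists ins', P a b = Some (ins', o).
  by case=> -[b [b' [ins /K[ins' e]]]]; [left|right]; exists b, b', ins'.
rewrite /hstep /=; case: ifP => _; last by exists ins.
by case: (P a b) => [[i' o']|] //= [_ <-]; exists i'.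
Qed.

Lemma hstep_adj_new P la u j x y : adj (hstep P la (Some (u, j))) x y ->
  adj P x y \/ exists v b, la = Some (v, b) /\ (x = u /\ y = v \/ x = v /\ y = u).
Proof.
have K a b ins o : hstep P la (Some (u, j)) a b = Some (ins, o) ->
    (exists ins', P a b = Some (ins', o)) \/ a = u /\ o = la.
  rewrite /hstep /=; case: (Some (u, j) =P Some (a, b)) => [[<- _]|_].
    by case: ifP => _ /= [_ <-]; right.
  case: ifP => _; last by left; exists ins.
  by case: (P a b) => [[i' o']|] //= [_ <-]; left; exists i'.
case=> -[b [b' [ins /K[[ins' e]|[-> e]]]]].
- by left; left; exists b, b', ins'.
- by right; exists y, b'; split; [|left].
- by left; right; exists b, b', ins'.
- by right; exists x, b'; split; [|right].
Qed.

End Connectivity.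

(** * Deterministic bounds on the number of occurrences of a pattern *)

Section CountBound.
Variable m : nat.
Hypothesis m0 : (0 < m)%N.
Local Notation pat := (pattern_of m).
Local Notation loc := (slot_of m).
Implicit Types (P Q : pattern) (s phi V : seq nat) (U : seq (nat * nat)).

(** Edges arriving from outside the list count too: the weight bounds the in-degrees, and it is the
    measure of the inner induction in [cnt_conv]. *)
Definition pat_weight sz Q : nat := \sum_(a < sz) \sum_(b < m)
  (if Q a b is Some e then size e.1 else 0).

Lemma pat_wfp s phi : uniq phi -> wfp (size phi) (pat s phi).
Proof.
move=> u a b e; rewrite /pattern_of; case: ifP => // /and3P[ha _ _] [<-]; split => //= a' b' /eqP.
by rewrite locP // => /andP[].
Qed.

Definition pinned_count n sz Q s U : nat :=
  count (fun phi => [&& size phi == sz, pat s phi == Q &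
    all (fun p => nth 0%N phi p.1 == p.2) U]) (node_lists n).

Lemma count_split (T : eqType) (r : seq T) (p : pred T) (f : T -> nat) (L : seq nat) :
  {in r, forall x, p x -> f x \in L} ->
  (count p r <= \sum_(i <- L) count (fun x => p x && (f x == i)) r)%N.
Proof.
elim: r => [|x r IH] h; first by rewrite big1.
rewrite /= big_split /=; apply: leq_add.
  case px : (p x) => //=.
  have := h x (mem_head _ _) px => fL; rewrite (big_rem (f x)) //= eqxx.
  exact: leq_addr.
by apply: IH => y yr; apply: h; rewrite inE yr orbT.
Qed.

Lemma pinned_cons n sz Q s U x (L : seq nat) :
  (forall phi, phi \in node_lists n -> size phi = sz -> pat s phi = Q ->
     all (fun p => nth 0%N phi p.1 == p.2) U -> nth 0%N phi x \in L) ->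
  (pinned_count n sz Q s U <= \sum_(i <- L) pinned_count n sz Q s ((x, i) :: U))%N.
Proof.
move=> h; apply: leq_trans (count_split (f := fun phi => nth 0%N phi x) (L := L) _) _.
  by move=> phi hp /and3P[/eqP h1 /eqP h2 h3]; apply: h.
apply: leq_sum => i _; apply: sub_count => phi /=.
by case/andP => /and3P[-> -> ->] ->.
Qed.

Lemma pinned0 n sz Q s U : ~ wfp sz Q -> pinned_count n sz Q s U = 0%N.
Proof.
move=> nw; apply/eqP; rewrite -leqn0 leqNgt -has_count; apply/hasPn => phi /node_listsP[u _].
by apply/negP => /and3P[/eqP sp /eqP Qe _]; apply: nw; rewrite -sp -Qe; apply: pat_wfp.
Qed.

Lemma sum_size_iota (K : nat -> nat) (L : seq nat) (r : seq nat) : uniq L ->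
  (\sum_(h <- L) count (fun t => K t == h) r = count (fun t => K t \in L) r)%N.
Proof.
move=> uL; elim: r => [|t r IH]; first by rewrite big1.
rewrite /= big_split /= IH; congr addn.
case: (boolP (K t \in L)) => h.
  rewrite (bigD1_seq (K t)) //= eqxx big1 // => i /negbTE; rewrite eq_sym => ->; by [].
by rewrite big_seq big1 // => i iL; apply/eqP; rewrite eqb0; apply: contra h => /eqP ->.
Qed.

Lemma in_degree_bound n Q s phi x : phi \in node_lists n -> (m * n <= size s)%N ->
  (x < size phi)%N ->
  (count (fun t => nth 0 s t %/ m == nth 0 phi x) (iota 0 (size s)) <= pat_weight (size phi) (pat s phi))%N.
Proof.
move=> /node_listsP[u pn] sn xs.
have vn : (nth 0 phi x < n)%N by apply/pn/mem_nth.
rewrite /pat_weight (bigD1 (Ordinal xs)) //=; apply: leq_trans (leq_addr _ _).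
set v := nth 0%N phi x in vn *.
rewrite (eq_count (a2 := fun t => nth 0%N s t \in [seq m * v + b | b <- iota 0 m]%N)); last first.
  move=> t; apply/eqP/mapP => [e|[b]].
    exists (nth 0 s t %% m)%N; first by rewrite mem_iota add0n ltn_pmod.
    by rewrite -e mulnC -divn_eq.
  rewrite mem_iota add0n => /= bm ->; by rewrite mulnC divnMDl // divn_small ?addn0.
rewrite -sum_size_iota; last first.
  by rewrite map_inj_uniq ?iota_uniq // => b b' /addnI.
rewrite big_map -{1}[m]subn0 -/(index_iota 0 m) big_mkord; apply: leq_sum => b _.
have hb : (m * v + b < size s)%N.
  apply: leq_trans sn; apply: (@leq_trans (m * v.+1)%N); last by rewrite leq_mul2l vn orbT.
  by rewrite mulnS addnC ltn_add2r.
by rewrite /pattern_of xs ltn_ord hb /= size_map size_filter -/v.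
Qed.

Lemma pinned_all n sz Q s U : (forall y, (y < sz)%N -> y \in map fst U) ->
  (pinned_count n sz Q s U <= 1)%N.
Proof.
move=> h; rewrite /pinned_count -size_filter.
set r := [seq _ <- _ | _]; have ur : uniq r by apply/filter_uniq/node_lists_uniq.
have same : {in r &, forall x y, x = y}.
  move=> x y; rewrite !mem_filter => /andP[/and3P[/eqP sx _ ax] _] /andP[/and3P[/eqP sy _ ay] _].
  apply: (@eq_from_nth _ 0%N); first by rewrite sx sy.
  move=> i; rewrite sx => /h/mapP[p pU ->].
  by rewrite (eqP (allP ax _ pU)) (eqP (allP ay _ pU)).
case: r ur same => [|x [|y r]] //= /andP[+ _] same.
by rewrite (same x y) ?inE ?eqxx ?orbT.
Qed.

(** Each position of [V] costs a factor [n.+1]. Any other position is reached from a fixed one, at a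
    node [v] say, along an edge of the pattern; its node is then a target of one of the [m] edges of
    [v] or a source of an edge to [v], and the pattern bounds the number of these. *)
Lemma pinned_bound n sz Q s V U : (m * n <= size s)%N ->
  hits sz Q (V ++ map fst U) ->
  (pinned_count n sz Q s U <= n.+1 ^ size V * (m + pat_weight sz Q) ^ sz)%N.
Proof.
move=> sn; case: (pselect (wfp sz Q)) => [w|nw]; last by rewrite pinned0.
elim: V U => [|x V IH] U h.
  rewrite mul1n.
  have D0 : (0 < m + pat_weight sz Q)%N by rewrite ltn_addr.
  pose free U := count (fun y => y \notin map fst U) (iota 0 sz).
  apply: (@leq_trans ((m + pat_weight sz Q) ^ free U)%N); last first.
    by rewrite leq_pexp2l // -[leqRHS](size_iota 0 sz) count_size.
  have [u] := ubnP (free U); elim: u U h => // u IHu U h; rewrite ltnS => fu.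
  case: (pselect (forall y, (y < sz)%N -> y \in map fst U)) => [/pinned_all hU|].
    by apply: leq_trans (hU _ _ _) _; rewrite expn_gt0 D0.
  move=> /existsNP[y /not_implyP[ysz /negP yU]].
  have [x [x' [xx' xU x'U]]] : exists x x', [/\ adj Q x x', x \in map fst U & x' \notin map fst U].
    apply: contrapT => nE; have [r rU ry] := h y ysz.
    case/negP: yU; apply: (ry (fun z => z \in map fst U)) => // z z' zz' zU.
    by apply: contrapT => /negP z'U; apply: nE; exists z, z'.
  have [_ x'sz] := adj_wfp w xx'.
  have [[x0 v] pU /= xE] := mapP xU; subst x0.
  have ff U' : map fst U' = x' :: map fst U -> (free U').+1 = free U.
    move=> e; rewrite /free e.
    rewrite -!size_filter -(count_predT [seq _ <- _ | _]).
    have x'm : x' \in [seq y <- iota 0 sz | y \notin map fst U].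
      by rewrite mem_filter x'U mem_iota.
    rewrite -[in RHS](@perm_size _ (x' :: rem x' [seq y <- iota 0 sz | y \notin map fst U])); last first.
      by rewrite perm_sym; apply: perm_to_rem.
    rewrite /= count_predT rem_filter ?filter_uniq ?iota_uniq // -filter_predI.
    congr (size _).+1; apply: eq_filter => z /=.
    by rewrite inE negb_or.
  (* If a list matches at all, it shows that the in-degree of [v] is the one recorded in [Q]. *)
  case: (posnP (pinned_count n sz Q s U)) => [->//|].
  rewrite -has_count => /hasP[phi0 p0 /and3P[/eqP s0 /eqP P0 /allP a0]].
  have v0 : nth 0%N phi0 x = v by apply/eqP/(a0 _ pU).
  have [xsz _] := adj_wfp w xx'.
  pose L := [seq nth 0 s (m * v + b) %/ m | b <- iota 0 m]%N ++
    [seq t %/ m | t <- [seq t <- iota 0 (size s) | nth 0 s t %/ m == v]]%N.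
  have sL : (size L <= m + pat_weight sz Q)%N.
    rewrite size_cat !size_map size_iota leq_add2l size_filter.
    have := in_degree_bound (phi := phi0) (x := x) Q p0 sn.
    by rewrite s0 P0 v0; apply.
  apply: leq_trans (pinned_cons (x := x') (L := L) _) _.
    move=> phi hp sp Pp /allP/(_ _ pU)/= /eqP vE; have [up pn] := node_listsP hp.
    rewrite mem_cat; case: xx' => -[b [b' [ins e]]]; apply/orP; [left|right].
      move: e; rewrite -Pp /pattern_of; case: ifP => // /and3P[_ bm _] [_ /eqP].
      rewrite locP // vE => /and3P[_ b'm]; rewrite divn_eqP // => /andP[/eqP <- _].
      by apply/mapP; exists b; rewrite // mem_iota.
    move: e; rewrite -Pp /pattern_of; case: ifP => // /and3P[_ bm hs] [_ /eqP].
    rewrite locP // vE => /and3P[_ b'm]; rewrite divn_eqP // => /andP[/eqP e _].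
    apply/mapP; exists (m * nth 0 phi x' + b)%N.
      by rewrite mem_filter mem_iota e eqxx.
    by rewrite mulnC divnMDl // divn_small ?addn0.
  apply: (@leq_trans (\sum_(i <- L) (m + pat_weight sz Q) ^ (free U).-1)%N).
    apply: leq_sum => i _; have fE := ff ((x', i) :: U) erefl.
    have := IHu ((x', i) :: U); rewrite -fE /=; apply; last by rewrite fE.
    move=> z /h[r rU rz]; exists r => //=; rewrite inE; apply/orP; by right.
  have fE := ff ((x', 0%N) :: U) erefl.
  rewrite big_const_seq count_predT iter_addn_0 -fE /= expnSr.
  by rewrite leq_mul2l sL orbT.
(* A junk index [x] reads the default 0, which belongs to [iota 0 n.+1] even for [n = 0]. *)
apply: leq_trans (pinned_cons (x := x) (L := iota 0 n.+1) _) _.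
  move=> phi /node_listsP[_ pn] _ _ _; rewrite mem_iota /= ltnS.
  case: (ltnP x (size phi)) => hx; last by rewrite nth_default.
  exact/ltnW/pn/mem_nth.
apply: (@leq_trans (\sum_(i <- iota 0 n.+1) n.+1 ^ size V * (m + pat_weight sz Q) ^ sz)%N).
  apply: leq_sum => i _; apply: IH => y /h[r + ry]; rewrite mem_cat inE => hr.
  by exists r => //; rewrite mem_cat /= inE; move: hr; case: (r == x); rewrite ?orbT //= ?orbF.
by rewrite big_const_seq count_predT size_iota iter_addn_0 mulnC expnS -mulnA.
Qed.

End CountBound.

(** * Convergence of pattern counts *)

Section PatternConvergence.
Variables (R : realType) (m : nat).
Hypothesis m0 : (0 < m)%N.
Local Notation pat := (pattern_of m).
Local Notation loc := (slot_of m).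
Local Notation cnt := (pat_count R m).
Local Notation cntn := (new_count R m).
Local Notation coef := (step_coef R m).
Local Notation slots := (all_slots m).
Local Notation L1conv := (@L1_conv R m).
Local Notation pinned := (pinned_count m).
Local Notation weight := (pat_weight m).
Implicit Types (Q P : pattern) (s t phi U V : seq nat) (n j k sz : nat).

Lemma cntE n sz Q s : cnt n sz Q s = (pinned n sz Q s [::])%:R.
Proof.
rewrite /pat_count /pinned_count -sum1_count natr_sum big_mkcond [RHS]big_mkcond /=.
apply: eq_bigr => phi _; rewrite andbT; case: (size phi == sz) => //=.
by case: (_ == Q).
Qed.

Lemma cnt_le n sz Q s U : hits sz Q U -> (m * n <= size s)%N ->
  cnt n sz Q s <= ((m + weight sz Q) ^ sz)%:R * n.+1%:R ^+ size U.
Proof.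
move=> h sn; rewrite cntE mulrC -natrX -natrM ler_nat.
by apply: pinned_bound => //; rewrite cats0.
Qed.

Lemma pinned1_le n sz Q s V k x i : hits sz Q V -> size V = k.+1 -> (m * n <= size s)%N ->
  (x < sz)%N -> (pinned n sz Q s [:: (x, i)] <= n.+1 ^ k * (m + weight sz Q) ^ sz)%N.
Proof.
move=> h sV sn xsz; have [W sW hW] := hits_swap h xsz.
have -> : k = size W by move: sW; rewrite sV => -[].
apply: pinned_bound => // y /hW[r rW c]; exists r => //.
by move: rW; rewrite mem_cat inE /= inE orbC.
Qed.

Lemma pat_extend n s t phi : phi \in node_lists n -> (m * n <= size s)%N -> valid (s ++ t) ->
  all (fun x => x %/ m \notin phi)%N t -> pat (s ++ t) phi = pat s phi.
Proof.
move=> /node_listsP[u pn] sn; elim/last_ind: t => [|t x IH]; first by rewrite cats0.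
rewrite -rcons_cat valid_rconsE all_rcons => /andP[v xs] /andP[xp tp].
rewrite pat_rcons // IH //.
have -> : loc phi x = None by rewrite /slot_of (negbTE xp).
have -> : loc phi (size (s ++ t)) = None.
  rewrite /slot_of; case: ifP => // /pn; rewrite ltnNge leq_divRL // mulnC size_cat.
  by rewrite (leq_trans sn) ?leq_addr.
by apply/funext => a; apply/funext => b.
Qed.

(** At this time no vertex of the node [n] is born, so appending it leaves the pattern unchanged. *)
Lemma cntn_base n sz Q s : size s = (m * n)%N -> valid s -> cntn n sz Q s = cnt n sz Q s.
Proof.
move=> ss v; rewrite /new_count /pat_count big_seq_cond [RHS]big_seq_cond.
apply: eq_bigr => phi /andP[/node_listsP[u pn] _]; suff -> : pat s (rcons phi n) = pat s phi by [].
have loce h : (h < size s)%N -> loc (rcons phi n) h = loc phi h.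
  rewrite ss => hs; rewrite /slot_of mem_rcons inE ltn_eqF /=; last first.
    by rewrite ltn_divLR // mulnC.
  by case: ifP => // hp; rewrite -cats1 index_cat hp.
apply/funext => a; apply/funext => b; rewrite /pattern_of size_rcons nth_rcons ltnS leq_eqVlt.
case: (ltngtP a (size phi)) => // [ha|ha] /=; last first.
  by case: (b < m)%N => //=; rewrite ltnNge ss leq_addr.
case: (b < m)%N => //=; case: ifP => // hs; congr (Some (_, _)).
  by apply/eq_in_map => t; rewrite mem_filter mem_iota => /andP[_ /=]; apply: loce.
by apply: loce; apply: valid_lt v _; apply: mem_nth.
Qed.

Lemma cntn_le n sz Q s : cntn n sz Q s <= (pinned n.+1 sz.+1 Q s [:: (sz, n)])%:R.
Proof.
rewrite /new_count /pinned_count count_cat natrD ler_wpDl // count_map -sum1_count natr_sum.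
rewrite big_mkcond [leRHS]big_mkcond /=; apply: ler_sum => phi _.
rewrite /= size_rcons eqSS nth_rcons; case: (size phi =P sz) => //= ->.
by rewrite ltnn !eqxx /= andbT; case: ifP.
Qed.

(** A list whose pattern changes contains the node of some new target, and it is counted, pinned at
    this node, before or after the change. *)
Lemma cnt_diff n sz Q s t : (m * n <= size s)%N -> valid (s ++ t) ->
  `|cnt n sz Q (s ++ t) - cnt n sz Q s| <=
  \sum_(x < sz) \sum_(y <- t) ((pinned n sz Q (s ++ t) [:: (x : nat, y %/ m)%N])%:R +
                               (pinned n sz Q s [:: (x : nat, y %/ m)%N])%:R).
Proof.
move=> sn v; rewrite /pat_count -sumrB; apply: le_trans (ler_norm_sum _ _ _) _.
pose F s' phi x y : R :=
  [&& size phi == sz, pat s' phi == Q & nth 0%N phi x == (y %/ m)%N]%:R.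
have pE s' x y : (pinned n sz Q s' [:: (x, y %/ m)%N])%:R = \sum_(phi <- node_lists n) F s' phi x y.
  rewrite /pinned_count -sum1_count natr_sum big_mkcond /=; apply: eq_bigr => phi _.
  by rewrite /F andbT; case: ifP.
have -> : \sum_(x < sz) \sum_(y <- t) ((pinned n sz Q (s ++ t) [:: (x : nat, y %/ m)%N])%:R +
      (pinned n sz Q s [:: (x : nat, y %/ m)%N])%:R) =
   \sum_(phi <- node_lists n) \sum_(x < sz) \sum_(y <- t) (F (s ++ t) phi x y + F s phi x y).
  rewrite [RHS]exchange_big /=; apply: eq_bigr => x _; rewrite [RHS]exchange_big /=.
  by apply: eq_bigr => y _; rewrite !pE big_split.
have F0 phi x y : 0 <= F (s ++ t) phi x y + F s phi x y by rewrite addr_ge0.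
rewrite big_mkcond big_seq [leRHS]big_seq; apply: ler_sum => phi hp.
case: (size phi =P sz) => [sp|_]; last by rewrite !sumr_ge0 // => x _; apply: sumr_ge0.
case: (boolP (all (fun x => x %/ m \notin phi)%N t)) => [h|].
  by rewrite (pat_extend hp) // subrr normr0 !sumr_ge0 // => x _; apply: sumr_ge0.
move=> /allPn[y yt]; rewrite negbK => yp.
have ix : (index (y %/ m) phi < sz)%N by rewrite -sp index_mem.
rewrite (bigD1 (Ordinal ix)) //=; apply: ler_wpDr.
  by apply: sumr_ge0 => x _; apply: sumr_ge0.
rewrite (big_rem y) //=; apply: ler_wpDr; first exact: sumr_ge0.
rewrite /F nth_index // sp !eqxx /= !andbT; apply: le_trans (ler_normB _ _) _.
by rewrite !normr_nat.
Qed.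

(** Both the lists affected by a new edge and those ending with the new node have a pinned position,
    which takes away one of the [k.+1] free choices. *)
Lemma cnt_increment sz Q U k : hits sz.+1 Q U -> size U = k.+1 ->
  exists C : R, forall n s t, size s = (m * n)%N -> size t = m -> valid s -> valid (s ++ t) ->
   `|cnt n.+1 sz.+1 Q (s ++ t) - cnt n sz.+1 Q s| <= C * n.+1%:R ^+ k.
Proof.
move=> h sU; pose B : R := ((m + weight sz.+1 Q) ^ sz.+1)%:R.
(* The first term covers [m] targets at [sz.+1] positions, before and after the change; in the
   second, [2 ^+ k] absorbs the passage from [n.+2] to [n.+1]. *)
exists (sz.+1%:R * (m%:R * (B + B)) + 2%:R ^+ k * B) => n s t ss st vs vst.
have sn : (m * n <= size s)%N by rewrite ss.
have snt : (m * n <= size (s ++ t))%N by rewrite size_cat ss leq_addr.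
have snt' : (m * n.+1 <= size (s ++ t))%N by rewrite size_cat ss st mulnS addnC.
rewrite cntS addrAC mulrDl; apply: le_trans (ler_normD _ _) _; apply: lerD; last first.
  rewrite ger0_norm; last by apply: sumr_ge0.
  apply: le_trans (cntn_le _ _ _ _) _.
  apply: (@le_trans _ _ (n.+2%:R ^+ k * B)).
    by rewrite /B -natrX -natrM ler_nat; apply: pinned1_le h sU snt' (leqnn _).
  rewrite [2%:R ^+ k * B]mulrC -mulrA [B * _]mulrC ler_wpM2r //.
  by rewrite -exprMn; apply: lerXn2r; rewrite ?nnegrE // -natrM ler_nat; lia.
apply: le_trans (cnt_diff _ _ sn vst) _.
have bnd s' x i : (m * n <= size s')%N -> (x < sz.+1)%N ->
    (pinned n sz.+1 Q s' [:: (x, i)])%:R <= n.+1%:R ^+ k * B.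
  by move=> h1 h2; rewrite /B -natrX -natrM ler_nat; apply: pinned1_le h sU h1 h2.
apply: (@le_trans _ _ (\sum_(x < sz.+1) \sum_(y <- t) (n.+1%:R ^+ k * (B + B)))).
  apply: ler_sum => x _; apply: ler_sum => y _; rewrite mulrDr.
  by apply: lerD; apply: bnd.
rewrite sumr_const card_ord big_const_seq count_predT iter_addr_0 st.
rewrite -[X in X <= _]mulr_natl -[X in _ * X <= _]mulr_natl.
move: (n.+1%:R ^+ k) => z; lra.
Qed.

Lemma iter_cnt n sz Q j s : size s = (m * n)%N -> valid s -> (j < m)%N ->
  iter j.+1 (@Step R) (cnt n sz Q) s = \sum_(la <- None :: slots sz)
    coef (m * n + j) sz None Q la * iter j (@Step R) (cnt n sz (ustep Q la None)) s.
Proof.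
move=> ss v jm; rewrite iterSr.
rewrite (@iterStep_eq R j s _ (fun s' => \sum_(la <- None :: slots sz)
    coef (m * n + j) sz None Q la * cnt n sz (ustep Q la None) s')) //; last first.
  move=> t st vt; rewrite (@Step_cnt R m m0 n sz Q (s ++ t)) // size_cat ss st //.
  by rewrite leq_addr /= mulnS addnC ltn_add2r.
by rewrite iterStep_sum; apply: eq_bigr => la _; rewrite iterStepZ.
Qed.

Lemma iter_cntn n sz Q j s : size s = (m * n)%N -> valid s -> (j < m)%N ->
  iter j.+1 (@Step R) (cntn n sz Q) s = \sum_(la <- None :: slots sz.+1)
    coef (m * n + j) sz.+1 (Some (sz, j)) Q la *
    iter j (@Step R) (cntn n sz (ustep Q la (Some (sz, j)))) s.
Proof.
move=> ss v jm; rewrite iterSr.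
rewrite (@iterStep_eq R j s _ (fun s' => \sum_(la <- None :: slots sz.+1)
    coef (m * n + j) sz.+1 (Some (sz, j)) Q la * cntn n sz (ustep Q la (Some (sz, j))) s')) //; last first.
  move=> t st vt; rewrite (@Step_cntn R m m0 n sz Q (s ++ t)) // size_cat ss st // ?addKn //.
  by rewrite leq_addr /= mulnS addnC ltn_add2r.
by rewrite iterStep_sum; apply: eq_bigr => la _; rewrite iterStepZ.
Qed.

Section Coefficients.
Local Open Scope classical_set_scope.

Lemma cvg_slope j :
  (fun n => n.+1%:R / (2 * (m * n + j) + 1)%:R : R) @ \oo --> ((2 * m)%:R^-1 : R).
Proof.
pose e n : R := (2 * (m * n + j) + 1)%:R^-1.
have he : e @ \oo --> 0.
  apply: (cvg0_le _ _ (@cvg_invS R)) => [n|]; first by rewrite invr_ge0.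
  exists 0%N => n _; rewrite /e lef_pV2 ?posrE ?ltr0n ?addn1 // ler_nat.
  by move: m0; nia.
have m0' : (2 * m)%:R != 0 :> R by rewrite pnatr_eq0; lia.
rewrite (_ : (fun n => _) = fun n => (2 * m)%:R^-1 * (1 + ((2 * m)%:R - (2 * j + 1)%:R) * e n)).
  have -> : (fun n => (2 * m)%:R^-1 * (1 + ((2 * m)%:R - (2 * j + 1)%:R) * e n)) @ \oo -->
      ((2 * m)%:R^-1 : R) = ((fun n => (2 * m)%:R^-1 * (1 + ((2 * m)%:R - (2 * j + 1)%:R) * e n))
      @ \oo --> ((2 * m)%:R^-1 * (1 + ((2 * m)%:R - (2 * j + 1)%:R) * 0) : R)).
    by rewrite mulr0 addr0 mulr1.
  by apply: cvgM; [exact: cvg_cst|apply: cvgD; [exact: cvg_cst|apply: cvgM => //; exact: cvg_cst]].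
apply/funext => n.
have d0 : (2 * (m * n + j) + 1)%:R != 0 :> R by rewrite pnatr_eq0 addn1.
apply: (mulfI m0'); rewrite [RHS]mulrA divff // mul1r mulrA -natrM.
apply: (mulIf d0); rewrite divfK // mulrDl mul1r /e -mulrA mulVf // mulr1.
by rewrite -[n.+1]addn1 !(natrD, natrM); lra.
Qed.

Lemma coef_Some_cvg sz nu Q la j : la != None ->
  exists c : R, (fun n => n.+1%:R * coef (m * n + j) sz nu Q la) @ \oo --> c.
Proof.
case: la => // ab _; rewrite /step_coef /slot_prob.
set d := (hstep _ _ _ == Q)%:R; set w := (mass _ _ _)%:R.
exists (d * w * (2 * m)%:R^-1).
rewrite (_ : (fun n => _) = fun n => d * w * (n.+1%:R / (2 * (m * n + j) + 1)%:R)).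
  by apply: cvgM (cvg_slope j); exact: cvg_cst.
by apply/funext => n; move: (_%:R^-1) => x; lra.
Qed.

Lemma cvg_of_slope (c : nat -> R) (c0 : R) :
  (fun n => n.+1%:R * c n) @ \oo --> c0 -> c @ \oo --> 0.
Proof.
move=> h; rewrite (_ : c = (fun n => n.+1%:R^-1) \* (fun n => n.+1%:R * c n)).
  by rewrite -[X in _ --> X](mul0r c0); apply: cvgM h; exact: cvg_invS.
by apply/funext => n /=; rewrite mulrA mulVf ?mul1r // pnatr_eq0.
Qed.

Lemma coef_cvg sz nu Q la j : exists c : R, (fun n => coef (m * n + j) sz nu Q la) @ \oo --> c.
Proof.
case: (la =P None) => [->|/eqP h]; last first.
  by have [c /cvg_of_slope hc] := coef_Some_cvg sz nu Q j h; exists 0.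
rewrite /step_coef /slot_prob; set d := (_ == Q)%:R; set w := (total _ _ _ _)%:R.
exists (d * (1 - w * 0)); apply: cvgM; first exact: cvg_cst.
apply: cvgB; first exact: cvg_cst.
apply: cvgM; first exact: cvg_cst.
exact: cvg_of_slope (cvg_slope j).
Qed.

End Coefficients.

(** The edges of the node [n] are undone one at a time. Before its birth the list has one position
    and one representative fewer, hence the power [k]. *)
Lemma new_conv sz : (forall Q U, hits sz Q U -> L1conv (size U) (fun n s => cnt n sz Q s)) ->
  forall j, (j <= m)%N -> forall Q U k, hits sz.+1 Q U -> size U = k.+1 ->
  L1conv k (fun n s => iter j (@Step R) (cntn n sz Q) s).
Proof.
move=> IHsz; elim=> [_|j IH jm] Q U k h sU.
  case: (pselect (wfp sz Q)) => w; last first.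
    apply: L1conv_eq (@L1conv0 R m k) => n s ss vs.
    by rewrite /= cntn_base // cntE pinned0.
  have [V sV hV] := hits_last w h.
  have -> : k = size V by move: sV; rewrite sU => -[].
  by apply: L1conv_eq (IHsz Q V hV) => n s ss vs; rewrite /= cntn_base.
apply: (@L1conv_eq R m k (fun n s => \sum_(la <- None :: slots sz.+1)
    coef (m * n + j) sz.+1 (Some (sz, j)) Q la *
    iter j (@Step R) (cntn n sz (ustep Q la (Some (sz, j)))) s)).
  by move=> n s ss vs; rewrite iter_cntn.
apply: L1conv_sum => la hla; set P := ustep _ _ _.
case: (hstep P la (Some (sz, j)) =P Q) => [QE|nE]; last first.
  apply: L1conv_eq (@L1conv0 R m k) => n s _ _.
  by rewrite /step_coef -/P (introF eqP nE) !mul0r.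
have adjP x y : adj Q x y -> adj P x y \/
    exists v b, la = Some (v, b) /\ (x = sz /\ y = v \/ x = v /\ y = sz).
  by rewrite -QE; apply: hstep_adj_new.
case: la hla @P QE adjP => [[v b]|] hla P QE adjP.
  have [c hc] := coef_Some_cvg sz.+1 (Some (sz, j)) Q j (isT : Some (v, b) != None).
  (* Cutting the edge from [sz] to [v] may cost one more representative, hence one more power of
     [n]; the coefficient of order [1/n] compensates it. *)
  apply: (L1conv_shift hc).
  have [W sW hW] := hits_swap h (leqnn sz.+1).
  have hP : hits sz.+1 P [:: sz, v & W].
    apply: hits_cut hW => x y /adjP[h1|[v' [b' [[<- _] [h1|h1]]]]].
    - by constructor 1. - by constructor 2. - by constructor 3.
  by apply: (IH (ltnW jm) P _ k.+1 hP); rewrite /= sW sU.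
have [c hc] := coef_cvg sz.+1 (Some (sz, j)) Q None j.
apply: (L1convZ hc); apply: (IH (ltnW jm) P U k) => //.
by apply: hits_sub h => x y /adjP[//|[v' [b' []]]].
Qed.

(** An unborn vertex cannot be a target; at a vertex already born, undoing the arrival deletes a
    recorded edge. *)
Lemma ustep_weight sz Q a b : hstep (ustep Q (Some (a, b)) None) (Some (a, b)) None = Q ->
  (a < sz)%N -> (b < m)%N ->
  mass (ustep Q (Some (a, b)) None) None (Some (a, b)) = 0%N \/
  (weight sz (ustep Q (Some (a, b)) None) < weight sz Q)%N.
Proof.
set P := ustep _ _ _ => QE ha hb; rewrite /mass /=.
case PE : (P a b) => [e|]; [right|by left].
have Q0 : Q a b = Some (rcons e.1 None, e.2) by rewrite -QE /hstep /= PE eqxx.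
have le x y : ((if P x y is Some e' then size e'.1 else 0) <=
    (if Q x y is Some e' then size e'.1 else 0))%N.
  rewrite -QE /hstep /=; case: ifP => _ //.
  by case: (P x y) => [[i o]|] //=; rewrite size_rcons.
rewrite /pat_weight (bigD1 (Ordinal ha)) //= [X in (_ < X)%N](bigD1 (Ordinal ha)) //=.
rewrite -addSn; apply: leq_add; last by apply: leq_sum => x _; apply: leq_sum => y _.
rewrite (bigD1 (Ordinal hb)) //= [X in (_ < X)%N](bigD1 (Ordinal hb)) //=.
rewrite PE Q0 size_rcons -addSn; apply: leq_add => //.
by apply: leq_sum => y _.
Qed.

Lemma hstep_None P : hstep P None None = P.
Proof. by apply/funext => a; apply/funext => b. Qed.

Lemma ustep_None P : ustep P None None = P.
Proof. by apply/funext => a; apply/funext => b. Qed.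

Lemma old_conv sz w0 : (forall P U, hits sz P U -> (weight sz P < w0)%N ->
    L1conv (size U) (fun n s => cnt n sz P s)) ->
  forall j, (j <= m)%N -> forall P U, hits sz P U -> (weight sz P < w0)%N ->
    L1conv (size U) (fun n s => iter j (@Step R) (cnt n sz P) s).
Proof.
move=> IHw; elim=> [_|j IH jm] Q U h wQ; first exact: IHw.
apply: (@L1conv_eq R m _ (fun n s => \sum_(la <- None :: slots sz)
    coef (m * n + j) sz None Q la * iter j (@Step R) (cnt n sz (ustep Q la None)) s)).
  by move=> n s ss vs; rewrite iter_cnt.
apply: L1conv_sum => la hla; have [c hc] := coef_cvg sz None Q la j.
case: (hstep (ustep Q la None) la None =P Q) => [QE|nE]; last first.
  apply: L1conv_eq (@L1conv0 R m _) => n s _ _.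
  by rewrite /step_coef (introF eqP nE) !mul0r.
case: la hla QE hc => [[a b]|] hla QE hc; last first.
  by apply: (L1convZ hc); rewrite ustep_None; apply: (IH (ltnW jm)).
have /andP[ha hb] : (a < sz)%N && (b < m)%N by move: hla; rewrite inE /= mem_slots.
case: (ustep_weight QE ha hb) => [mE|wP].
  apply: L1conv_eq (@L1conv0 R m _) => n s _ _.
  by rewrite /step_coef /slot_prob mE !mul0r mulr0 mul0r.
apply: (L1convZ hc); apply: (IH (ltnW jm)); last exact: ltn_trans wP wQ.
by apply: hits_sub h => x y; rewrite -{1}QE; apply: hstep_adj_old.
Qed.

(** The conditional probability that [j] consecutive edges of the node [n], lying outside the list,
    all miss a given occurrence of [Q]. *)
Definition decay sz Q j n : R :=
  \prod_(i < j) (1 - (total m sz Q None)%:R / (2 * (m * n + i) + 1)%:R).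

(** An occurrence of [Q] either persists without being hit, or arises from a pattern of smaller
    weight by a hit of probability of order [1/n]. The second kind makes up [W], one power of [n]
    below the count. *)
Lemma old_decomp sz Q U k : (forall P U, hits sz P U -> (weight sz P < weight sz Q)%N ->
    L1conv (size U) (fun n s => cnt n sz P s)) ->
  hits sz Q U -> size U = k.+1 ->
  forall j, (j <= m)%N -> exists2 W : nat -> seq nat -> R, L1conv k W &
    forall n s, size s = (m * n)%N -> valid s ->
      iter j (@Step R) (cnt n sz Q) s = decay sz Q j n * cnt n sz Q s + W n s.
Proof.
move=> IHw h sU; elim=> [_|j IH jm].
  exists (fun _ _ => 0); first exact: L1conv0.
  by move=> n s _ _; rewrite /decay big_ord0 mul1r addr0.
have [W hW WE] := IH (ltnW jm).
exists (fun n s => coef (m * n + j) sz None Q None * W n s +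
   \sum_(la <- slots sz) coef (m * n + j) sz None Q la *
     iter j (@Step R) (cnt n sz (ustep Q la None)) s); last first.
  move=> n s ss vs; rewrite iter_cnt // big_cons ustep_None WE // mulrDr -!addrA.
  congr (_ + _); rewrite mulrA; congr (_ * _).
  rewrite /step_coef ustep_None hstep_None eqxx mul1r /slot_prob /decay big_ord_recr /=.
  exact: mulrC.
apply: L1convD.
  by have [c hc] := coef_cvg sz None Q None j; apply: (L1convZ hc).
apply: L1conv_sum => -[[a b]|hla]; last by rewrite (negbTE (slots_None _ _)) in hla.
rewrite mem_slots => /andP[ha hb].
case: (hstep (ustep Q (Some (a, b)) None) (Some (a, b)) None =P Q) => [QE|nE]; last first.
  apply: L1conv_eq (@L1conv0 R m _) => n s _ _.
  by rewrite /step_coef (introF eqP nE) !mul0r.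
case: (ustep_weight QE ha hb) => [mE|wP].
  apply: L1conv_eq (@L1conv0 R m _) => n s _ _.
  by rewrite /step_coef /slot_prob mE !mul0r mulr0 mul0r.
have [c hc] := coef_Some_cvg sz None Q j (isT : Some (a, b) != None).
apply: (L1conv_shift hc); rewrite -sU; apply: (old_conv IHw (ltnW jm)) => //.
by apply: hits_sub h => x y; rewrite -{1}QE; apply: hstep_adj_old.
Qed.

Section Decay.
Local Open Scope classical_set_scope.

Lemma decay_cvg sz Q j : exists2 c : R, 0 <= c &
  (fun n => n.+1%:R * (1 - decay sz Q j n)) @ \oo --> c.
Proof.
elim: j => [|j [c c0 hc]].
  exists 0 => //; rewrite (_ : (fun n => _) = fun=> 0); first exact: cvg_cst.
  by apply/funext => n; rewrite /decay big_ord0 subrr mulr0.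
pose w : R := (total m sz Q None)%:R.
exists (c + 1 * (w * (2 * m)%:R^-1)); first by rewrite addr_ge0 // mul1r mulr_ge0 // invr_ge0.
rewrite (_ : (fun n => _) = (fun n => n.+1%:R * (1 - decay sz Q j n)) \+
   (fun n => decay sz Q j n) \* (fun n => w * (n.+1%:R / (2 * (m * n + j) + 1)%:R))).
  apply: cvgD => //; apply: cvgM; last by apply: cvgM (cvg_slope j); exact: cvg_cst.
  have h1 := cvg_of_slope hc.
  rewrite (_ : (fun n => _) = (fun=> 1) \- (fun n => 1 - decay sz Q j n)).
    by rewrite -[X in _ --> X](subr0 (1 : R)); apply: (cvgB _ h1); exact: cvg_cst.
  by apply/funext => n /=; lra.
apply/funext => n /=; rewrite {1}/decay big_ord_recr /= -/(decay sz Q j n) -/w.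
by move: (_%:R^-1) (decay sz Q j n) => x y; lra.
Qed.

End Decay.

(** For such [n] all factors are nonnegative. *)
Lemma decay_le1 sz Q j n : (total m sz Q None <= n)%N -> decay sz Q j n <= 1.
Proof.
move=> h; apply: prodr_ile1 => i _; apply/andP; split; last first.
  by rewrite gerBl divr_ge0.
rewrite subr_ge0 ler_pdivrMr ?ltr0n ?addn1 // mul1r ler_nat.
by move: m0; nia.
Qed.

(* Lists of older nodes had, one step before, the same pattern (this gives the drift) or one
   with a recorded incoming edge less, hence of smaller weight.  For lists ending with the
   node being built, undoing its edges may split components, which is compensated by the
   choice of that node no longer being free. *)
Theorem cnt_conv sz Q U : hits sz Q U -> L1conv (size U) (fun n s => cnt n sz Q s).
Proof.
elim: sz Q U => [|sz IHsz] Q U h.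
  apply: L1conv_eq (@L1conv_const R m (size U) ((fun _ _ => None) == Q)%:R) => n s _ _.
  by rewrite cnt0.
have [w] := ubnP (weight sz.+1 Q); elim: w Q U h => // w IHw Q U h; rewrite ltnS => wQ.
have IHw' P V : hits sz.+1 P V -> (weight sz.+1 P < weight sz.+1 Q)%N ->
    L1conv (size V) (fun n s => cnt n sz.+1 P s).
  by move=> hP wP; apply: IHw => //; apply: leq_trans wP wQ.
have [k sU] : exists k, size U = k.+1.
  by have [x + _] := h 0%N isT; case: (U) => // y V _; exists (size V).
have [W hW WE] := old_decomp IHw' h sU (leqnn m).
have hZ := new_conv IHsz (leqnn m) h sU.
have [c c0 hc] := decay_cvg sz.+1 Q m.
have [C hC] := cnt_increment h sU.
pose B : R := ((m + weight sz.+1 Q) ^ sz.+1)%:R.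
rewrite sU; apply: (L1conv_drift (C := Num.max B C) (n0 := total m sz.+1 Q None) hc c0 _ _ (L1convD hW hZ)).
- by move=> n; apply: decay_le1.
- move=> n s ss vs; rewrite addrA -WE // -iterStepD; apply: iterStep_eq => // t _ _.
  by rewrite cntS.
- move=> n s ss vs; rewrite ger0_norm; last exact: cnt_ge0.
  apply: le_trans (cnt_le h _) _; first by rewrite ss.
  by rewrite sU; apply: ler_wpM2r; rewrite ?exprn_ge0 // le_max lexx.
- move=> n s t ss st vs vst; apply: le_trans (hC n s t ss st vs vst) _.
  by apply: ler_wpM2r; rewrite ?exprn_ge0 // le_max lexx orbT.
Qed.

End PatternConvergence.

(** * A moment of the degrees above the first *)

Section DegreeMoment.
Variable R : realType.
Implicit Types (s : seq nat) (N d i : nat).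

(* Chosen so that [d * grow d] satisfies [d * (f d.+1 - f d) = 3/2 * f d]: the drift of
   its sum over all degrees is then linear with a rate [3/4 < 1]. *)
Definition grow d : R := \prod_(i < d) ((i%:R + 3 / 2) / i.+1%:R).

Lemma growS d : d.+1%:R * grow d.+1 = (d%:R + 3 / 2) * grow d.
Proof. by rewrite /grow big_ord_recr /= mulrCA [X in _ * X]mulrC divfK // mulrC. Qed.

Lemma grow_gt0 d : 0 < grow d.
Proof. by apply: prodr_gt0 => i _; rewrite divr_gt0 // ltr_wpDl. Qed.

Lemma grow_mono d d' : (d <= d')%N -> grow d <= grow d'.
Proof.
move/subnK <-; elim: (d' - d)%N => // e IH; apply: le_trans IH _; rewrite addSn.
rewrite /grow big_ord_recr /= -/(grow _) ler_peMr ?(ltW (grow_gt0 _)) //.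
by rewrite ler_pdivlMr // mul1r -addn1 natrD; lra.
Qed.

(** By [(d + 3/2)^2 >= (d + 1)(d + 2)]; in fact [grow] is a quotient of Gamma values, of order
    [sqrt d]. *)
Lemma grow_sqr d : d.+1%:R <= grow d ^+ 2.
Proof.
elim: d => [|d IH]; first by rewrite /grow big_ord0 expr1n.
rewrite /grow big_ord_recr /= -/(grow d) exprMn expr_div_n mulrA ler_pdivlMr ?exprn_gt0 //.
have : d.+1%:R * (d%:R + 3 / 2) ^+ 2 <= grow d ^+ 2 * (d%:R + 3 / 2) ^+ 2.
  by apply: ler_wpM2r => //; apply: sqr_ge0.
apply: le_trans; rewrite -[d.+2]addn2 -[d.+1]addn1 !natrD.
have : 0 <= d%:R :> R by [].
move: (d%:R) => x x0; nra.
Qed.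

Lemma grow_unbounded (A : R) : exists d, A <= grow d.
Proof.
exists (Num.bound (A ^+ 2)); apply: le_trans (ler_norm _) _.
have h : `|A| ^+ 2 <= grow (Num.bound (A ^+ 2)) ^+ 2.
  rewrite real_normK ?num_real //; apply: le_trans (grow_sqr _).
  apply: le_trans (ltW (archi_boundP (sqr_ge0 A))) _.
  by rewrite ler_nat.
by move: h; rewrite ler_pXn2r ?nnegrE // ltW // grow_gt0.
Qed.

Definition lyap d : R := d%:R * grow d.

Lemma lyapS d : d%:R * (lyap d.+1 - lyap d) = 3 / 2 * lyap d.
Proof. by rewrite /lyap growS; lra. Qed.

Lemma lyap_mono d d' : (d <= d')%N -> lyap d <= lyap d'.
Proof. by move=> h; apply: ler_pM; rewrite ?ler_nat ?grow_mono // ltW // grow_gt0. Qed.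

Lemma lyap_ge0 d : 0 <= lyap d.
Proof. by rewrite mulr_ge0 // ltW // grow_gt0. Qed.

Definition energy s : R := \sum_(x < size s) lyap (hdeg s x).

(** [lyap 2] accounts for the new vertex, whose degree is 2 if it chooses a loop. *)
Lemma energy_rcons s i : valid s -> (i <= size s)%N -> energy (rcons s i) <=
  energy s + lyap 2 + \sum_(x < size s) (i == x)%:R * (lyap (hdeg s x).+1 - lyap (hdeg s x)).
Proof.
move=> v hi; rewrite /energy size_rcons big_ord_recr /= addrAC lerD //; last first.
  apply: lyap_mono; rewrite /hdeg size_rcons leqnn -cats1 count_cat /= addn0.
  rewrite (_ : count_mem (size s) s = 0%N) ?add0n; first by case: (_ == _).
  apply/eqP; rewrite -leqn0 leqNgt -has_count; apply/hasPn => x /(valid_lt v) xs.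
  by rewrite /= neq_ltn xs.
rewrite -big_split /=; apply: ler_sum => x _.
have -> : hdeg (rcons s i) x = (hdeg s x + (i == x))%N.
  rewrite /hdeg size_rcons -cats1 count_cat /= addn0 ltnS (ltnW (ltn_ord x)) ltn_ord.
  by rewrite addnA.
case: (i == x); rewrite ?mul1r ?mul0r ?addr0 ?addn0 // addn1; lra.
Qed.

Lemma Step_energy s : valid s ->
  Step energy s <= (1 + 3 / 2 / (2 * size s + 1)%:R) * energy s + lyap 2.
Proof.
move=> v; pose D x := lyap (hdeg s x).+1 - lyap (hdeg s x).
apply: (@le_trans _ _ (\sum_(i < (size s).+1) wt R s i *
   (energy s + lyap 2 + \sum_(x < size s) ((i : nat) == x)%:R * D x))).
  apply: ler_sum => i _; apply: ler_wpM2l; first exact: wt_ge0.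
  by apply: energy_rcons => //; rewrite -ltnS.
under eq_bigr do rewrite mulrDr.
rewrite big_split /= -mulr_suml wt_sum // mul1r.
under [X in _ + X]eq_bigr do rewrite mulr_sumr.
suff -> : \sum_(i < (size s).+1) \sum_(x < size s) wt R s i * (((i : nat) == x)%:R * D x) =
    3 / 2 / (2 * size s + 1)%:R * energy s.
  by move: (3 / 2 / _) (energy s) (lyap 2) => x y z; lra.
rewrite exchange_big /= /energy mulr_sumr; apply: eq_bigr => x _.
have xs : (x < (size s).+1)%N by rewrite ltnS ltnW.
rewrite (bigD1 (Ordinal xs)) //= eqxx mul1r big1 ?addr0.
  by rewrite /wt ltn_ord mulrAC /D lyapS mulrAC.
move=> i ix; rewrite (_ : _ == _ = false) ?mul0r ?mulr0 //; apply/negbTE.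
by apply: contra ix => /eqP e; apply/eqP/val_inj.
Qed.

(** The factor 4 is [1 / (1 - 3/4)]: a bound [B * N] is preserved as soon as
    [3/4 * B + lyap 2 <= B]. *)
Lemma EN_energy N : EN N energy <= 4 * lyap 2 * N%:R.
Proof.
elim: N => [|N IH]; first by rewrite /EN /= /energy big_ord0 mulr0.
rewrite -addn1 EN_add /=.
apply: (@le_trans _ _ (EN N (fun s => (1 + 3 / 2 / (2 * N + 1)%:R) * energy s + lyap 2))).
  by apply: EN_le => s ss vs; have := Step_energy vs; rewrite ss.
rewrite END ENZ EN_const.
have h : 0 <= 1 + 3 / 2 / (2 * N + 1)%:R :> R by rewrite addr_ge0 // divr_ge0.
apply: le_trans (lerD (ler_wpM2l h IH) (lexx _)) _.
have n0 : 0 < (2 * N + 1)%:R :> R by rewrite ltr0n addn1.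
have : 3 / 2 / (2 * N + 1)%:R * N%:R <= 3 / 4 :> R.
  by rewrite mulrAC ler_pdivrMr // natrD natrM; have : 0 <= N%:R :> R by []; lra.
have := lyap_ge0 2; rewrite [(N + 1)%:R]natrD.
move: (_ / (2 * N + 1)%:R) (lyap 2) (N%:R) => x y z; nra.
Qed.

End DegreeMoment.

(** * The merged graph and its degrees *)

Section BAGraph.
Variables (R : realType) (m : nat).
Hypothesis m0 : (0 < m)%N.

Definition BA_edge (s : seq nat) (x y : nat) := (x != y) &&
  has (fun t => ((t %/ m == x) && (nth 0 s t %/ m == y)) ||
                ((t %/ m == y) && (nth 0 s t %/ m == x)))%N (iota 0 (size s)).

Lemma BA_graphE n (c : {ffun 'I_(m * n) -> 'I_(m * n)}) (x y : 'I_n) :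
  ((x, y) \in BA_graph c) = BA_edge (codes c) x y.
Proof.
rewrite inE /= /BA_edge; congr (_ && _); rewrite size_codes; apply/existsP/hasP.
  by move=> [t ht]; exists (t : nat); rewrite ?mem_iota //= nth_codes.
move=> [t]; rewrite mem_iota add0n => /= tn; exists (Ordinal tn).
by rewrite -(nth_codes c (Ordinal tn)).
Qed.

Lemma BA_simple n (c : {ffun 'I_(m * n) -> 'I_(m * n)}) : simple_graph (BA_graph c).
Proof.
split=> [x y|x]; rewrite !inE /= ?eqxx // => /andP[ne /existsP[t ht]].
by rewrite eq_sym ne; apply/existsP; exists t; rewrite orbC.
Qed.

(** The degree in the multigraph, before loops and repeated edges are removed. *)
Definition BA_dg n (c : {ffun 'I_(m * n) -> 'I_(m * n)}) (v : 'I_n) : nat :=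
  (\sum_(j < m) hdeg (codes c) (m * v + j))%N.

Lemma half_lt n (v : 'I_n) j : (j < m)%N -> (m * v + j < m * n)%N.
Proof.
move=> jm; apply: (@leq_trans (m * v.+1)%N); last by rewrite leq_mul2l ltn_ord orbT.
by rewrite mulnS addnC ltn_add2r.
Qed.

Lemma BA_dgE n (c : {ffun 'I_(m * n) -> 'I_(m * n)}) (v : 'I_n) :
  BA_dg c v = (m + count (fun t => nth 0 (codes c) t %/ m == v) (iota 0 (m * n)))%N.
Proof.
rewrite /BA_dg /hdeg; have sc := size_codes c; move: (codes c) sc => s sc.
rewrite big_split /=; congr addn.
  rewrite (eq_bigr (fun=> 1%N)); first by rewrite sum1_card card_ord.
  by move=> j _; rewrite sc half_lt.
rewrite (eq_count (a2 := fun t => nth 0%N s t \in [seq m * v + b | b <- iota 0 m]%N)); last first.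
  move=> t; apply/eqP/mapP => [e|[b]].
    exists (nth 0 s t %% m)%N; first by rewrite mem_iota add0n ltn_pmod.
    by rewrite -e mulnC -divn_eq.
  rewrite mem_iota add0n => /= bm ->; by rewrite mulnC divnMDl // divn_small ?addn0.
rewrite -sum_size_iota; last first.
  by rewrite map_inj_uniq ?iota_uniq // => b b' /addnI.
rewrite big_map -[in RHS](subn0 m) -/(index_iota 0 m) big_mkord subn0; apply: eq_bigr => b _.
rewrite -[in LHS](mkseq_nth 0%N s) /mkseq count_map sc.
by apply: eq_count => t.
Qed.

Lemma BA_dgP n (c : {ffun 'I_(m * n) -> 'I_(m * n)}) (x : 'I_n) :
  (#|[set y | (x, y) \in BA_graph c]| <= BA_dg c x)%N.
Proof.
rewrite BA_dgE; have sc := size_codes c; have eE := BA_graphE c.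
move: (codes c) sc eE => s sc eE.
pose L := [seq nth 0 s (m * x + b) %/ m | b <- iota 0 m]%N ++
    [seq t %/ m | t <- [seq t <- iota 0 (m * n) | nth 0 s t %/ m == x]]%N.
apply: (@leq_trans (size L)).
  rewrite cardE -(size_map val); apply: uniq_leq_size.
    by rewrite map_inj_uniq ?enum_uniq //; apply: val_inj.
  move=> _ /mapP[y yx ->]; move: yx; rewrite mem_enum inE eE => /andP[_ /hasP[t]].
  rewrite mem_iota add0n sc mem_cat => /= tn /orP[/andP[/eqP tx /eqP ty]|/andP[/eqP ty tx]].
    apply/orP; left; apply/mapP; exists (t %% m)%N; first by rewrite mem_iota add0n ltn_pmod.
    by rewrite -ty -tx mulnC -divn_eq.
  apply/orP; right; apply/mapP; exists t; last by rewrite ty.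
  by rewrite mem_filter mem_iota tx.
by rewrite size_cat !size_map size_iota size_filter.
Qed.

Lemma sum_halves n (F : nat -> R) :
  \sum_(v < n) \sum_(j < m) F (m * v + j)%N = \sum_(i < m * n) F i.
Proof.
rewrite -[RHS](big_mkord xpredT F); elim: n => [|n IH].
  by rewrite big_ord0 muln0 big_geq.
rewrite big_ord_recr /= IH mulnS addnC [RHS](big_cat_nat (n := (m * n)%N)) ?leq_addr //=.
congr (_ + _); rewrite -[X in \sum_(X <= _ < _) _]add0n big_addn addKn big_mkord.
by apply: eq_bigr => j _; rewrite addnC.
Qed.

Lemma BA_prob_sum n : \sum_(c : {ffun 'I_(m * n) -> 'I_(m * n)}) BA_weight R c = 1.
Proof.
rewrite -[RHS](EN_const (m * n) (1 : R)) -BA_expectation.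
by apply: eq_bigr => c _; rewrite mulr1.
Qed.

Lemma BA_weight_ge0 N (c : {ffun 'I_N -> 'I_N}) : 0 <= BA_weight R c.
Proof.
by apply: prodr_ge0 => t _; apply: divr_ge0 => //; do 2?case: ifP.
Qed.

(** The energy controls single vertices. A merged degree is at most [m] times the largest of its [m]
    parts, whence the division by [m] inside [grow]. *)
Lemma BA_degree_moment n :
  \sum_(c : {ffun 'I_(m * n) -> 'I_(m * n)}) BA_weight R c *
     (\sum_v (BA_dg c v)%:R * grow R (BA_dg c v %/ m)) <= m%:R * (4 * lyap R 2 * m%:R) * n%:R.
Proof.
apply: (@le_trans _ _ (\sum_(c : {ffun 'I_(m * n) -> 'I_(m * n)}) BA_weight R c *
    (m%:R * energy R (codes c)))).
  apply: ler_sum => c _; apply: ler_wpM2l; first exact: BA_weight_ge0.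
  rewrite /energy size_codes -(sum_halves n (fun i => lyap R (hdeg (codes c) i))) mulr_sumr.
  apply: ler_sum => v _.
  rewrite /BA_dg; set h := fun j : 'I_m => hdeg (codes c) (m * v + j).
  pose j0 := Ordinal m0; pose j1 := [arg max_(j > j0) h j].
  have jP j : (h j <= h j1)%N by rewrite /j1; case: arg_maxnP => // i _; apply.
  have le1 : (\sum_(j < m) h j <= m * h j1)%N.
    rewrite -[X in (_ <= X * _)%N](card_ord m) -sum_nat_const.
    by apply: leq_sum => j _; apply: jP.
  apply: (@le_trans _ _ (m%:R * lyap R (h j1))); last first.
    apply: ler_wpM2l => //; rewrite (bigD1 j1) //= lerDl.
    by apply: sumr_ge0 => j _; apply: lyap_ge0.
  rewrite /lyap mulrA; apply: ler_pM => //; first exact/ltW/grow_gt0.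
    by rewrite -natrM ler_nat.
  by apply: grow_mono; apply: (@leq_trans (m * h j1 %/ m)%N); [apply: leq_div2r | rewrite mulKn].
rewrite (BA_expectation _ (fun s => m%:R * energy R s)) ENZ -mulrA.
apply: ler_wpM2l => //; apply: le_trans (EN_energy R _) _.
by rewrite natrM mulrA.
Qed.

End BAGraph.

(** * Types of nodes in the preferential attachment graph *)

Section BATypes.
Variables (R : realType) (m : nat).
Hypothesis m0 : (0 < m)%N.
Variable l : nat.
Local Notation choices n := {ffun 'I_(m * n) -> 'I_(m * n)}.
Local Notation pat := (pattern_of m).
Local Notation loc := (slot_of m).

Definition BA_list n (c : choices n) (v : 'I_n) : seq nat :=
  vals (ball (BA_graph c) l (fun _ : 'I_1 => v)).

Definition BA_typ n (c : choices n) (v : 'I_n) : nat * pattern * nat :=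
  (size (BA_list c v), pat (codes c) (BA_list c v), index (val v) (BA_list c v)).

Lemma BA_list_node_lists n (c : choices n) v : BA_list c v \in node_lists n.
Proof. by rewrite mem_node_lists vals_sorted. Qed.

Lemma mem_BA_list n (c : choices n) (v x : 'I_n) :
  (val x \in BA_list c v) = within (BA_graph c) l v x.
Proof.
rewrite mem_vals inE; apply/existsP/idP => [[i] //|h]; by exists ord0.
Qed.

Lemma loc_nth phi b h : uniq phi -> (b < size phi)%N -> (h %/ m)%N = nth 0%N phi b ->
  loc phi h = Some (b, (h %% m)%N).
Proof.
move=> u bp e; apply/eqP; rewrite locP // bp ltn_pmod //= -e.
by rewrite [(m * _)%N]mulnC -divn_eq.
Qed.

Lemma BA_edge_adj n (s phi : seq nat) a b : size s = (m * n)%N -> phi \in node_lists n ->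
  (a < size phi)%N -> (b < size phi)%N ->
  BA_edge m s (nth 0%N phi a) (nth 0%N phi b) <-> a <> b /\ adj (pat s phi) a b.
Proof.
move=> ss /node_listsP[u pn] ha hb; rewrite /BA_edge nth_uniq //.
have half x y t : (x < size phi)%N -> (y < size phi)%N -> (t < size s)%N ->
    (t %/ m)%N = nth 0%N phi x -> (nth 0 s t %/ m)%N = nth 0%N phi y ->
    exists b b' ins, pat s phi x b = Some (ins, Some (y, b')).
  move=> hx hy ht tx ty; exists (t %% m)%N, (nth 0 s t %% m)%N.
  rewrite /pattern_of hx ltn_pmod //= -tx [(m * _)%N]mulnC -divn_eq ht.
  by rewrite (loc_nth u hy ty); eexists.
have flah x y : (exists b b' ins, pat s phi x b = Some (ins, Some (y, b'))) ->
    exists2 t, (t < size s)%N & (t %/ m)%N = nth 0%N phi x /\ (nth 0 s t %/ m)%N = nth 0%N phi y.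
  move=> [j [j' [ins]]]; rewrite /pattern_of; case: ifP => // /and3P[_ jm hs] [_ /eqP].
  rewrite locP // => /and3P[_ j'm /eqP e]; exists (m * nth 0 phi x + j)%N => //.
  rewrite e; split; by rewrite mulnC divnMDl // divn_small ?addn0.
split.
  move=> /andP[/eqP ne /hasP[t]]; rewrite mem_iota add0n => /= ts.
  case/orP => /andP[/eqP h1 /eqP h2]; split => //; [left|right]; exact: half ts h1 h2.
move=> [/eqP -> /=] [] /flah[t ts [h1 h2]]; apply/hasP; exists t; rewrite ?mem_iota //=.
  by rewrite h1 h2 !eqxx.
by rewrite h1 h2 !eqxx orbT.
Qed.

Lemma BA_typ_iso n n' (c : choices n) (c' : choices n') v v' : BA_typ c v = BA_typ c' v' ->
  rg_iso (nbhd_edge (BA_graph c) l (fun _ : 'I_1 => v)) (nbhd_root (BA_graph c) l (fun _ : 'I_1 => v))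
    (nbhd_edge (BA_graph c') l (fun _ : 'I_1 => v')) (nbhd_root (BA_graph c') l (fun _ : 'I_1 => v')).
Proof.
move=> [sE pE iE]; apply: index_iso => //.
  by move: sE; rewrite /BA_list !size_vals.
move=> x y x' y' xA yA x'A y'A xE yE.
have sub n0 (c0 : choices n0) (v0 z0 : 'I_n0) :
    z0 \in ball (BA_graph c0) l (fun _ : 'I_1 => v0) ->
    (index (val z0) (BA_list c0 v0) < size (BA_list c0 v0))%N /\
    nth 0%N (BA_list c0 v0) (index (val z0) (BA_list c0 v0)) = val z0.
  by rewrite -mem_vals => h; rewrite index_mem nth_index.
have [ix nx] := sub _ _ _ _ xA; have [iy ny] := sub _ _ _ _ yA.
have [ix' nx'] := sub _ _ _ _ x'A; have [iy' ny'] := sub _ _ _ _ y'A.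
have h := BA_edge_adj (size_codes c) (BA_list_node_lists c v) ix iy.
have h' := BA_edge_adj (size_codes c') (BA_list_node_lists c' v') ix' iy'.
rewrite !BA_graphE; apply/idP/idP.
  rewrite -nx -ny -nx' -ny' => /h[h1 h2]; apply/h'; split; first by rewrite -xE -yE.
  by rewrite -pE -xE -yE.
rewrite -nx -ny -nx' -ny' => /h'[h1 h2]; apply/h; split; first by rewrite [index _ _]xE [in X in _ <> X]yE.
by rewrite pE [index (val x) _]xE [index (val y) _]yE.
Qed.

(** In the pattern of a ball, [None] marks an edge leaving the ball, which a node at distance below
    [l] cannot have. *)
Lemma BA_interior n (c : choices n) (v x : 'I_n) i a j : within (BA_graph c) i v x -> (i < l)%N ->
  (a < size (BA_list c v))%N -> nth 0%N (BA_list c v) a = x -> (j < m)%N ->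
  exists e, [/\ pat (codes c) (BA_list c v) a j = Some e, None \notin e.1 & e.2 != None].
Proof.
move=> wx il ha ax jm; set phi := BA_list c v; set s := codes c.
have ss : size s = (m * n)%N by apply: size_codes.
have hs : (m * x + j < size s)%N by rewrite ss half_lt.
rewrite /pattern_of ha jm ax hs /=; eexists; split; first by [].
  apply/negP => /mapP[t]; rewrite mem_filter mem_iota add0n => /andP[/eqP e /= ts].
  have tn : (t %/ m < n)%N by rewrite ltn_divLR // mulnC -ss.
  have : (t %/ m)%N \in phi.
    rewrite (mem_BA_list c v (Ordinal tn)); apply: (within_leq il).
    case: (Ordinal tn =P x) => [->|ne]; first exact: withinS.
    apply: within_edge wx _; rewrite BA_graphE /BA_edge; apply/andP; split.
      by apply/eqP => h; apply: ne; apply: val_inj.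
    apply/hasP; exists t; first by rewrite mem_iota add0n -/s ts.
    apply/orP; right; apply/andP; split; first exact: eqxx.
    by rewrite -/s e mulnC divnMDl // divn_small // addn0 eqxx.
  by rewrite /slot_of => ->.
set h := (m * x + j)%N in hs *.
have hn : (nth 0 s h %/ m < n)%N.
  have hmn : (h < m * n)%N by rewrite -ss.
  by rewrite ltn_divLR // mulnC (nth_codes c (Ordinal hmn)).
have : (nth 0 s h %/ m)%N \in phi.
  rewrite (mem_BA_list c v (Ordinal hn)); apply: (within_leq il).
  case: (Ordinal hn =P x) => [->|ne]; first exact: withinS.
  apply: within_edge wx _; rewrite BA_graphE /BA_edge; apply/andP; split.
    by apply/eqP => e; apply: ne; apply: val_inj.
  apply/hasP; exists h; first by rewrite mem_iota add0n -/s hs.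
  apply/orP; left; apply/andP; split; last exact: eqxx.
  by rewrite /h mulnC divnMDl // divn_small // addn0 eqxx.
by rewrite /slot_of => ->.
Qed.

(** A ball is connected, so a single representative suffices and its pattern count is normalised by
    one power of [n]. *)
Lemma BA_hits n (c : choices n) v :
  hits (size (BA_list c v)) (pat (codes c) (BA_list c v)) [:: index (val v) (BA_list c v)].
Proof.
set phi := BA_list c v; set s := codes c => a ha.
have u : uniq phi by apply: vals_uniq.
exists (index (val v) phi); first by rewrite mem_head.
have [x xA xE] := valsP (mem_nth 0%N ha).
have K i (y : 'I_n) b : (i <= l)%N -> within (BA_graph c) i v y -> (b < size phi)%N ->
    nth 0%N phi b = y -> conn (pat s phi) (index (val v) phi) b.
  elim: i y b => [|i IH] y b il /=.
    by move=> /eqP <- hb <-; rewrite index_uniq //; apply: conn_refl.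
  case/orP => [h|/existsP[w /andP[h wy]]] hb by_; first exact: IH (ltnW il) h hb by_.
  have wp : val w \in phi by rewrite mem_BA_list; apply: within_leq h; apply: ltnW.
  have iw : (index (val w) phi < size phi)%N by rewrite index_mem.
  apply: conn_trans (IH w _ (ltnW il) h iw (nth_index _ wp)) _; apply: conn_adj.
  have [] := BA_edge_adj (size_codes c) (BA_list_node_lists c v) iw hb.
  by rewrite nth_index // by_ -BA_graphE => /(_ wy)[].
apply: (K l x) => //; move: xA; rewrite -mem_vals => xA.
by rewrite -mem_BA_list.
Qed.

(** The entries free of [None] certify that [phi] contains all neighbours of its inner nodes, so a
    list with the pattern of a ball is itself a ball. *)
Lemma BA_transfer n0 (c0 : choices n0) v0 n (c : choices n) phi (v : 'I_n) :
  phi \in node_lists n -> size phi = size (BA_list c0 v0) ->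
  pat (codes c) phi = pat (codes c0) (BA_list c0 v0) ->
  val v = nth 0%N phi (index (val v0) (BA_list c0 v0)) -> phi = BA_list c v.
Proof.
set phi0 := BA_list c0 v0 => hp sE pE vE; have [u pn] := node_listsP hp.
have u0 : uniq phi0 by apply: vals_uniq.
have v0p : val v0 \in phi0 by rewrite mem_BA_list within_refl.
have iv0 : (index (val v0) phi0 < size phi0)%N by rewrite index_mem.
have edgeE a b : (a < size phi)%N -> (b < size phi)%N ->
    BA_edge m (codes c) (nth 0%N phi a) (nth 0%N phi b) =
    BA_edge m (codes c0) (nth 0%N phi0 a) (nth 0%N phi0 b).
  move=> ha hb; have h := BA_edge_adj (size_codes c) hp ha hb.
  rewrite sE in ha hb; have h0 := BA_edge_adj (size_codes c0) (BA_list_node_lists c0 v0) ha hb.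
  by apply/idP/idP => [/h h1|/h0 h1]; [apply/h0; rewrite -pE|apply/h; rewrite pE].
have ord0 a : (a < size phi0)%N -> exists2 x : 'I_n0, within (BA_graph c0) l v0 x & nth 0%N phi0 a = x.
  move=> ha; have [x xA xE] := valsP (mem_nth 0%N ha); exists x; last by rewrite xE.
  by rewrite -mem_BA_list mem_vals.
(* By induction on the radius, the balls around [v] and [v0] occupy the same positions of [phi] and
   [phi0]; [BA_interior] keeps each next neighbour inside [phi]. *)
have K i : (i <= l)%N -> forall y : 'I_n, within (BA_graph c) i v y <->
    exists a (x : 'I_n0), [/\ (a < size phi0)%N, nth 0%N phi a = y, nth 0%N phi0 a = x &
       within (BA_graph c0) i v0 x].
  elim: i => [|i IH] il y.
    split=> [/eqP <-|[a [x [ha ay ax /eqP vx]]]].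
      by exists (index (val v0) phi0), v0; rewrite -vE nth_index //= eqxx.
    rewrite /= -val_eqE /= -ay vE; apply/eqP; congr nth.
    by rewrite (_ : val v0 = nth 0%N phi0 a) ?index_uniq // vx ax.
  split.
    case/orP => [/(IH (ltnW il))[a [x [ha ay ax h]]]|/existsP[w /andP[/(IH (ltnW il))]]].
      by exists a, x; split => //; apply: withinS.
    move=> [b [z [hb bw bz h]]] wy.
    have yp : val y \in phi.
      move: wy; rewrite BA_graphE => /andP[_ /hasP[t]].
      rewrite mem_iota add0n size_codes => /= ts.
      have fin j (jm : (j < m)%N) := BA_interior h il hb bz jm.
      case/orP => /andP[/eqP e1 /eqP e2].
        have [e [pe _ eN]] := fin (t %% m)%N (ltn_pmod _ m0).
        move: pe; rewrite -/phi0 -pE /pattern_of sE hb ltn_pmod //= bw -e1 [(m * _)%N]mulnC -divn_eq.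
        rewrite size_codes ts => -[eE]; move: eN; rewrite -eE /= /slot_of e2.
        by case: ifP.
      have [e [pe eN _]] := fin (nth 0 (codes c) t %% m)%N (ltn_pmod _ m0).
      move: pe; rewrite -/phi0 -pE /pattern_of sE hb ltn_pmod //= bw -e2 [(m * _)%N]mulnC -divn_eq.
      case: ifP => // _ [eE]; move: eN; rewrite -eE /=.
      case: (boolP (val y \in phi)) => // yn /negP[]; apply/mapP; exists t.
        by rewrite mem_filter mem_iota add0n size_codes ts eqxx.
      by rewrite /slot_of e1 (negbTE yn).
    have iy : (index (val y) phi < size phi)%N by rewrite index_mem.
    have iy0 : (index (val y) phi < size phi0)%N by rewrite -sE.
    have [x _ xE] := ord0 _ iy0.
    exists (index (val y) phi), x; split => //; first by rewrite nth_index.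
    apply: within_edge h _; rewrite BA_graphE -bz -xE -edgeE ?sE //.
    by rewrite bw nth_index // -BA_graphE.
  move=> [a [x [ha ay ax /= /orP[h|/existsP[z /andP[h zx]]]]]].
    by apply/orP; left; apply/(IH (ltnW il)); exists a, x.
  have zp : val z \in phi0 by rewrite mem_BA_list; apply: within_leq h; apply: ltnW.
  have iz : (index (val z) phi0 < size phi0)%N by rewrite index_mem.
  have bn : (nth 0%N phi (index (val z) phi0) < n)%N by apply/pn/mem_nth; rewrite sE.
  apply: (within_edge (w := Ordinal bn)).
    by apply/(IH (ltnW il)); exists (index (val z) phi0), z; rewrite nth_index.
  rewrite BA_graphE /= -ay edgeE ?sE // nth_index // ax -BA_graphE //.
apply: (irr_sorted_eq ltn_trans ltnn).
- by move: hp; rewrite mem_node_lists => /andP[].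
- by have := BA_list_node_lists c v; rewrite mem_node_lists => /andP[].
move=> y; apply/idP/idP => [yp|].
  have yn := pn _ yp; rewrite (mem_BA_list c v (Ordinal yn)); apply/(K l (leqnn l)).
  have iy : (index y phi < size phi0)%N by rewrite -sE index_mem.
  have [x xw xE] := ord0 _ iy.
  by exists (index y phi), x; rewrite nth_index.
move=> yl; have [_ yn] := node_listsP (BA_list_node_lists c v).
have := yl; rewrite (mem_BA_list c v (Ordinal (yn _ yl))) => /(K l (leqnn l))[a [x [ha /= <- _ _]]].
by rewrite mem_nth // sE.
Qed.

(** The position of the root recovers [v] from its list, and [BA_transfer] shows that every list
    with this pattern comes from such a [v]. *)
Lemma BA_count n0 (c0 : choices n0) v0 n (c : choices n) :
  #|[set v : 'I_n | `[< BA_typ c v = BA_typ c0 v0 >]]|%:R =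
  pat_count R m n (size (BA_list c0 v0)) (pat (codes c0) (BA_list c0 v0)) (codes c).
Proof.
set phi0 := BA_list c0 v0; set P0 := pat _ _.
have i0 : (index (val v0) phi0 < size phi0)%N by rewrite index_mem mem_BA_list within_refl.
rewrite /pat_count -natr_sum -big_mkcondr /= sum1_count -size_filter; congr (_%:R).
rewrite cardE -(size_map (BA_list c)); apply: perm_size; apply: uniq_perm.
- rewrite map_inj_in_uniq ?enum_uniq // => x y.
  rewrite !mem_enum !inE => -[_ _ ex] [_ _ ey] e; apply: val_inj.
  have mem z : val z \in BA_list c z by rewrite mem_BA_list within_refl.
  by rewrite -(nth_index 0%N (mem x)) -(nth_index 0%N (mem y)) ex ey e.
- by apply/filter_uniq/node_lists_uniq.
move=> phi; rewrite mem_filter; apply/mapP/andP => [[v]|[/andP[/eqP sE /eqP pE] hp]].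
  rewrite mem_enum inE => /asboolP h ->; rewrite BA_list_node_lists; split; last by [].
  by case: h => sE pE _; rewrite sE pE !eqxx.
have [u pn] := node_listsP hp.
have vn : (nth 0%N phi (index (val v0) phi0) < n)%N by apply/pn/mem_nth; rewrite sE.
have pl : phi = BA_list c (Ordinal vn) by apply: (BA_transfer hp sE pE).
exists (Ordinal vn) => //; rewrite mem_enum inE; apply/asboolP; rewrite /BA_typ -pl sE pE /=.
by rewrite index_uniq // sE.
Qed.

End BATypes.

(** * Tightness and convergence of the attachment types *)

Section BAConclusion.
Variables (R : realType) (m : nat).
Hypothesis m0 : (0 < m)%N.
Local Notation choices n := {ffun 'I_(m * n) -> 'I_(m * n)}.

Lemma bounded_seqs (T : eqType) (L : seq T) D :
  exists L' : seq (seq T), forall s, (size s <= D)%N -> {subset s <= L} -> s \in L'.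
Proof.
elim: D => [|D [L' hL']].
  by exists [:: [::]] => s; rewrite leqn0 size_eq0 => /eqP ->.
exists ([::] :: [seq x :: s | x <- L, s <- L']) => -[|x s] //= sD sub.
rewrite inE /=; apply/allpairsP; exists (x, s); split => //=; first by apply: sub; rewrite mem_head.
by apply: hL' => // y ys; apply: sub; rewrite inE ys orbT.
Qed.

Lemma BA_typ_fin l D : exists L : seq (nat * pattern * nat),
  forall n (c : choices n) v, tame (BA_graph c) (BA_dg c) D l v -> BA_typ l c v \in L.
Proof.
pose K := (D.+1 ^ l.+1)%N.
have [L2 h2] := bounded_seqs (None :: all_slots m K) D.
pose L3 := None :: [seq Some (i, o) | i <- L2, o <- None :: all_slots m K].
have [L4 h4] := bounded_seqs L3 m.
have [L5 h5] := bounded_seqs L4 K.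
(* Outside the table the default of [nth] is [None], which is also the value of a pattern there. *)
pose dec (T : seq (seq (option (seq place * place)))) : pattern :=
  fun a b => nth None (nth [::] T a) b.
have [I hI] : exists I : seq nat, forall a, (a <= K)%N -> a \in I.
  by exists (iota 0 K.+1) => a; rewrite mem_iota add0n ltnS.
exists [seq (p.1, dec p.2, r) | p <- [seq (a, T) | a <- I, T <- L5], r <- I].
move=> n c v t.
have sK : (size (BA_list l c v) <= K)%N.
  rewrite size_vals; apply: leq_trans (card_tame_ball (BA_dgP m0 c) t).
  apply: subset_leq_card; apply/fintype.subsetP => x.
  by rewrite -mem_vals (mem_BA_list l c v x) inE => h; apply: withinS.
set phi := BA_list l c v; pose P := pattern_of m (codes c) phi.
have u : uniq phi by apply: vals_uniq.
pose T := mkseq (fun a => mkseq (P a) m) (size phi).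
have PT : P = dec T.
  apply/funext => a; apply/funext => b; rewrite /dec.
  case: (ltnP a (size phi)) => ha; last first.
    by rewrite (nth_default [::]) ?size_mkseq // nth_nil /P /pattern_of ltnNge ha.
  rewrite nth_mkseq //; case: (ltnP b m) => hb; first by rewrite nth_mkseq.
  by rewrite nth_default ?size_mkseq // /P /pattern_of ha (ltnNge b) hb.
have locK h : slot_of m phi h \in None :: all_slots m K.
  have := mem_loc m0 phi h; rewrite !inE => /orP[->//|].
  case: (slot_of m phi h) => [[a b]|//]; rewrite !mem_slots => /andP[ha ->].
  by rewrite (leq_trans ha sK) orbT.
apply/allpairsP; exists ((size phi, T), index (val v) phi); split => /=.
- apply/allpairsP; exists (size phi, T); split => //=.
    exact: hI.
  apply: h5; first by rewrite size_mkseq.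
  move=> r /mapP[a]; rewrite mem_iota add0n => /= ha ->.
  apply: h4; first by rewrite size_mkseq.
  move=> e /mapP[b]; rewrite mem_iota add0n => /= hb ->.
  rewrite /P /pattern_of; case: ifP => [_|_]; last by rewrite mem_head.
  set h0 := (m * _ + b)%N; set ins := [seq _ | _ <- _ & _].
  rewrite inE; apply/orP; right; apply/allpairsP.
  exists (ins, slot_of m phi (nth 0%N (codes c) h0)); split => /=; [|exact: locK|by []].
  apply: h2; last by move=> _ /mapP[h _ ->]; apply: locK.
  have [x xA xE] := valsP (mem_nth 0%N ha).
  have h0E : h0 = (m * x + b)%N by rewrite /h0 -xE.
  have wx : within (BA_graph c) l v x by rewrite -mem_BA_list mem_vals.
  move/tameP: t => /(_ x wx); apply: leq_trans.
  rewrite /BA_dg (bigD1 (Ordinal hb)) //= -h0E /ins size_map size_filter.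
  apply: leq_trans (leq_addr _ _); rewrite /hdeg.
  apply: leq_trans (leq_addl _ _); rewrite -[in leqRHS](mkseq_nth 0%N (codes c)) /mkseq count_map.
  by apply: sub_count.
- by apply/hI/ltnW; rewrite (leq_trans _ sK) // index_mem mem_BA_list within_refl.
- by rewrite -PT.
Qed.

Local Notation mu := (fun n (c : choices n) => BA_weight R c).

Lemma BA_typ_conv l t : exists q,
  conv_prob mu (fun n (c : choices n) => freq R (fun v => BA_typ l c v = t)) q.
Proof.
have mu0 n (c : choices n) : 0 <= BA_weight R c by apply: BA_weight_ge0.
have mu1 n : \sum_(c : choices n) BA_weight R c = 1 by apply: BA_prob_sum.
case: (pselect (exists n (c : choices n) v, BA_typ l c v = t)) => [|nreal]; last first.
  exists 0; apply: (conv_prob_cst mu1) => n c.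
  rewrite freqE big1 ?mul0r // => v _; rewrite asboolF // => h.
  by apply: nreal; exists n, c, v.
move=> [n0 [c0 [v0 <-]]].
have [q hq] := cnt_conv R m0 (@BA_hits m m0 l n0 c0 v0).
exists q => eps th e0 t0.
pose X := pat_count R m; pose sz := size (BA_list l c0 v0).
pose P := pattern_of m (codes c0) (BA_list l c0 v0).
rewrite -/X -/P -/sz /L1to /= in hq.
have e4 : 0 < eps / 4 by lra.
have et : 0 < eps / 4 * th by rewrite mulr_gt0.
have [N hN] := cvg_ex hq et.
have l1 : likely mu th (fun n (c : choices n) => `|X n sz P (codes c) / n.+1%:R - q| <= eps / 4).
  apply: (likely_markov mu0 mu1 (N := N)) => // n /hN.
  rewrite subr0 ger0_norm; last by apply: EN_ge0.
  by move=> h; apply: le_trans _ h; rewrite -BA_expectation; exact: lexx.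
(* Passing from the normalisation by [n.+1] to that by [n] costs [|q| / n]. *)
pose N1 := Num.bound (`|q| / (eps / 2)).
apply: (likely_mono mu0 (N := N1.+1) _ l1) => n c nN.
rewrite /freq (BA_count R m0) -/X -/P -/sz.
have n0' : 0 < n%:R :> R by rewrite ltr0n; apply: leq_trans nN.
have n1 : 1 <= n%:R :> R by rewrite ler1n; apply: leq_trans nN.
have hq2 : `|q| <= n%:R * (eps / 2).
  rewrite -ler_pdivrMr; last by lra.
  apply: le_trans (ltW (archi_boundP _)) _; first by rewrite divr_ge0 // ltW //; lra.
  by rewrite ler_nat; apply: ltnW.
set x := X _ _ _ _ => h.
have -> : x / n%:R - q = ((x / n.+1%:R - q) * n.+1%:R + q) / n%:R.
  rewrite mulrBl divfK // -[n.+1]addn1 natrD mulrDr mulr1 opprD -addrA addrNK mulrBl.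
  by rewrite mulfK // gt_eqF.
rewrite normrM [`|_^-1|]ger0_norm ?invr_ge0 ?(ltW n0') // ler_pdivrMr //.
apply: le_trans (ler_normD _ _) _; rewrite normrM [`|n.+1%:R|]ger0_norm //.
have h2 : `|x / n.+1%:R - q| * n.+1%:R <= eps / 4 * n.+1%:R by apply: ler_wpM2r.
apply: le_trans (lerD h2 hq2) _; rewrite -[n.+1]addn1 natrD; nra.
Qed.

Theorem BA_local_limit_extension (k : nat) (T : crg k) (l : nat) :
  exists q : set (crg k.+1) -> R,
    (forall T' : crg k.+1, extends T T' ->
       0 <= q (iso_class T') <= 1 /\
       forall eps theta : R, 0 < eps -> 0 < theta ->
         likely mu theta (fun n (c : choices n) => forall u : 'I_k -> 'I_n,
           nbhd_iso (BA_graph c) l u T ->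
               `| (#|[set v : 'I_n | `[< nbhd_iso (BA_graph c) l (ext_roots u v) T' >]]|%:R / n%:R)
                  - q (iso_class T') | < eps))
    /\ (\esum_(C in Ext T) (q C)%:E = 1)%E.
Proof.
apply: (@local_limit_extension R (fun n => choices n) mu _ _
  (fun n (c : choices n) => BA_graph c) (fun n (c : choices n) => BA_dg c) _ _
  (fun d => grow R (d %/ m)) (m%:R * (4 * lyap R 2 * m%:R)) _ _ _ _ l _
  (fun n (c : choices n) v => BA_typ l c v)).
- by move=> n c; apply: BA_weight_ge0.
- by move=> n; apply: BA_prob_sum.
- by move=> n c; apply: BA_simple.
- by move=> n c x; apply: BA_dgP.
- by move=> d; apply/ltW/grow_gt0.
- by move=> d d' h; apply/grow_mono/leq_div2r.
- move=> A; have [D hD] := grow_unbounded A; exists (D * m)%N.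
  by rewrite mulnK.
- by move=> n; apply: BA_degree_moment.
- by move=> n n' c c' v v'; apply: BA_typ_iso.
- exact: BA_typ_conv.
- exact: BA_typ_fin.
Qed.

End BAConclusion.

(** * The sparse Erdos-Renyi graph *)

Section ERModel.
Variable R : realType.
Implicit Types (n : nat) (p : R).

Local Notation sample n := {ffun 'I_n * 'I_n -> bool}.

Definition pair_weight p n (e : 'I_n * 'I_n) (b : bool) : R :=
  if (e.1 < e.2)%N then (if b then p else 1 - p) else (~~ b)%:R.

(* Only the coordinates [e.1 < e.2] are random; the others are deterministically [false]. *)
Definition er_mu p n (f : sample n) : R := \prod_e pair_weight p e (f e).

Definition er_graph n (f : sample n) : graph n :=
  [set e : 'I_n * 'I_n | ((e.1 < e.2)%N && f e) || ((e.2 < e.1)%N && f (e.2, e.1))].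

Definition er_code n (G : graph n) : sample n := [ffun e : 'I_n * 'I_n => (e.1 < e.2)%N && (e \in G)].

Lemma er_graph_simple n (f : sample n) : simple_graph (er_graph f).
Proof.
by split=> [x y|x]; rewrite !inE /= ?ltnn // orbC.
Qed.

Lemma er_graph_lt n (f : sample n) (x y : 'I_n) : (x < y)%N -> ((x, y) \in er_graph f) = f (x, y).
Proof. by move=> xy; rewrite inE /= xy (ltnNge y) (ltnW xy) /= orbF. Qed.

Lemma er_expectation p n (h : 'I_n * 'I_n -> bool -> R) :
  \sum_(f : sample n) er_mu p f * \prod_e h e (f e) =
  \prod_e \sum_(b : bool) pair_weight p e b * h e b.
Proof.
rewrite bigA_distr_bigA /=; apply: eq_bigr => f _.
by rewrite -big_split.
Qed.

Lemma sum_pair_weight p n (e : 'I_n * 'I_n) : \sum_(b : bool) pair_weight p e b = 1.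
Proof.
rewrite big_bool /pair_weight /=; case: ifP => _; last by rewrite add0r.
by rewrite addrC subrK.
Qed.

Lemma er_mu_sum p n : \sum_(f : sample n) er_mu p f = 1.
Proof.
have := @er_expectation p n (fun _ _ => 1).
rewrite (eq_bigr (fun f => er_mu p f)) => [->|f _]; last by rewrite big1 ?mulr1.
by apply: big1 => e _; under eq_bigr do rewrite mulr1; rewrite sum_pair_weight.
Qed.

Lemma er_mu_ge0 p n (f : sample n) : 0 <= p <= 1 -> 0 <= er_mu p f.
Proof.
move=> /andP[p0 p1]; apply: prodr_ge0 => e _; rewrite /pair_weight.
by case: ifP => // _; case: ifP => // _; rewrite subr_ge0.
Qed.

(** A sample of nonzero weight is false outside the pairs with [e.1 < e.2], hence is recovered from
    its graph; the graphs that are not simple have weight 0. *)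
Lemma er_transfer p n (A : graph n -> Prop) :
  \sum_(G : graph n | `[< A G >]) ER_weight p G =
  \sum_(f : sample n | `[< A (er_graph f) >]) er_mu p f.
Proof.
have codeK (f : sample n) : er_mu p f != 0 -> er_code (er_graph f) = f.
  move=> /prodf_neq0 h; apply/ffunP => e; rewrite ffunE inE.
  have := h e isT; rewrite /pair_weight; case: ltngtP => //= _; rewrite ?orbF //.
    by case: (f e) => //=; rewrite eqxx.
  by case: (f e) => //=; rewrite eqxx.
rewrite [RHS](bigID (fun f => er_code (er_graph f) == f)) /= [X in _ = _ + X]big1 ?addr0; last first.
  by move=> f /andP[_]; apply: contraNeq => /codeK ->.
rewrite (reindex_onto (@er_code n) (@er_graph n)) /=; last by move=> f /andP[_ /eqP].
pose simple (G : graph n) :=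
  [forall x, forall y, ((x, y) \in G) == ((y, x) \in G)] && [forall x, (x, x) \notin G].
have graphK (G : graph n) : (er_graph (er_code G) == G) = simple G.
  apply/eqP/andP => [<-|[/forallP s /forallP i]].
    split; apply/forallP => x; last by case: (er_graph_simple (er_code G)).
    apply/forallP => y; apply/eqP; apply/idP/idP; exact: (er_graph_simple (er_code G)).1.
  apply/setP => -[x y]; rewrite inE !ffunE /=.
  case: (ltngtP x y) => //= [_|xy|xy]; first by rewrite orbF.
    by have /forallP/(_ x)/eqP := s y.
  by rewrite (val_inj xy) (negbTE (i y)).
rewrite [LHS](bigID simple) /= [X in _ + X]big1 ?addr0; last first.
  by move=> G /andP[_ ns]; rewrite /ER_weight ifN.
apply: eq_big => [G|G /andP[_ sG]].
  rewrite graphK; case sG : (simple G); rewrite ?andbF // !andbT.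
  by move: sG; rewrite -graphK => /eqP ->; rewrite eqxx andbT.
rewrite /ER_weight ifT // /er_mu pair_big_dep /=.
rewrite [RHS](bigID (fun e : 'I_n * 'I_n => (e.1 < e.2)%N)) /= [X in _ = _ * X]big1 ?mulr1.
  by apply: eq_bigr => e h; rewrite /pair_weight h ffunE h -surjective_pairing.
by move=> e /negbTE h; rewrite /pair_weight h ffunE h.
Qed.

Definition er_dg n (f : sample n) (x : 'I_n) : nat := #|[set y | (x, y) \in er_graph f]|.

Definition sort_pair n (e : 'I_n * 'I_n) := if (e.1 < e.2)%N then e else (e.2, e.1).

Lemma er_edge n (f : sample n) x y :
  ((x, y) \in er_graph f) = (x != y) && f (sort_pair (x, y)).
Proof.
rewrite inE /sort_pair /= -(inj_eq val_inj) /=.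
by case: (ltngtP x y) => //=; rewrite ?orbF.
Qed.

Lemma er_edges_prob p n (S : {set 'I_n * 'I_n}) : (forall e, e \in S -> (e.1 < e.2)%N) ->
  \sum_(f : sample n) er_mu p f * [forall e in S, f e]%:R = p ^+ #|S|.
Proof.
move=> hS; transitivity (\sum_(f : sample n) er_mu p f *
    \prod_e (fun e (b : bool) => ((e \in S) ==> b)%:R : R) e (f e)).
  apply: eq_bigr => f _; congr (_ * _); case: (boolP [forall e in S, f e]) => [/forallP h|].
    by rewrite big1 // => e _; rewrite h.
  rewrite negb_forall => /existsP[e he]; rewrite (bigD1 e) //= (negbTE he) mul0r //.
rewrite (er_expectation p (fun e b => ((e \in S) ==> b)%:R)) -prodr_const [RHS]big_mkcond.
apply: eq_bigr => e _.
case: (boolP (e \in S)) => he; last first.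
  by under eq_bigr do rewrite mulr1; rewrite sum_pair_weight.
by rewrite big_bool /pair_weight hS //= mulr1 mulr0 addr0.
Qed.

Lemma er_edge2_prob p n (v x y : 'I_n) : 0 <= p <= 1 ->
  \sum_(f : sample n) er_mu p f * (((v, x) \in er_graph f) && ((v, y) \in er_graph f))%:R <=
  if x == y then p else p ^+ 2.
Proof.
move=> p01; have /andP[p0 p1] := p01.
have triv (b : R) : 0 <= b -> \sum_(f : sample n) er_mu p f * 0 <= b.
  by move=> h; under eq_bigr do rewrite mulr0; rewrite big1_eq.
have sp z : v != z -> ((sort_pair (v, z)).1 < (sort_pair (v, z)).2)%N.
  rewrite /sort_pair /=; case: ifP => //= h vz.
  by rewrite ltn_neqAle leqNgt h andbT; apply: contra vz => /eqP /val_inj ->.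
have b0 : 0 <= if x == y then p else p ^+ 2 by case: ifP => _ //; apply: exprn_ge0.
case: (v =P x) => [->|/eqP vx].
  rewrite (eq_bigr (fun f => er_mu p f * 0)); first exact: triv.
  by move=> f _; rewrite er_edge eqxx.
case: (v =P y) => [->|/eqP vy].
  rewrite (eq_bigr (fun f => er_mu p f * 0)); first exact: triv.
  by move=> f _; rewrite [X in _ && X]er_edge eqxx andbF.
pose S := [set sort_pair (v, x); sort_pair (v, y)].
have hS e : e \in S -> (e.1 < e.2)%N by rewrite !inE => /orP[] /eqP ->; apply: sp.
have cS : #|S| = (x != y).+1.
  rewrite cards2; congr (nat_of_bool (~~ _)).+1; apply/eqP/eqP => [|-> //].
  rewrite /sort_pair; case: ifP => _; case: ifP => _ [] //= h1 h2.
  - by move: vy; rewrite h1 eqxx.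
  - by move: vx; rewrite h1 eqxx.
rewrite (_ : (if x == y then p else p ^+ 2) = p ^+ #|S|); last by rewrite cS; case: (x == y).
rewrite -er_edges_prob //; apply: ler_sum => f _; apply: ler_wpM2l; first exact: er_mu_ge0.
rewrite !er_edge vx vy ler_nat; case: (boolP (f _ && f _)) => //= /andP[h1 h2].
rewrite lt0b; apply/forallP => e; apply/implyP; rewrite !inE => /orP[] /eqP -> //.
Qed.

(** The square of a degree counts pairs of edges: equal ones give [n * p <= K] per node, distinct
    ones at most [(n * p) ^+ 2]. This is the moment bound with [g d = d]. *)
Lemma er_degree_moment p n (K : R) : 0 <= p <= 1 -> p * n%:R <= K -> 0 <= K ->
  \sum_(f : sample n) er_mu p f * (\sum_v (er_dg f v)%:R * (er_dg f v)%:R) <= (K + K ^+ 2) * n%:R.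
Proof.
move=> p01 pK K0; have /andP[p0 p1] := p01.
have dgE (f : sample n) v : (er_dg f v)%:R = \sum_x ((v, x) \in er_graph f)%:R :> R.
  rewrite /er_dg -sum1_card natr_sum big_mkcond /=; apply: eq_bigr => x _.
  by rewrite inE; case: ifP.
have -> : \sum_(f : sample n) er_mu p f * (\sum_v (er_dg f v)%:R * (er_dg f v)%:R) =
  \sum_v \sum_x \sum_y \sum_(f : sample n)
    er_mu p f * (((v, x) \in er_graph f) && ((v, y) \in er_graph f))%:R.
  under eq_bigr do rewrite mulr_sumr.
  rewrite exchange_big /=; apply: eq_bigr => v _.
  under eq_bigr do rewrite !dgE mulr_suml mulr_sumr.
  rewrite exchange_big /=; apply: eq_bigr => x _.
  under eq_bigr do rewrite mulr_sumr mulr_sumr.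
  rewrite exchange_big /=; apply: eq_bigr => y _; apply: eq_bigr => f _.
  by rewrite -natrM mulnb.
have bx (x : 'I_n) : \sum_(y < n) (if x == y then p else p ^+ 2) <= p + n%:R * p ^+ 2.
  rewrite (bigD1 x) //= eqxx lerD2l.
  apply: (@le_trans _ _ (\sum_(y < n) p ^+ 2)); last by rewrite sumr_const card_ord mulr_natl.
  rewrite big_mkcond; apply: ler_sum => y _; case: ifP; last by rewrite sqr_ge0.
  by rewrite eq_sym => /negbTE ->.
apply: (@le_trans _ _ (\sum_(v < n) \sum_(x < n) (p + n%:R * p ^+ 2))).
  apply: ler_sum => v _; apply: ler_sum => x _; apply: le_trans (bx x).
  by apply: ler_sum => y _; apply: er_edge2_prob.
rewrite !sumr_const !card_ord -[X in X <= _]mulr_natr -[X in X * _ <= _]mulr_natr.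
apply: ler_wpM2r => //.
have h : (p * n%:R) ^+ 2 <= K ^+ 2 by rewrite ler_pXn2r ?nnegrE // mulr_ge0.
move: h pK; move: (n%:R) => x; nra.
Qed.

End ERModel.

(** * Types of nodes and placements in the Erdos-Renyi graph *)

Section ERTypes.
Variable R : realType.
Variable l : nat.
Local Notation sample n := {ffun 'I_n * 'I_n -> bool}.

Definition nedge n (G : graph n) (x y : nat) : bool :=
  [exists e : 'I_n * 'I_n, [&& e \in G, val e.1 == x & val e.2 == y]].

Lemma nedgeE n (G : graph n) (x y : 'I_n) : nedge G (val x) (val y) = ((x, y) \in G).
Proof.
apply/existsP/idP => [[[a b] /and3P[h /eqP/val_inj h1 /eqP/val_inj h2]]|h].
  by rewrite -h1 -h2.
by exists (x, y); rewrite h !eqxx.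
Qed.

Definition er_ball_list n (f : sample n) (v : 'I_n) : seq nat :=
  vals (ball (er_graph f) l (fun _ : 'I_1 => v)).

Definition er_adj n (f : sample n) (phi : seq nat) : nat -> nat -> bool := fun a b =>
  [&& a < size phi, b < size phi & nedge (er_graph f) (nth 0 phi a) (nth 0 phi b)]%N.

(* The positions in the ball all of whose neighbours are again in the ball. *)
Definition er_ball_inner n (f : sample n) (v : 'I_n) (phi : seq nat) : nat -> bool := fun a =>
  [&& (a < size phi)%N, (0 < l)%N &
   [exists u : 'I_n, (val u == nth 0%N phi a) && within (er_graph f) l.-1 v u]].

Definition er_ball_type n (f : sample n) (v : 'I_n) :
    nat * (nat -> nat -> bool) * (nat -> bool) * nat :=
  let phi := er_ball_list f v in
  (size phi, er_adj f phi, er_ball_inner f v phi, index (val v) phi).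

Lemma mem_er_list n (f : sample n) (v x : 'I_n) :
  (val x \in er_ball_list f v) = within (er_graph f) l v x.
Proof.
rewrite mem_vals inE; apply/existsP/idP => [[i] //|h]; by exists ord0.
Qed.

Lemma er_typ_iso n n' (f : sample n) (f' : sample n') v v' : er_ball_type f v = er_ball_type f' v' ->
  rg_iso (nbhd_edge (er_graph f) l (fun _ : 'I_1 => v)) (nbhd_root (er_graph f) l (fun _ : 'I_1 => v))
    (nbhd_edge (er_graph f') l (fun _ : 'I_1 => v')) (nbhd_root (er_graph f') l (fun _ : 'I_1 => v')).
Proof.
move=> [sE aE _ iE]; apply: index_iso => //; first by move: sE; rewrite /er_ball_list !size_vals.
move=> x y x' y' xA yA x'A y'A xE yE.
have K k (g : sample k) (u z w : 'I_k) : z \in ball (er_graph g) l (fun _ : 'I_1 => u) ->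
    w \in ball (er_graph g) l (fun _ : 'I_1 => u) -> ((z, w) \in er_graph g) =
    er_adj g (er_ball_list g u) (index (val z) (er_ball_list g u)) (index (val w) (er_ball_list g u)).
  by rewrite -!mem_vals => hz hw; rewrite /er_adj !index_mem hz hw /= !nth_index // nedgeE.
by rewrite (K _ f v x y) // (K _ f' v' x' y') // aE [index (val x) _]xE [index (val y) _]yE.
Qed.

Section Placement.
Variables (sz : nat) (M : nat -> nat -> bool) (I : nat -> bool).

(* The condition on the pair [e] for [A] to carry the adjacency matrix [M] and to have no edge
   leaving its positions in [I]. *)
Definition place_ok n (A : {set 'I_n}) (e : 'I_n * 'I_n) (b : bool) : bool :=
  let idx x := index (val x) (vals A) in
  if (e.1 \in A) && (e.2 \in A) then b == M (idx e.1) (idx e.2)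
  else if ((e.1 \in A) && I (idx e.1)) || ((e.2 \in A) && I (idx e.2)) then ~~ b else true.

Definition placed n (f : sample n) (A : {set 'I_n}) : bool :=
  [forall e : 'I_n * 'I_n, (e.1 < e.2)%N ==> place_ok A e (f e)].

Lemma enum_fun n (A : {set 'I_n}) : #|A| = sz -> exists nu : 'I_sz -> 'I_n,
  [/\ forall a, val (nu a) = nth 0%N (vals A) a, forall a, nu a \in A, injective nu,
      forall a b, (nu a < nu b)%N = (a < b)%N & forall x, x \in A -> exists a, nu a = x].
Proof.
move=> cA; have sA : size (vals A) = sz by rewrite size_vals.
have ex (a : 'I_sz) : exists x : 'I_n, x \in A /\ val x = nth 0%N (vals A) a.
  have ha : (a < size (vals A))%N by rewrite sA.
  by have [x xA xE] := valsP (mem_nth 0%N ha); exists x.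
have [nu nuE] := choice ex.
have inj : injective nu.
  move=> a b e; apply: val_inj; apply/eqP.
  rewrite -(nth_uniq 0%N _ _ (vals_uniq A)) ?sA ?ltn_ord //.
  by rewrite -(nuE a).2 -(nuE b).2 e.
have /andP[srt _] := vals_sorted A.
have mono (a b : 'I_sz) : (a < b)%N -> (nu a < nu b)%N.
  move=> ab; rewrite -[X in (X < _)%N]/(val (nu a)) -[X in (_ < X)%N]/(val (nu b)) (nuE a).2 (nuE b).2.
  by apply: (sorted_ltn_nth ltn_trans) => //; rewrite inE sA.
exists nu; split => //.
- by move=> a; case: (nuE a).
- by move=> a; case: (nuE a).
- move=> a b; case: (ltngtP a b) => [/mono //|/mono h|/val_inj ->]; last by rewrite ltnn.
  by rewrite ltnNge ltnW.
move=> x; rewrite -mem_vals => xA; have ix : (index (val x) (vals A) < sz)%N by rewrite -sA index_mem.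
by exists (Ordinal ix); apply: val_inj; rewrite (nuE _).2 /= nth_index.
Qed.

Definition inside_prob (p : R) : R :=
  \prod_(ab : 'I_sz * 'I_sz | (ab.1 < ab.2)%N) (if M ab.1 ab.2 then p else 1 - p).

Definition ninner := #|[set a : 'I_sz | I a]|.

Definition place_prob p n : R := inside_prob p * (1 - p) ^+ (ninner * (n - sz)).

Definition place_factor p n (A : {set 'I_n}) (e : 'I_n * 'I_n) : R :=
  \sum_(b : bool) pair_weight p e b * ((e.1 < e.2)%N ==> place_ok A e b)%:R.

Lemma placedE n (f : sample n) (A : {set 'I_n}) :
  (placed f A)%:R = \prod_e (fun (e : 'I_n * 'I_n) (b : bool) =>
     ((e.1 < e.2)%N ==> place_ok A e b)%:R) e (f e) :> R.
Proof.
case: (boolP (placed f A)) => [/forallP h|].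
  by rewrite big1 // => e _; rewrite h.
rewrite negb_forall => /existsP[e he]; rewrite (bigD1 e) //= (negbTE he) mul0r //.
Qed.

Lemma place_factor_ge p n (A : {set 'I_n}) (e : 'I_n * 'I_n) : ~~ (e.1 < e.2)%N -> place_factor p A e = 1.
Proof.
move=> h; rewrite -[RHS](sum_pair_weight p e); apply: eq_bigr => b _.
by rewrite (negbTE h) mulr1.
Qed.

Lemma place_factor_lt p n (A : {set 'I_n}) (e : 'I_n * 'I_n) : (e.1 < e.2)%N ->
  place_factor p A e = p * (place_ok A e true)%:R + (1 - p) * (place_ok A e false)%:R.
Proof. by move=> h; rewrite /place_factor big_bool /pair_weight h. Qed.

(** The pairs not inside [A] on which a placement forbids an edge. *)
Definition touching n (A : {set 'I_n}) : {set 'I_n * 'I_n} :=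
  [set e : 'I_n * 'I_n | [&& (e.1 < e.2)%N, ~~ ((e.1 \in A) && (e.2 \in A)) &
     ((e.1 \in A) && I (index (val e.1) (vals A))) || ((e.2 \in A) && I (index (val e.2) (vals A)))]].

Lemma card_touching n (A : {set 'I_n}) : #|A| = sz -> #|touching A| = (ninner * (n - sz))%N.
Proof.
move=> cA; have [nu [nuE nuA nui _ nus]] := enum_fun cA.
pose B := [set x in A | I (index (val x) (vals A))].
have sz_vals : size (vals A) = sz by rewrite size_vals.
have idx a : index (val (nu a)) (vals A) = a by rewrite nuE index_uniq ?vals_uniq ?sz_vals.
have cB : #|B| = ninner.
  rewrite /ninner -(card_imset _ nui); apply: eq_card => x; rewrite !inE.
  apply/andP/imsetP => [[/nus[a <-]]|[a]]; first by rewrite idx; exists a; rewrite ?inE.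
  by rewrite inE => Ia ->; rewrite idx Ia nuA.
have cC : #|~: A| = (n - sz)%N by rewrite cardsCs finset.setCK card_ord cA.
rewrite -cB -cC -cardsX.
have <- : (@sort_pair n) @: (finset.setX B (~: A)) = touching A.
  apply/setP => -[x y]; rewrite inE /=; apply/imsetP/and3P.
    move=> [[x' y']]; rewrite !inE /= /sort_pair /= => /andP[/andP[xA Ix] yA].
    have ne : x' != y' by apply: contraNneq yA => <-.
    case: ifP => h [-> ->]; split=> //.
    - by rewrite (negbTE yA) andbF.
    - by rewrite xA Ix.
    - by rewrite ltn_neqAle leqNgt h andbT; apply: contra ne => /eqP/val_inj ->.
    - by rewrite (negbTE yA).
    - by rewrite xA Ix orbT.
  move=> [xy nb]; case/orP => /andP[zA Iz].
    by exists (x, y); [rewrite !inE /= zA Iz; move: nb; rewrite zA|rewrite /sort_pair /= xy].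
  exists (y, x); first by rewrite !inE /= zA Iz; move: nb; rewrite zA andbT.
  by rewrite /sort_pair /= ltnNge (ltnW xy).
rewrite card_in_imset // => -[x y] [x' y']; rewrite !inE /= => /andP[/andP[xA _] yA] /andP[/andP[x'A _] y'A].
rewrite /sort_pair; case: ifP => _; case: ifP => _ [] /= h1 h2; rewrite ?h1 ?h2 //.
- by move: xA; rewrite h1 (negbTE y'A).
- by move: xA; rewrite h2 (negbTE y'A).
Qed.

Lemma prod_place_factor p n (A : {set 'I_n}) : #|A| = sz ->
  \prod_e place_factor p A e = place_prob p n.
Proof.
move=> cA; have [nu [nuE nuA nui nul nus]] := enum_fun cA.
have idx a : index (val (nu a)) (vals A) = a.
  by rewrite nuE index_uniq ?vals_uniq ?size_vals ?cA.
rewrite (bigID (fun e : 'I_n * 'I_n => (e.1 < e.2)%N)) /= [X in _ * X]big1 ?mulr1; last first.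
  by move=> e; apply: place_factor_ge.
rewrite (bigID (fun e : 'I_n * 'I_n => (e.1 \in A) && (e.2 \in A))) /=; congr (_ * _).
  rewrite /inside_prob.
  rewrite (eq_bigl (fun e => e \in (fun ab : 'I_sz * 'I_sz => (nu ab.1, nu ab.2)) @:
      [set ab : 'I_sz * 'I_sz | (ab.1 < ab.2)%N])); last first.
    move=> -[x y] /=; apply/and3P/imsetP => [[xy /nus[a ax] /nus[b by_]]|[[a b]]].
      by exists (a, b); rewrite ?inE /= -?nul ?ax ?by_.
    by rewrite inE /= => ab [-> ->]; rewrite !nuA nul.
  rewrite big_imset /=; last by move=> [a b] [a' b'] _ _ [/nui -> /nui ->].
  under eq_bigl do rewrite inE.
  apply: eq_bigr => -[a b] /= ab; rewrite place_factor_lt /= ?nul // /place_ok /= !nuA !idx.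
  by case: (M a b); rewrite ?mulr1 ?mulr0 ?addr0 ?add0r.
rewrite -(card_touching cA) -prodr_const.
rewrite (bigID (fun e => e \in touching A)) /= [X in _ * X]big1 ?mulr1.
  apply: eq_big => [e|e /andP[/andP[h1 h2] h3]].
    by rewrite inE; case: (e.1 < e.2)%N => //=; case: (~~ ((e.1 \in A) && (e.2 \in A))).
  rewrite place_factor_lt // /place_ok (negbTE h2).
  by move: h3; rewrite inE h1 h2 /= => ->; rewrite mulr0 mulr1 add0r.
move=> e /andP[/andP[h1 h2] h3]; rewrite place_factor_lt // /place_ok (negbTE h2).
by move: h3; rewrite inE h1 h2 /= => /negbTE ->; rewrite !mulr1 addrC subrK.
Qed.

Lemma placed_prob p n (A : {set 'I_n}) : #|A| = sz ->
  \sum_(f : sample n) er_mu p f * (placed f A)%:R = place_prob p n.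
Proof.
move=> cA; rewrite -(prod_place_factor p cA) /place_factor.
rewrite -(er_expectation p (fun (e : 'I_n * 'I_n) (b : bool) =>
  ((e.1 < e.2)%N ==> place_ok A e b)%:R)).
by apply: eq_bigr => f _; rewrite placedE.
Qed.

(* The conditions for [A] and for [A'] only interact on the pairs between [A] and [A']. *)
Lemma placed2_prob p n (A A' : {set 'I_n}) : 0 <= p <= 1 -> #|A| = sz -> #|A'| = sz ->
  [disjoint A & A'] ->
  (\sum_(f : sample n) er_mu p f * (placed f A && placed f A')%:R) * (1 - p) ^+ (sz * sz)
    <= place_prob p n ^+ 2.
Proof.
move=> p01 cA cA' dis; have /andP[p0 p1] := p01; have p1' : 0 <= 1 - p by rewrite subr_ge0.
have p1'' : 1 - p <= 1 by rewrite gerBl.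
pose cross := [set e : 'I_n * 'I_n | (e.1 < e.2)%N &&
  (((e.1 \in A) && (e.2 \in A')) || ((e.1 \in A') && (e.2 \in A)))].
have ccross : (#|cross| <= sz * sz)%N.
  have -> : (sz * sz)%N = #|finset.setX A A'| by rewrite cardsX cA cA'.
  apply: leq_trans (leq_imset_card (@sort_pair n) _); apply: subset_leq_card.
  apply/fintype.subsetP => -[x y]; rewrite inE /= => /andP[xy /orP[]/andP[h1 h2]]; apply/imsetP.
    by exists (x, y); rewrite ?inE /= ?h1 ?h2 // /sort_pair /= xy.
  by exists (y, x); rewrite ?inE /= ?h1 ?h2 // /sort_pair /= ltnNge (ltnW xy).
pose F (e : 'I_n * 'I_n) (b : bool) : R := ((e.1 < e.2)%N ==> place_ok A e b)%:R *
  ((e.1 < e.2)%N ==> place_ok A' e b)%:R.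
have -> : \sum_(f : sample n) er_mu p f * (placed f A && placed f A')%:R =
    \prod_e \sum_(b : bool) pair_weight p e b * F e b.
  rewrite -er_expectation; apply: eq_bigr => f _; congr (_ * _).
  by rewrite -mulnb natrM !placedE -big_split.
have w0 (e : 'I_n * 'I_n) b : 0 <= pair_weight p e b.
  by rewrite /pair_weight; case: ifP => // _; case: ifP.
have S0 e : 0 <= \sum_(b : bool) pair_weight p e b * F e b.
  by apply: sumr_ge0 => b _; rewrite mulr_ge0 // mulr_ge0.
(* When both placements forbid an edge on a cross pair, the joint probability is [1 - p] but the
   product of the separate ones is [(1 - p) ^+ 2]; one factor [1 - p] per cross pair makes up for
   it. *)
apply: (@le_trans _ _ (\prod_e ((\sum_(b : bool) pair_weight p e b * F e b) *
    (if e \in cross then 1 - p else 1)))).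
  rewrite big_split /=; apply: ler_wpM2l; first exact: prodr_ge0.
  by rewrite -big_mkcond prodr_const /= ler_wiXn2l.
rewrite expr2 -{1}(prod_place_factor p cA) -(prod_place_factor p cA') -big_split /=.
apply: ler_prod => e _; apply/andP; split.
  by apply: mulr_ge0 => //; case: ifP.
case: (boolP (e.1 < e.2)%N) => he; last first.
  rewrite !place_factor_ge // mulr1 inE (negbTE he) /= mulr1 -(sum_pair_weight p e).
  by apply: ler_sum => b _; rewrite /F (negbTE he) !mulr1.
rewrite !place_factor_lt // big_bool /pair_weight he /F he /= inE he /=.
have dA x : x \in A -> x \in A' = false.
  by move=> xA; apply/negbTE; have := disjointFr dis xA => ->.
rewrite /place_ok; case: e he => x y /= he.
have hp : 0 <= p * (1 - p) by apply: mulr_ge0.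
pose simp := (mulr0, mulr1, mul0r, mul1r, addr0, add0r).
case xA : (x \in A); case yA : (y \in A).
- rewrite (dA _ xA) (dA _ yA) /=.
  by case: (M (index _ _) (index _ _)); rewrite /= !simp; lra.
- rewrite (dA _ xA) /=; case: (y \in A') => /=; last first.
    by case: (I (index (val x) (vals A))); rewrite /= !simp; lra.
  by case: (I (index (val x) (vals A))); case: (I (index (val y) (vals A'))); rewrite /= !simp; lra.
- rewrite (dA _ yA) /=; case: (x \in A') => /=; last first.
    by case: (I (index (val y) (vals A))); rewrite /= !simp; lra.
  by case: (I (index (val y) (vals A))); case: (I (index (val x) (vals A'))); rewrite /= !simp; lra.
- rewrite /= !andbF /=; case: (x \in A'); case: (y \in A') => /=.
  + by case: (M (index _ _) (index _ _)); rewrite /= !simp; lra.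
  + by case: (I (index (val x) (vals A'))); rewrite /= !simp; lra.
  + by case: (I (index (val y) (vals A'))); rewrite /= !simp; lra.
  + by rewrite !simp; lra.
Qed.

End Placement.
End ERTypes.

(** * Exact counting of the Erdos-Renyi types by placements *)

Section ERCount.
Variable l : nat.
Local Notation sample n := {ffun 'I_n * 'I_n -> bool}.
Local Notation er_ball f v := (ball (er_graph f) l (fun _ : 'I_1 => v)).
Local Notation er_list := (er_ball_list l).
Local Notation er_typ := (er_ball_type l).
Local Notation er_inner := (er_ball_inner l).

Lemma mem_er_ball n (f : sample n) (v x : 'I_n) :
  (x \in er_ball f v) = within (er_graph f) l v x.
Proof. by rewrite -mem_vals -mem_er_list. Qed.

Lemma er_adj_sym n (f : sample n) phi a b : er_adj f phi a b = er_adj f phi b a.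
Proof.
rewrite /er_adj; case: (a < _)%N; case: (b < _)%N => //=.
by apply/existsP/existsP => -[[x y] /and3P[/(er_graph_simple f).1 h h1 h2]];
  exists (y, x); rewrite h h1 h2.
Qed.

Lemma er_adj_irr n (f : sample n) phi a : er_adj f phi a a = false.
Proof.
apply/negP => /and3P[_ _ /existsP[[x y] /and3P[h /eqP h1 /eqP h2]]].
by move: h; rewrite (_ : y = x) ?(negbTE ((er_graph_simple f).2 x)) //; apply: val_inj;
  rewrite /= in h1 h2 *; rewrite h1 h2.
Qed.

Section Transfer.
Variables (n0 : nat) (f0 : sample n0) (v0 : 'I_n0) (n : nat) (f : sample n).
Local Notation phi0 := (er_list f0 v0).
Local Notation M0 := (er_adj f0 phi0).
Local Notation I0 := (er_inner f0 v0 phi0).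
Local Notation sz := (size phi0).
Local Notation placed := (placed M0 I0 f).

Lemma er_typ_placed v : er_typ f v = er_typ f0 v0 -> #|er_ball f v| = sz /\ placed (er_ball f v).
Proof.
move=> [sE mE iE _]; split; first by rewrite -sE /er_ball_list size_vals.
apply/forallP => -[x y]; apply/implyP => /= xy; rewrite /place_ok /= -!/(er_list f v).
have inner z w : z \in er_ball f v -> I0 (index (val z) (er_list f v)) ->
    (z, w) \in er_graph f -> w \in er_ball f v.
  move=> zB; rewrite -iE => /and3P[_ l0 /existsP[u /andP[/eqP uE h]]] zw.
  rewrite mem_er_ball -(prednK l0); apply: within_edge zw.
  suff <- : u = z by [].
  by apply: val_inj; rewrite uE nth_index // mem_vals.
case xA : (x \in _); case yA : (y \in _) => //=.
- by rewrite -(er_graph_lt f xy) -mE /er_adj !index_mem !mem_vals xA yA /= !nth_index ?mem_vals // nedgeE.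
- rewrite orbF; case: ifP => // Ix; apply/negP => fxy; move: yA.
  by rewrite (inner x y) // er_graph_lt.
- case: ifP => // Iy; apply/negP => fxy; move: xA.
  by rewrite (inner y x) //; apply: (er_graph_simple f).1; rewrite er_graph_lt.
Qed.

(** No edge leaves the inner positions, so exploring from [v] up to distance [l] stays in [A], where
    the adjacency matrix reproduces the ball of [v0]. *)
Lemma placed_er_typ (A : {set 'I_n}) (v : 'I_n) : #|A| = sz -> placed A ->
  val v = nth 0%N (vals A) (index (val v0) phi0) -> er_ball f v = A /\ er_typ f v = er_typ f0 v0.
Proof.
move=> cA /forallP pl vE; set phi := vals A.
have sE : size phi = sz by rewrite size_vals.
have u : uniq phi by apply: vals_uniq.
have u0 : uniq phi0 by apply: vals_uniq.
have v0p : val v0 \in phi0 by rewrite mem_er_list within_refl.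
have iv0 : (index (val v0) phi0 < sz)%N by rewrite index_mem.
have edge x y : x \in A -> y \in A ->
    ((x, y) \in er_graph f) = M0 (index (val x) phi) (index (val y) phi).
  move=> xA yA; wlog xy : x y xA yA / (x <= y)%N.
    move=> h; case: (leqP x y) => [/h -> //|/ltnW yx]; rewrite er_adj_sym -h //.
    by apply/idP/idP; apply: (er_graph_simple f).1.
  move: xy; rewrite leq_eqVlt => /orP[/eqP/val_inj <-|xy].
    by rewrite er_adj_irr; apply/negbTE; apply: (er_graph_simple f).2.
  rewrite er_graph_lt //; have := pl (x, y); rewrite /= xy /= /place_ok /= xA yA /=.
  by move/eqP.
have inner x y : x \in A -> I0 (index (val x) phi) -> (x, y) \in er_graph f -> y \in A.
  move=> xA Ix; case yA : (y \in A) => //; rewrite er_edge => /andP[ne].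
  have := pl (sort_pair (x, y)); rewrite /sort_pair /=; case: ifP => xy /=.
    by rewrite xy /= /place_ok /= xA yA Ix /= => /negbTE ->.
  have -> : (y < x)%N.
    by rewrite ltn_neqAle leqNgt xy andbT; apply: contra ne => /eqP/val_inj ->.
  by rewrite /= /place_ok /= xA yA Ix /= => /negbTE ->.
have elt a : (a < sz)%N -> exists2 x : 'I_n, x \in A & val x = nth 0%N phi a.
  by rewrite -sE => ha; apply: valsP (mem_nth 0%N ha).
have elt0 a : (a < sz)%N -> exists2 x : 'I_n0, within (er_graph f0) l v0 x & val x = nth 0%N phi0 a.
  by move=> ha; have [x xA xE] := valsP (mem_nth 0%N ha); exists x; rewrite // -mem_er_list mem_vals.
have edge0 x y a b : (a < sz)%N -> (b < sz)%N -> val x = nth 0%N phi0 a -> val y = nth 0%N phi0 b ->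
    ((x, y) \in er_graph f0) = M0 a b.
  by move=> ha hb xE yE; rewrite /er_adj ha hb /= -xE -yE nedgeE.
have edge1 x y a b : (a < sz)%N -> (b < sz)%N -> val x = nth 0%N phi a -> val y = nth 0%N phi b ->
    ((x, y) \in er_graph f) = M0 a b.
  move=> ha hb xE yE.
  have xA : x \in A by rewrite -mem_vals xE mem_nth // sE.
  have yA : y \in A by rewrite -mem_vals yE mem_nth // sE.
  by rewrite (edge _ _ xA yA) xE yE !index_uniq ?sE.
have K i : (i <= l)%N -> forall y : 'I_n, within (er_graph f) i v y <->
    exists a (x : 'I_n0), [/\ (a < sz)%N, val y = nth 0%N phi a, val x = nth 0%N phi0 a &
       within (er_graph f0) i v0 x].
  elim: i => [|i IH] il y.
    split=> [/eqP <-|[a [x [ha yE xE /eqP vx]]]].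
      by exists (index (val v0) phi0), v0; rewrite nth_index //= eqxx.
    rewrite /= -val_eqE /= -/(val v) -/(val y) yE vE; apply/eqP; congr nth.
    by rewrite (_ : val v0 = nth 0%N phi0 a) ?index_uniq // -xE vx.
  split.
    case/orP => [/(IH (ltnW il))[a [x [ha ay ax h]]]|/existsP[w /andP[/(IH (ltnW il))]]].
      by exists a, x; split => //; apply: withinS.
    move=> [b [z [hb wE zE h]]] wy.
    have wA : w \in A by rewrite -mem_vals wE mem_nth // sE.
    have Ib : I0 (index (val w) phi).
      rewrite wE index_uniq // ?sE // /er_ball_inner hb (leq_ltn_trans (leq0n i) il) /=.
      apply/existsP; exists z; rewrite zE eqxx /=; apply: within_leq h.
      by rewrite -ltnS prednK // (leq_ltn_trans (leq0n i) il).
    have yA := inner w y wA Ib wy.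
    have iy : (index (val y) phi < sz)%N by rewrite -sE index_mem mem_vals.
    have yE : val y = nth 0%N phi (index (val y) phi) by rewrite nth_index // mem_vals.
    have [x _ xE] := elt0 _ iy.
    exists (index (val y) phi), x; split => //; apply: within_edge h _.
    by rewrite (edge0 _ _ b (index (val y) phi)) // -(edge1 w y).
  move=> [a [x [ha yE xE /= /orP[h|/existsP[z /andP[h zx]]]]]].
    by apply/orP; left; apply/(IH (ltnW il)); exists a, x.
  have zp : val z \in phi0 by rewrite mem_er_list; apply: within_leq h; apply: ltnW.
  have iz : (index (val z) phi0 < sz)%N by rewrite index_mem.
  have zE : val z = nth 0%N phi0 (index (val z) phi0) by rewrite nth_index.
  have [w wA wE] := elt _ iz.
  apply: (within_edge (w := w)); first by apply/(IH (ltnW il)); exists (index (val z) phi0), z.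
  by rewrite (edge1 _ _ (index (val z) phi0) a) // -(edge0 z x).
have bA : er_ball f v = A.
  apply/setP => y; rewrite mem_er_ball; apply/idP/idP => [/(K l (leqnn l))[a [x [ha yE _ _]]]|yA].
    by rewrite -mem_vals yE mem_nth // sE.
  have iy : (index (val y) phi < sz)%N by rewrite -sE index_mem mem_vals.
  have [x xw xE] := elt0 _ iy; apply/(K l (leqnn l)); exists (index (val y) phi), x.
  by rewrite nth_index // mem_vals.
split=> //; rewrite /er_ball_type /er_ball_list bA -/phi -/(er_list f0 v0) sE.
congr (_, _, _, _).
- apply/funext => a; apply/funext => b; rewrite /er_adj sE.
  case: (ltnP a sz) => //= ha; case: (ltnP b sz) => //= hb.
  have [x xA xE] := elt _ ha; have [y yA yE] := elt _ hb.
  rewrite -xE -yE nedgeE (edge1 x y a b) // /er_adj ha hb //.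
- apply/funext => a; rewrite /er_ball_inner sE; case: (ltnP a sz) => //= ha.
  have [x xA xE] := elt _ ha; have [x0 _ x0E] := elt0 _ ha; congr (_ && _).
  have ll : (l.-1 <= l)%N by apply: leq_pred.
  apply/existsP/existsP => [[w /andP[/eqP wE /(K _ ll)[b [z [hb wE' zE h]]]]]|[w /andP[/eqP wE h]]].
    exists z; rewrite h andbT zE; apply/eqP; congr nth.
    by apply/eqP; rewrite -(nth_uniq 0%N _ _ u) ?sE // -wE'; apply/eqP.
  exists x; rewrite xE eqxx /=; apply/(K _ ll); exists a, w; split => //.
- by rewrite vE index_uniq // sE.
Qed.

Lemma er_count : #|[set v : 'I_n | `[< er_typ f v = er_typ f0 v0 >]]| =
  (\sum_(A : {set 'I_n} | #|A| == sz) placed A)%N.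
Proof.
have v0p : val v0 \in phi0 by rewrite mem_er_list within_refl.
have iv0 : (index (val v0) phi0 < sz)%N by rewrite index_mem.
rewrite -big_mkcondr sum1dep_card /=.
rewrite -(card_in_imset (f := fun v : 'I_n => er_ball f v)).
  apply: eq_card => A; rewrite [RHS]inE; apply/imsetP/andP.
    move=> [v]; rewrite inE => /asboolP h ->; have [h1 h2] := er_typ_placed h.
    by rewrite h1 eqxx.
  move=> [/eqP cA pA].
  have ir : (index (val v0) phi0 < size (vals A))%N by rewrite size_vals cA.
  have [v vA vE] := valsP (mem_nth 0%N ir).
  have [h1 h2] := placed_er_typ cA pA vE.
  by exists v => //; rewrite inE; apply/asboolP.
move=> x y; rewrite !inE => -[_ _ _ ex] [_ _ _ ey] e; apply: val_inj.
have mem z : val z \in er_list f z by rewrite mem_er_list within_refl.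
by rewrite -(nth_index 0%N (mem x)) -(nth_index 0%N (mem y)) ex ey /er_ball_list e.
Qed.

End Transfer.

Lemma er_typ_fin D : exists L : seq (nat * (nat -> nat -> bool) * (nat -> bool) * nat),
  forall n (f : sample n) v, tame (er_graph f) (er_dg f) D l v -> er_typ f v \in L.
Proof.
pose K := (D.+1 ^ l.+1)%N.
have [L2 h2] := bounded_seqs [:: true; false] K.
have [L3 h3] := bounded_seqs L2 K.
pose decM (T : seq (seq bool)) : nat -> nat -> bool := fun a b => nth false (nth [::] T a) b.
pose decI (T : seq bool) : nat -> bool := fun a => nth false T a.
have [I hI] : exists I : seq nat, forall a, (a <= K)%N -> a \in I.
  by exists (iota 0 K.+1) => a; rewrite mem_iota add0n ltnS.
exists [seq (p, decI q.1, q.2) | p <- [seq (a, decM T) | a <- I, T <- L3],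
   q <- [seq (T, r) | T <- L2, r <- I]].
move=> n f v t; rewrite /er_ball_type; set phi := er_list f v.
have sK : (size phi <= K)%N.
  rewrite size_vals; apply: leq_trans (card_tame_ball (fun x => leqnn _) t).
  apply: subset_leq_card; apply/fintype.subsetP => x.
  by rewrite mem_er_ball inE => h; apply: withinS.
have bb (s : seq bool) : {subset s <= [:: true; false]} by move=> [] _; rewrite !inE.
pose TM := mkseq (fun a => mkseq (er_adj f phi a) (size phi)) (size phi).
pose TI := mkseq (er_inner f v phi) (size phi).
have ME : er_adj f phi = decM TM.
  apply/funext => a; apply/funext => b; rewrite /decM.
  case: (ltnP a (size phi)) => ha; last first.
    by rewrite (nth_default [::]) ?size_mkseq // nth_nil /er_adj ltnNge ha.
  rewrite nth_mkseq //; case: (ltnP b (size phi)) => hb; first by rewrite nth_mkseq.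
  by rewrite nth_default ?size_mkseq // /er_adj (ltnNge b) hb andbF.
have IE : er_inner f v phi = decI TI.
  apply/funext => a; rewrite /decI; case: (ltnP a (size phi)) => ha; first by rewrite nth_mkseq.
  by rewrite nth_default ?size_mkseq // /er_ball_inner ltnNge ha.
apply/allpairsP; exists ((size phi, decM TM), (TI, index (val v) phi)); split => /=.
- apply/allpairsP; exists (size phi, TM); split => //=; first exact: hI.
  apply: h3; first by rewrite size_mkseq.
  move=> r /mapP[a _ ->]; apply: h2; rewrite ?size_mkseq //; exact: bb.
- apply/allpairsP; exists (TI, index (val v) phi); split => //=.
    by apply: h2; rewrite ?size_mkseq //; exact: bb.
  by apply/hI/ltnW; rewrite (leq_trans _ sK) // index_mem mem_er_list within_refl.
- by rewrite -ME -IE.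
Qed.

End ERCount.

(** * Asymptotics of the first moment *)

Section ERLimits.
Variables (R : realType) (K : R).
Hypothesis K0 : 0 < K.
Local Open Scope classical_set_scope.

Definition er_p n : R := Num.min 1 (K / n%:R).

Lemma er_p01 n : 0 <= er_p n <= 1.
Proof. by rewrite /er_p le_min ler01 divr_ge0 ?ge_min ?lexx // ltW. Qed.

Lemma er_p_le n : er_p n * n%:R <= K.
Proof.
case: n => [|n]; first by rewrite mulr0 ltW.
by rewrite -ler_pdivlMr // /er_p ge_min lexx orbT.
Qed.

Lemma er_pE : exists N, forall n, (N <= n)%N -> (0 < n)%N /\ er_p n = K / n%:R.
Proof.
exists (Num.bound K).+1 => n hn; have n0 : (0 < n)%N by apply: leq_trans hn.
split => //; apply/min_idPr; rewrite ler_pdivrMr ?ltr0n // mul1r.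
apply: le_trans (ltW (archi_boundP (ltW K0))) _.
by rewrite ler_nat ltnW.
Qed.

Lemma cvg_inv : (fun n => n%:R^-1 : R) @ \oo --> 0.
Proof.
by rewrite -(cvg_shiftS (fun n => n%:R^-1 : R)); apply: cvg_invS.
Qed.

Lemma er_p_cvg0 : er_p @ \oo --> 0.
Proof.
have [N hN] := er_pE.
apply: (cvg_eventually (u := fun n => K * n%:R^-1) (N := N)) => [n /hN[_ -> //]|].
by rewrite -[X in _ --> X](mulr0 K); apply: cvgM cvg_inv; exact: cvg_cst.
Qed.

Lemma er_p_mean : (fun n => n%:R * er_p n) @ \oo --> K.
Proof.
have [N hN] := er_pE.
apply: (cvg_eventually (u := fun=> K) (N := N)) => [n /hN[n0 ->]|]; last exact: cvg_cst.
by rewrite mulrC divfK // pnatr_eq0 -lt0n.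
Qed.

Lemma er_q_cvg1 : (fun n => 1 - er_p n) @ \oo --> (1 : R).
Proof.
by rewrite -[X in _ --> X](subr0 (1 : R)); apply: cvgB er_p_cvg0; exact: cvg_cst.
Qed.

(** The powers are squeezed by [exp(-x/(1-x)) <= 1 - x <= exp(-x)] with [x = er_p n]. *)
Lemma er_q_exp : (fun n => (1 - er_p n) ^+ n) @ \oo --> expR (- K).
Proof.
have [N hN] := er_pE.
have low (x : R) : x < 1 -> expR (- (x / (1 - x))) <= 1 - x.
  move=> x1; have y0 : 0 < 1 - x by rewrite subr_gt0.
  rewrite expRN -[leRHS]invrK lef_pV2 ?posrE ?invr_gt0 ?expR_gt0 //.
  apply: le_trans (expR_ge1Dx _).
  suff -> : 1 + x / (1 - x) = (1 - x)^-1 by [].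
  by apply: (mulIf (lt0r_neq0 y0)); rewrite mulrDl divfK ?mulVf ?lt0r_neq0 //; lra.
have h2 : 0 < 2^-1 :> R by lra.
have [N1 hN1] := cvg_ex er_p_cvg0 h2.
pose g n := expR (- (n%:R * er_p n / (1 - er_p n))).
apply: (squeeze_cvgr (f := g) (h := fun=> expR (- K))); last exact: cvg_cst.
- exists (maxn N N1) => // n /=; rewrite geq_max => /andP[/hN[n0 pE] /hN1].
  rewrite subr0 => /ler_normlP[_ p2].
  have p1 : er_p n < 1 by lra.
  apply/andP; split.
    rewrite /g -mulrA -mulrN expRM_natl; apply: lerXn2r; rewrite ?nnegrE ?low //.
    by rewrite subr_ge0 ltW.
  have -> : - K = n%:R * (- er_p n) by rewrite pE mulrN mulrC divfK // pnatr_eq0 -lt0n.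
  rewrite expRM_natl; apply: lerXn2r; rewrite ?nnegrE.
  - by rewrite subr_ge0 ltW.
  - by rewrite ltW // expR_gt0.
  - exact: expR_ge1Dx.
- rewrite /g; apply: (@cvg_comp _ _ _ (fun n => - (n%:R * er_p n / (1 - er_p n))) expR _ (nbhs (- K)));
    last exact: continuous_expR.
  apply: cvgN; rewrite -[X in _ --> X](divr1 K); apply: cvgM; first exact: er_p_mean.
  by apply: cvgV; [exact: oner_neq0|exact: er_q_cvg1].
Qed.

Lemma er_q_exp_sub s : (fun n => (1 - er_p n) ^+ (n - s)) @ \oo --> expR (- K).
Proof.
have h2 : 0 < 2^-1 :> R by lra.
have [N1 hN1] := cvg_ex er_p_cvg0 h2.
apply: (cvg_eventually (u := fun n => (1 - er_p n) ^+ n / (1 - er_p n) ^+ s) (N := maxn s N1)).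
  move=> n; rewrite geq_max => /andP[sn /hN1]; rewrite subr0 => /ler_normlP[_ p2].
  have q0 : 1 - er_p n != 0 by rewrite gt_eqF //; lra.
  have -> : (1 - er_p n) ^+ n = (1 - er_p n) ^+ (n - s) * (1 - er_p n) ^+ s.
    by rewrite -exprD subnK.
  by rewrite mulfK // expf_neq0.
rewrite -[X in _ --> X]divr1; apply: cvgM; first exact: er_q_exp.
apply: cvgV; first exact: oner_neq0.
by have := cvgX (k := s) er_q_cvg1; rewrite expr1n.
Qed.

Lemma cvg_binomial s : (fun n => 'C(n, s)%:R / n%:R ^+ s : R) @ \oo --> ((s`!)%:R^-1 : R).
Proof.
have ff : (fun n => (n ^_ s)%:R / n%:R ^+ s : R) @ \oo --> (1 : R).
  elim: s => [|s IH].
    apply: (cvg_eventually (u := fun=> 1) (N := 0)) => [n _|]; last exact: cvg_cst.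
    by rewrite ffactn0 expr0 divr1.
  apply: (cvg_eventually (u := fun n => ((n ^_ s)%:R / n%:R ^+ s) * (1 - s%:R * n%:R^-1)) (N := s.+1)).
    move=> n sn; have n0 : n%:R != 0 :> R by rewrite pnatr_eq0 -lt0n (leq_trans _ sn).
    rewrite ffactnSr natrM natrB ?(ltnW sn) // exprSr invfM mulrACA; congr (_ * _).
    by rewrite mulrBl divff.
  have e1 : 1 * (1 - s%:R * 0) = 1 :> R by rewrite mulr0 subr0 mulr1.
  rewrite -[X in _ --> X]e1.
  apply: cvgM IH _; apply: cvgB; first exact: cvg_cst.
  by apply: cvgM cvg_inv; exact: cvg_cst.
apply: (cvg_eventually (u := fun n => (s`!)%:R^-1 * ((n ^_ s)%:R / n%:R ^+ s)) (N := 0)).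
  move=> n _; rewrite -bin_ffact natrM mulrA; congr (_ / _).
  by rewrite mulrC mulfK // pnatr_eq0 -lt0n fact_gt0.
by rewrite -[X in _ --> X]mulr1; apply: cvgM ff; exact: cvg_cst.
Qed.

Lemma cvg_pow_ratio (a b : nat) : (b <= a)%N -> exists c : R,
  (fun n => n%:R ^+ b * er_p n ^+ a) @ \oo --> c.
Proof.
(* As [0 ^+ 0 = 1], the limit is nonzero exactly for [a = b]; with [b = sz.-1] these are the balls
   that are trees. *)
move=> ba; exists (K ^+ b * 0 ^+ (a - b)).
rewrite (_ : (fun n => _) = (fun n => (n%:R * er_p n) ^+ b) \* (fun n => er_p n ^+ (a - b))).
  by apply: cvgM; apply: cvgX; [exact: er_p_mean|exact: er_p_cvg0].
by apply/funext => n /=; rewrite exprMn -mulrA -exprD subnKC.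
Qed.

Lemma inside_probE sz (M : nat -> nat -> bool) : exists a b : nat,
  forall p : R, inside_prob sz M p = p ^+ a * (1 - p) ^+ b.
Proof.
pose P (ab : 'I_sz * 'I_sz) := (ab.1 < ab.2)%N.
exists #|[pred ab | P ab && M (ab : 'I_sz * 'I_sz).1 ab.2]|,
  #|[pred ab | P ab && ~~ M (ab : 'I_sz * 'I_sz).1 ab.2]| => p.
rewrite /inside_prob (bigID (fun ab : 'I_sz * 'I_sz => M ab.1 ab.2)) /=; congr (_ * _).
  by rewrite -prodr_const; apply: eq_bigr => ab /andP[_ ->].
by rewrite -prodr_const; apply: eq_bigr => ab /andP[_ /negbTE ->].
Qed.

(* The number of edges cannot be below [sz - 1]: otherwise the quantity, which is bounded
   by 1 as the expectation of a frequency, would diverge. *)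
Lemma place_mean_cvg sz M I : (0 < sz)%N ->
  (forall n, 'C(n, sz)%:R * place_prob sz M I (er_p n) n / n%:R <= 1) ->
  exists q : R, (fun n => 'C(n, sz)%:R * place_prob sz M I (er_p n) n / n%:R) @ \oo --> q.
Proof.
move=> sz0 le1; have [a [b abE]] := inside_probE sz M.
pose F n : R := 'C(n, sz)%:R * place_prob sz M I (er_p n) n / n%:R.
suff : exists q : R, F @ \oo --> q by [].
pose i := ninner sz I.
(* The factors with a finite positive limit; what remains of [F] is [n ^+ sz.-1 * er_p n ^+ a],
   where [a] is the number of edges. *)
pose B n := 'C(n, sz)%:R / n%:R ^+ sz * (1 - er_p n) ^+ b * ((1 - er_p n) ^+ (n - sz)) ^+ i.
pose c := (sz`!)%:R^-1 * 1 * expR (- K) ^+ i.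
have c0 : 0 < c by rewrite mulr_gt0 // ?exprn_gt0 ?expR_gt0 // mulr1 invr_gt0 ltr0n fact_gt0.
have hB : B @ \oo --> c.
  apply: cvgM; last by apply: cvgX; exact: er_q_exp_sub.
  apply: cvgM; first exact: cvg_binomial.
  by have := cvgX (k := b) er_q_cvg1; rewrite expr1n.
have FE n : (0 < n)%N -> F n = B n * (n%:R ^+ sz.-1 * er_p n ^+ a).
  move=> n0; have n0' : n%:R != 0 :> R by rewrite pnatr_eq0 -lt0n.
  rewrite /F /B /place_prob abE -/i [(i * _)%N]mulnC exprM.
  have -> : n%:R ^+ sz = n%:R * n%:R ^+ sz.-1 :> R by rewrite -exprS prednK.
  rewrite invfM.
  have h : n%:R ^+ sz.-1 / n%:R ^+ sz.-1 = 1 :> R by rewrite divff // expf_neq0.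
  have gen (x1 x2 x3 x4 y z x : R) : y * z = 1 ->
      x3 * (x4 * x1 * x2) * x = x3 * (x * z) * x1 * x2 * (y * x4).
    by move=> yz; transitivity (x3 * (x4 * x1 * x2) * x * (y * z)); [rewrite yz mulr1|lra].
  exact: gen h.
case: (leqP sz.-1 a) => ha.
  have [d hd] := cvg_pow_ratio ha; exists (c * d).
  apply: (cvg_eventually (u := fun n => B n * (n%:R ^+ sz.-1 * er_p n ^+ a)) (N := 1)).
    by move=> n n0; rewrite FE.
  exact: cvgM hB hd.
exfalso; have d0 : (0 < sz.-1 - a)%N by rewrite subn_gt0.
pose G n := F n * (n%:R^-1) ^+ (sz.-1 - a).
have hG1 : G @ \oo --> c * K ^+ a.
  apply: (cvg_eventually (u := fun n => B n * (n%:R * er_p n) ^+ a) (N := 1)).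
    move=> n n0; have n0' : n%:R != 0 :> R by rewrite pnatr_eq0 -lt0n.
    rewrite /G FE // exprMn; set d := (sz.-1 - a)%N.
    have -> : n%:R ^+ sz.-1 = n%:R ^+ a * n%:R ^+ d :> R by rewrite -exprD subnKC // ltnW.
    have h : n%:R ^+ d * n%:R^-1 ^+ d = 1 :> R by rewrite -exprMn divff // expr1n.
    have gen (x y z t t' : R) : t * t' = 1 -> x * (y * z) = x * (y * t * z) * t'.
      by move=> tt; transitivity (x * (y * z) * (t * t')); [rewrite tt mulr1|lra].
    exact: gen h.
  by apply: cvgM => //; apply: cvgX; exact: er_p_mean.
have hG2 : G @ \oo --> 0.
  apply: (cvg0_le (v := fun n => n%:R^-1)); last exact: cvg_inv.
    move=> n; apply: mulr_ge0; last by rewrite exprn_ge0 // invr_ge0.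
    rewrite /F divr_ge0 // mulr_ge0 // /place_prob mulr_ge0 ?exprn_ge0 //.
      by apply: prodr_ge0 => ab _; case: ifP => _; have /andP[p0 p1] := er_p01 n; rewrite ?subr_ge0.
    by have /andP[p0 p1] := er_p01 n; rewrite subr_ge0.
  exists 1%N => n n0; rewrite /G -[leRHS]mul1r; apply: ler_pM.
  - rewrite /F divr_ge0 // mulr_ge0 // /place_prob mulr_ge0 ?exprn_ge0 //.
      by apply: prodr_ge0 => ab _; case: ifP => _; have /andP[p0 p1] := er_p01 n; rewrite ?subr_ge0.
    by have /andP[p0 p1] := er_p01 n; rewrite subr_ge0.
  - by rewrite exprn_ge0 // invr_ge0.
  - exact: le1.
  - rewrite -{2}[n%:R^-1]expr1; apply: ler_wiXn2l => //.
    by rewrite invf_le1 ?ltr0n // ler1n.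
have := cvg_unique _ hG1 hG2; move=> /(_ (@norm_hausdorff _ _)) e.
by have := mulr_gt0 c0 (exprn_gt0 a K0); rewrite e ltxx.
Qed.

End ERLimits.

(** * The second moment method *)

Section ERConclusion.
Variables (R : realType) (K : R).
Hypothesis K0 : 0 < K.
Local Notation sample n := {ffun 'I_n * 'I_n -> bool}.
Local Notation p := (er_p K).
Local Notation mu := (fun n (f : sample n) => er_mu (p n) f).

Lemma er_mu_er_p_ge0 n (f : sample n) : 0 <= er_mu (p n) f.
Proof. by apply: er_mu_ge0; apply: er_p01. Qed.

Lemma er_degree_UI n : Ex mu (fun f : sample n => \sum_v (er_dg f v)%:R * (er_dg f v)%:R)
  <= (K + K ^+ 2) * n%:R.
Proof.
by apply: er_degree_moment; [apply: er_p01|apply: er_p_le|apply: ltW].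
Qed.

Lemma er_reach_likely r (eps th : R) : 0 < eps -> 0 < th -> likely mu th (fun n (f : sample n) =>
  forall x, #|[set v | within (er_graph f) r v x]|%:R <= eps * n%:R).
Proof.
apply: (@reach_likely R (fun n => sample n) mu er_mu_er_p_ge0 _ (fun n (f : sample n) => er_graph f)
  (fun n (f : sample n) => er_dg f) _ _ (fun d => d%:R) (K + K ^+ 2)) => //.
- by move=> n; apply: er_mu_sum.
- by move=> n f; apply: er_graph_simple.
- by move=> d d'; rewrite ler_nat.
- move=> A; exists (Num.bound A); apply: le_trans (ler_norm _) _.
  by apply: le_trans (ltW (archi_boundP (normr_ge0 A))) _; rewrite ler_nat;
    rewrite /Num.bound normr_id.
- exact: er_degree_UI.
Qed.

Lemma Ex_affine n (a b c : R) (F G : sample n -> R) :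
  Ex mu (fun f => a * F f + b * G f + c) = a * Ex mu F + b * Ex mu G + c.
Proof.
rewrite /Ex -[X in _ = _ + X]mulr1 -[X in _ = _ + _ * X](er_mu_sum (p n) n) !mulr_sumr -!big_split /=.
by apply: eq_bigr => f _; lra.
Qed.

Section Realized.
Variables (l n0 : nat) (f0 : sample n0) (v0 : 'I_n0).
Local Notation phi0 := (er_ball_list l f0 v0).
Local Notation M0 := (er_adj f0 phi0).
Local Notation I0 := (er_ball_inner l f0 v0 phi0).
Local Notation sz := (size phi0).

Definition er_hits n (f : sample n) : R := \sum_(A : {set 'I_n} | #|A| == sz) (placed M0 I0 f A)%:R.

Lemma freq_er_hits n (f : sample n) :
  freq R (fun v => er_ball_type l f v = er_ball_type l f0 v0) = er_hits f / n%:R.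
Proof. by rewrite /freq er_count natr_sum. Qed.

Definition er_mean n : R := 'C(n, sz)%:R * place_prob sz M0 I0 (p n) n / n%:R.

Lemma Ex_er_hits n : Ex mu (@er_hits n) = 'C(n, sz)%:R * place_prob sz M0 I0 (p n) n.
Proof.
rewrite /Ex /er_hits; under eq_bigr do rewrite mulr_sumr.
rewrite exchange_big /= (eq_bigr (fun=> place_prob sz M0 I0 (p n) n)); last first.
  by move=> A /eqP cA; apply: placed_prob.
have -> : 'C(n, sz) = #|[set A : {set 'I_n} | #|A| == sz]| by rewrite card_draws card_ord.
rewrite -sum1_card natr_sum mulr_suml big_mkcond [RHS]big_mkcond /=.
by apply: eq_bigr => A _; rewrite inE; case: ifP => _; rewrite ?mul1r.
Qed.

Lemma er_mean_le1 n : er_mean n <= 1.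
Proof.
rewrite /er_mean -Ex_er_hits.
have -> : Ex mu (@er_hits n) / n%:R = Ex mu (fun f : sample n => er_hits f / n%:R).
  by rewrite /Ex mulr_suml; apply: eq_bigr => f _; rewrite mulrA.
rewrite -[leRHS](er_mu_sum (p n) n); apply: ler_sum => f _.
rewrite -freq_er_hits -[leRHS]mulr1 ler_wpM2l ?er_mu_er_p_ge0 //; exact: freq_le1.
Qed.

Lemma er_sz_gt0 : (0 < sz)%N.
Proof.
have v0p : val v0 \in phi0 by rewrite mem_er_list within_refl.
by case: (er_ball_list _ _ _) v0p.
Qed.

Definition er_apart n (f : sample n) : R :=
  \sum_(A : {set 'I_n} | #|A| == sz) \sum_(A' : {set 'I_n} | (#|A'| == sz) && [disjoint A & A'])
    (placed M0 I0 f A && placed M0 I0 f A')%:R.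

Definition er_close n (f : sample n) : R :=
  \sum_(A : {set 'I_n} | #|A| == sz) \sum_(A' : {set 'I_n} | (#|A'| == sz) && ~~ [disjoint A & A'])
    (placed M0 I0 f A && placed M0 I0 f A')%:R.

Lemma er_hits_sqr n (f : sample n) : er_hits f ^+ 2 = er_apart f + er_close f.
Proof.
rewrite /er_hits expr2 mulr_suml /er_apart /er_close -big_split /=; apply: eq_bigr => A _.
rewrite mulr_sumr (bigID (fun A' : {set 'I_n} => [disjoint A & A'])) /=.
by congr (_ + _); apply: eq_bigr => A' _; rewrite -natrM mulnb.
Qed.

Lemma Ex_er_apart n : Ex mu (@er_apart n) * (1 - p n) ^+ (sz * sz) <=
  ('C(n, sz)%:R * place_prob sz M0 I0 (p n) n) ^+ 2.
Proof.
rewrite /Ex /er_apart; under eq_bigr do rewrite mulr_sumr.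
rewrite exchange_big /= expr2 -!Ex_er_hits mulr_suml.
have PE : Ex mu (@er_hits n) = \sum_(A : {set 'I_n} | #|A| == sz) place_prob sz M0 I0 (p n) n.
  rewrite /Ex /er_hits; under eq_bigr do rewrite mulr_sumr.
  by rewrite exchange_big /=; apply: eq_bigr => A /eqP cA; apply: placed_prob.
rewrite !PE mulr_suml; apply: ler_sum => A /eqP cA.
under eq_bigr do rewrite mulr_sumr.
rewrite exchange_big /= mulr_suml mulr_sumr.
rewrite [leRHS](bigID (fun A' : {set 'I_n} => [disjoint A & A'])) /=.
have pp0 : 0 <= place_prob sz M0 I0 (p n) n.
  have /andP[p0 p1] := er_p01 K0 n.
  by rewrite /place_prob mulr_ge0 ?exprn_ge0 ?subr_ge0 // prodr_ge0 // => ab _; case: ifP; rewrite ?subr_ge0.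
apply: ler_wpDr; first by apply: sumr_ge0 => A' _; rewrite mulr_ge0.
apply: ler_sum => A' /andP[/eqP cA' dis]; rewrite -expr2.
exact: placed2_prob (er_p01 K0 n) cA cA' dis.
Qed.

(** Placed sets are balls, and the roots of two intersecting balls are within distance [l + l]; a
    pair of sets is determined by its roots. *)
Lemma er_close_le n (f : sample n) :
  er_close f <= \sum_v #|[set v' | within (er_graph f) (l + l) v' v]|%:R.
Proof.
have [sG _] := er_graph_simple f.
pose S := [set AA : {set 'I_n} * {set 'I_n} | [&& #|AA.1| == sz, #|AA.2| == sz,
   ~~ [disjoint AA.1 & AA.2], placed M0 I0 f AA.1 & placed M0 I0 f AA.2]].
have -> : er_close f = #|S|%:R.
  rewrite /er_close pair_big_dep /= -sum1_card natr_sum big_mkcond [RHS]big_mkcond /=.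
  apply: eq_bigr => -[A A'] _; rewrite inE /=.
  by case: (#|A| == sz); case: (#|A'| == sz); case: [disjoint _ & _]; case: (placed _ _ _ _) => //=;
    case: (placed _ _ _ _).
pose W := [set vv : 'I_n * 'I_n | within (er_graph f) (l + l) vv.2 vv.1].
have -> : \sum_v #|[set v' | within (er_graph f) (l + l) v' v]|%:R = #|W|%:R :> R.
  rewrite -natr_sum; congr (_%:R); rewrite -sum1_card.
  under eq_bigr do rewrite -sum1_card.
  by rewrite pair_big_dep /=; apply: eq_bigl => -[v v']; rewrite !inE.
rewrite ler_nat; pose B v := ball (er_graph f) l (fun _ : 'I_1 => v).
apply: (@leq_trans #|(fun vv : 'I_n * 'I_n => (B vv.1, B vv.2)) @: W|); last exact: leq_imset_card.
apply: subset_leq_card; apply/fintype.subsetP => -[A A']; rewrite inE /= => /and5P[/eqP cA /eqP cA' nd pA pA'].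
have v0p : val v0 \in phi0 by rewrite mem_er_list within_refl.
have root (C : {set 'I_n}) : #|C| = sz -> placed M0 I0 f C -> exists v, B v = C.
  move=> cC pC; have ir : (index (val v0) phi0 < size (vals C))%N by rewrite size_vals cC index_mem.
  have [v vC vE] := valsP (mem_nth 0%N ir).
  by exists v; case: (placed_er_typ cC pC vE).
have [v vA] := root A cA pA; have [v' vA'] := root A' cA' pA'.
apply/imsetP; exists (v, v'); last by rewrite /= vA vA'.
rewrite inE /=; move: nd; rewrite -vA -vA' => /pred0Pn[z /andP[/= h1 h2]].
rewrite !(mem_er_ball l) in h1 h2.
exact: within_trans h2 (within_sym sG h1).
Qed.

Lemma Ex_er_close (d : R) : 0 < d -> exists N, forall n, (N <= n)%N ->
  Ex mu (@er_close n) <= d * n%:R ^+ 2.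
Proof.
move=> d0; have d2 : 0 < d / 2 by lra.
have [N hN] := er_reach_likely (l + l) d2 d2; exists N => n /hN.
set A := (fun f : sample n => _) => hA.
have hA' : prob mu (fun f => ~ A f) <= d / 2 by rewrite (probC (fun n => er_mu_sum (p n) n)); lra.
(* Off the event [A], whose failure has probability at most [d / 2], the trivial bound [n ^+ 2]
   suffices. *)
have pw f : er_close f <= d / 2 * n%:R ^+ 2 + n%:R ^+ 2 * (`[< ~ A f >])%:R.
  apply: le_trans (er_close_le f) _; case: (pselect (A f)) => Af.
    rewrite asboolF ?mulr0 ?addr0; last by apply.
    apply: (@le_trans _ _ (\sum_(v < n) d / 2 * n%:R)); first by apply: ler_sum => v _; apply: Af.
    by rewrite sumr_const card_ord -[leLHS]mulr_natr expr2 mulrA.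
  rewrite asboolT // mulr1; apply: ler_wpDl; first by rewrite mulr_ge0 ?exprn_ge0 // ltW.
  apply: (@le_trans _ _ (\sum_(v < n) n%:R)).
    by apply: ler_sum => v _; rewrite ler_nat -[leqRHS]card_ord max_card.
  by rewrite sumr_const card_ord -[leLHS]mulr_natr expr2.
apply: (@le_trans _ _ (Ex mu (fun f : sample n => 0 * 0 + n%:R ^+ 2 * (`[< ~ A f >])%:R + d / 2 * n%:R ^+ 2))).
  by apply: (Ex_le er_mu_er_p_ge0) => f; rewrite mul0r add0r addrC.
rewrite (Ex_affine 0 (n%:R ^+ 2) (d / 2 * n%:R ^+ 2) (fun=> 0)) mul0r add0r.
have -> : Ex mu (fun f => (`[< ~ A f >])%:R) = prob mu (fun f => ~ A f).
  rewrite /Ex /prob [RHS]big_mkcond; apply: eq_bigr => f _.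
  by case: `[< _ >]; rewrite ?mulr1 ?mulr0.
have : n%:R ^+ 2 * prob mu (fun f => ~ A f) <= n%:R ^+ 2 * (d / 2).
  by apply: ler_wpM2l; rewrite ?exprn_ge0.
lra.
Qed.

Lemma er_hits_conv : exists q,
  conv_prob mu (fun n (f : sample n) => freq R (fun v => er_ball_type l f v = er_ball_type l f0 v0)) q.
Proof.
have [q hq] := place_mean_cvg K0 er_sz_gt0 er_mean_le1.
exists q => eps th e0 t0; pose d := eps ^+ 2 * th.
have d0 : 0 < d by rewrite mulr_gt0 // exprn_gt0.
have d2 : 0 < d / 2 by lra.
have [N1 hN1] := Ex_er_close d2.
(* A bound for the mean of [(freq - q) ^+ 2] without the intersecting pairs; it tends to
   [q ^+ 2 - 2 * q ^+ 2 + q ^+ 2 = 0]. *)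
pose u n : R := er_mean n ^+ 2 / (1 - p n) ^+ (sz * sz) - 2 * q * er_mean n + q ^+ 2.
have hu : (u @ \oo --> (0 : R))%classic.
  have e1 : q ^+ 2 / 1 - 2 * q * q + q ^+ 2 = 0 :> R by rewrite divr1; lra.
  rewrite -e1; apply: cvgD; last exact: cvg_cst.
  apply: cvgB; last by apply: cvgM => //; exact: cvg_cst.
  apply: cvgM; first exact: cvgX.
  apply: cvgV; first exact: oner_neq0.
  by have := cvgX (k := (sz * sz)%N) (er_q_cvg1 K0); rewrite expr1n.
have [N2 hN2] := cvg_ex hu d2.
have h2 : 0 < 2^-1 :> R by lra.
have [N3 hN3] := cvg_ex (er_p_cvg0 K0) h2.
have l1 : likely mu th (fun n (f : sample n) => (er_hits f / n%:R - q) ^+ 2 <= eps ^+ 2).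
  apply: (likely_markov er_mu_er_p_ge0 (fun n => er_mu_sum (p n) n) (N := (N1 + N2 + N3).+1)).
  - by move=> n f; apply: sqr_ge0.
  - by rewrite exprn_gt0.
  move=> n nN; rewrite -/d.
  have n0' : 0 < n%:R :> R by rewrite ltr0n; apply: leq_trans nN.
  have hc := hN1 n (ltac:(lia)); have := hN2 n (ltac:(lia)); have := hN3 n (ltac:(lia)).
  rewrite !subr0 => /ler_normlP[_ p2] /ler_normlP[_ hun].
  have q0 : 0 < (1 - p n) ^+ (sz * sz) by rewrite exprn_gt0 //; lra.
  have -> : Ex mu (fun f : sample n => (er_hits f / n%:R - q) ^+ 2) =
      n%:R ^- 2 * (Ex mu (@er_apart n) + Ex mu (@er_close n)) - 2 * q * er_mean n + q ^+ 2.
    rewrite /er_mean -Ex_er_hits.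
    transitivity (Ex mu (fun f : sample n => n%:R ^- 2 * (er_hits f ^+ 2) +
        (- (2 * q / n%:R)) * er_hits f + q ^+ 2)).
      apply: eq_bigr => f _; congr (_ * _); rewrite sqrrB expr_div_n; lra.
    rewrite Ex_affine; congr (_ + _); congr (_ + _); last by move: (n%:R^-1) => z; lra.
    congr (_ * _).
    rewrite /Ex -big_split /=; apply: eq_bigr => f _; by rewrite er_hits_sqr mulrDr.
  have h1 : n%:R ^- 2 * Ex mu (@er_close n) <= d / 2.
    by rewrite mulrC ler_pdivrMr // exprn_gt0.
  have h3 : n%:R ^- 2 * Ex mu (@er_apart n) <= er_mean n ^+ 2 / (1 - p n) ^+ (sz * sz).
    rewrite ler_pdivlMr // /er_mean expr_div_n -mulrA [leRHS]mulrC.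
    apply: ler_wpM2l; first by rewrite invr_ge0 exprn_ge0 // ltW.
    exact: Ex_er_apart.
  rewrite /u in hun; lra.
apply: (likely_mono er_mu_er_p_ge0 (N := 0) _ l1) => n f _; rewrite freq_er_hits.
by rewrite -[X in X <= _]real_normK ?num_real // ler_pXn2r ?nnegrE // ltW.
Qed.

End Realized.

Lemma er_typ_conv l t : exists q,
  conv_prob mu (fun n (f : sample n) => freq R (fun v => er_ball_type l f v = t)) q.
Proof.
case: (pselect (exists n (f : sample n) v, er_ball_type l f v = t)) => [[n [f [v <-]]]|nreal].
  exact: er_hits_conv.
exists 0; apply: (conv_prob_cst (fun n => er_mu_sum (p n) n)) => n f.
rewrite freqE big1 ?mul0r // => v _; rewrite asboolF // => h.
by apply: nreal; exists n, f, v.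
Qed.

Theorem ER_local_limit_extension (k : nat) (T : crg k) (l : nat) :
  exists q : set (crg k.+1) -> R,
    (forall T' : crg k.+1, extends T T' ->
       0 <= q (iso_class T') <= 1 /\
       forall eps theta : R, 0 < eps -> 0 < theta ->
         likely mu theta (fun n (f : sample n) => forall u : 'I_k -> 'I_n,
           nbhd_iso (er_graph f) l u T ->
               `| (#|[set v : 'I_n | `[< nbhd_iso (er_graph f) l (ext_roots u v) T' >]]|%:R / n%:R)
                  - q (iso_class T') | < eps))
    /\ (\esum_(C in Ext T) (q C)%:E = 1)%E.
Proof.
apply: (@local_limit_extension R (fun n => sample n) mu er_mu_er_p_ge0 (fun n => er_mu_sum (p n) n)
  (fun n (f : sample n) => er_graph f) (fun n (f : sample n) => er_dg f) _ _
  (fun d => d%:R) (K + K ^+ 2) _ _ _ er_degree_UI l _ (fun n (f : sample n) v => er_ball_type l f v)) => //.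
- by move=> n f; apply: er_graph_simple.
- by move=> d d'; rewrite ler_nat.
- move=> A; exists (Num.bound A); apply: le_trans (ler_norm _) _.
  by apply: le_trans (ltW (archi_boundP (normr_ge0 A))) _; rewrite ler_nat;
    rewrite /Num.bound normr_id.
- by move=> n n' c c' v v'; apply: er_typ_iso.
- exact: er_typ_conv.
- exact: er_typ_fin.
Qed.

End ERConclusion.

Theorem mainTheorem8 (R : realType) (M : model R) (hM : model_ok M)
  (k : nat) (T : crg k) (l : nat) :
  exists q : set (crg k.+1) -> R,
    (forall T' : crg k.+1, extends T T' ->
       0 <= q (iso_class T') <= 1 /\
       forall eps theta : R, 0 < eps -> 0 < theta ->
         exists N : nat, forall n : nat, (N <= n)%N ->
           1 - theta <=
           Pr M n (fun G : graph n =>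
             forall u : 'I_k -> 'I_n, nbhd_iso G l u T ->
               `| (#|[set v : 'I_n | `[< nbhd_iso G l (ext_roots u v) T' >]]|%:R / n%:R)
                  - q (iso_class T') | < eps))
    /\ (\esum_(C in Ext T) (q C)%:E = 1)%E.
Proof.
case: M hM => [K K0|m m0] /=; last first.
  have [q [hq sq]] := BA_local_limit_extension R m0 T l.
  by exists q.
have [q [hq sq]] := ER_local_limit_extension K0 T l; exists q; split => // T' eT.
have [q01 hT] := hq T' eT; split=> // eps th e0 t0.
have [N hN] := hT eps th e0 t0; exists N => n nN.
by rewrite er_transfer; apply: hN.
Qed.
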